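(* Let $0<\alpha<1$, $\theta>0$, and let $H$ be a probability measure on $(0,\infty)$. Suppose $L$ is GGC$(\alpha\theta,\varrho_{\alpha,H})$. Then there exists a random variable $R$ with distribution $H$, independent of $X_\alpha$, such that $R^{1/\alpha}X_\alpha$ has density $\varrho_{\alpha,H}$ and $L$ has Lévy measure $$\alpha\theta\,s^{-1}\,\mathbb{E}\big[e^{-s/[R^{1/\alpha}X_\alpha]}\big]\,ds,\qquad s>0.$$ Correspondingly, $\tilde L$, the exponential tilt of $L$ with $c=1$ (the random variable with density proportional to $e^{-x}f_L(x)$, $f_L$ the density of $L$), is GGC$(\alpha\theta,\Lambda_{\alpha,H})$ and has Lévy measure $$\alpha\theta\,s^{-1}\,\mathbb{E}\big[e^{-s/A_{\alpha,\xi}}\big]\,ds,\qquad s>0,$$ where $\xi/(1-\xi)\overset{d}{=}R$ and $A_{\alpha,\xi}\overset{d}{=}R^{1/\alpha}X_\alpha/(R^{1/\alpha}X_\alpha+1)$ has distribution $\Lambda_{\alpha,H}$. Hence in this setting $A^{(\alpha,\alpha\theta)}_{\alpha,\xi_\theta}\overset{d}{=}M_{\alpha\theta}(\Lambda_{\alpha,H})$ and $\xi_\theta\overset{d}{=}M_\theta(H^{(1,1)})$ are Dirichlet mean functionals.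
   Context: $X_\alpha\overset{d}{=}S_\alpha/S_\alpha'$ with $S_\alpha,S'_\alpha$ independent positive $\alpha$-stable, $\mathbb{E}[e^{-\lambda S_\alpha}]=e^{-\lambda^\alpha}$. For a probability measure $K$ on $[0,\infty)$ with $\int\log(1+x)K(dx)<\infty$ (standing assumption, for $H$ in particular) and $\tau>0$: $M_\tau(K)$ (''Dirichlet mean functional'') is the mean of a Dirichlet process with shape $\tau K$, characterized by $\mathbb{E}[(1+\lambda M_\tau(K))^{-\tau}]=\exp(-\tau\int\log(1+\lambda x)K(dx))$; GGC$(\tau,K)$ is the law with Laplace transform $\exp(-\tau\int\log(1+\lambda x)K(dx))$. Define $\varrho_{\alpha,H}(x)=\frac{\sin(\pi\alpha)}{\pi}\int_0^\infty\frac{x^{\alpha-1}r}{x^{2\alpha}+2x^\alpha r\cos(\alpha\pi)+r^2}H(dr)$, $x>0$. For $0<p<1$, $\Lambda_{\alpha,p}$ is the law of $\frac{(p/(1-p))^{1/\alpha}X_\alpha}{1+(p/(1-p))^{1/\alpha}X_\alpha}$, and $\Lambda_{\alpha,H}(dx)=\int_0^\infty\Lambda_{\alpha,r/(1+r)}(dx)H(dr)$. $H^{(1,1)}$ is the law of $R/(R+1)$ when $R\sim H$. $\xi_\theta$ is the $[0,1]$-valued variable whose law is proportional to $(1-u)^\theta\tilde Q(du)$, with $\tilde Q$ the law of $M_\theta(H)/(M_\theta(H)+1)$. For a $[0,1]$-valued $\xi$ independent of $X_\alpha$, $A_{\alpha,\xi}\overset{d}{=}\frac{\xi^{1/\alpha}X_\alpha}{\xi^{1/\alpha}X_\alpha+(1-\xi)^{1/\alpha}}$.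 For $0<p<1$, $A^{(\alpha,\alpha\theta)}_{\alpha,p}$ (time spent positive up to time 1 by a $p$-skewed generalized Bessel bridge) has law on $[0,1]$ characterized by $\mathbb{E}[(1+\lambda A^{(\alpha,\alpha\theta)}_{\alpha,p})^{-\alpha\theta}]=(1-p+p(1+\lambda)^\alpha)^{-\theta}$; $A^{(\alpha,\alpha\theta)}_{\alpha,\xi_\theta}$ has, conditionally on $\xi_\theta=p$, the law of $A^{(\alpha,\alpha\theta)}_{\alpha,p}$. *)

(* Defs.v *)
From HB Require Import structures.
From mathcomp Require Import all_boot all_order all_algebra.
From mathcomp Require Import all_classical all_reals all_analysis.
From mathcomp Require Import measurable_realfun ring.

Set Implicit Arguments.
Unset Strict Implicit.
Unset Printing Implicit Defensive.

Import Order.TTheory GRing.Theory Num.Def Num.Theory.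
Import numFieldNormedType.Exports.

Local Open Scope classical_set_scope.
Local Open Scope ring_scope.
Local Open Scope ereal_scope.

(* Laws of real random variables.  A measure is a total function on sets, with
   unspecified values on non-measurable ones, so that laws are only ever
   compared on measurable sets. *)

Section laws.
Context {R : realType} {d : measure_display} {T : measurableType d}.
Variable P : probability T R.
Implicit Types X Y : T -> R.

Definition has_law X (mu : set R -> \bar R) :=
  forall A : set R, measurable A -> P (X @^-1` A) = mu A.

Definition same_law X {d' : measure_display} {T' : measurableType d'}
    (P' : probability T' R) (Y : T' -> R) :=
  has_law X (pushforward P' Y).

Definition has_density X (f : R -> \bar R) :=
  forall A : set R, measurable A ->
    P (X @^-1` A) = \int[lebesgue_measure]_(x in A) f x.

Definition independent X Y :=
  forall A B : set R, measurable A -> measurable B ->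
    P ((X @^-1` A) `&` (Y @^-1` B)) = P (X @^-1` A) * P (Y @^-1` B).

(* The law of X is proportional to w(x) mu(dx). *)
Definition law_proportional X (w : R -> R) (mu : {measure set R -> \bar R}) :=
  exists2 c : R, (0 < c)%R &
    forall A : set R, measurable A ->
      P (X @^-1` A) = c%:E * \int[mu]_(x in A) (w x)%:E.

(* k is a regular conditional law of X given Y. *)
Definition conditional_law X (Y : {RV P >-> R}) (k : R.-pker R ~> R) :=
  forall A B : set R, measurable A -> measurable B ->
    P ((Y @^-1` B) `&` (X @^-1` A)) = \int[distribution P Y]_(p in B) k p A.

End laws.
Arguments conditional_law {R d T} P X Y k.

Section definitions.
Context {R : realType}.
Implicit Types (alpha theta tau p : R) (K : {measure set R -> \bar R}).

Definition log_transform K (lambda : R) : \bar R :=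
  \int[K]_(x in `[0%R, +oo[) (ln (1 + lambda * x))%:E.

(* Standing assumption on the base measures of GGC and Dirichlet mean laws. *)
Definition base_measure K :=
  [/\ K setT = 1, K `[0%R, +oo[%classic = 1 & log_transform K 1 < +oo].

Section random_variables.
Context {d : measure_display} {T : measurableType d}.
Variable P : probability T R.
Implicit Types X Y : T -> R.

Definition positive_stable alpha X :=
  P [set t | (0 < X t)%R] = 1 /\
  forall lambda : R, (0 <= lambda)%R ->
    'E_P[fun t => expR (- (lambda * X t))] = (expR (- (lambda `^ alpha)))%:E.

Definition GGC tau K X :=
  P [set t | (0 <= X t)%R] = 1 /\
  forall lambda : R, (0 <= lambda)%R ->
    'E_P[fun t => expR (- (lambda * X t))] =
    expeR (- (tau%:E * log_transform K lambda)).

(* X has the law of M_tau(K), through the Cifarelli-Regazzini identity that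
   characterizes the mean of a Dirichlet process with shape tau K. *)
Definition dirichlet_mean tau K X :=
  P [set t | (0 <= X t)%R] = 1 /\
  forall lambda : R, (0 <= lambda)%R ->
    'E_P[fun t => ((1 + lambda * X t) `^ (- tau))%R] =
    expeR (- (tau%:E * log_transform K lambda)).

(* Lévy-Khintchine representation of a nonnegative, driftless infinitely
   divisible X, whose Lévy measure is l(s) ds on (0, +oo). *)
Definition has_levy_density X (l : R -> \bar R) :=
  let D : set R := `]0%R, +oo[%classic in
  [/\ measurable_fun D l,
      forall s, D s -> 0 <= l s,
      \int[lebesgue_measure]_(s in D) ((minr 1 s)%:E * l s) < +oo &
      forall lambda : R, (0 <= lambda)%R ->
        'E_P[fun t => expR (- (lambda * X t))] =
        expeR (- \int[lebesgue_measure]_(s in D)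
                   ((1 - expR (- (lambda * s)))%:E * l s))].

(* Used for almost surely positive Y: in mathcomp s / 0 = 0, so that the null
   event Y = 0 would contribute 1 instead of exp(- oo). *)
Definition thorin_levy_density (kappa : R) Y (s : R) : \bar R :=
  (kappa / s)%:E * 'E_P[fun t => expR (- (s / Y t))].

(* A_{alpha,xi} as a function of xi and X_alpha. *)
Definition occupation_ratio alpha (xi X : T -> R) (t : T) : R :=
  (xi t `^ alpha^-1 * X t / (xi t `^ alpha^-1 * X t + (1 - xi t) `^ alpha^-1))%R.

End random_variables.

(* X has the law of X_alpha. *)
Definition stable_ratio alpha {d : measure_display} {T : measurableType d}
    (P : probability T R) (X : T -> R) :=
  exists (d' : measure_display) (T' : measurableType d')
      (P' : probability T' R) (S S' : {RV P' >-> R}),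
    [/\ positive_stable P' alpha S, positive_stable P' alpha S',
        independent P' S S' & same_law P X P' (fun t => S t / S' t)%R].

(* The tilt acts on the law itself, so that no density need be chosen: if L has
   density f, then Lt has density proportional to exp(- c x) f x, see
   [exp_tilt_density] below. *)
Definition exp_tilt (c : R) {d : measure_display} {T : measurableType d}
    (P : probability T R) (L : {RV P >-> R})
    {d' : measure_display} {T' : measurableType d'}
    (P' : probability T' R) (Lt : T' -> R) :=
  law_proportional P' Lt (fun x => expR (- (c * x))) (distribution P L).

(* The law of A^(alpha, alpha theta)_{alpha,p}. *)
Definition bridge_occupation_law alpha theta p
    (mu : {measure set R -> \bar R}) :=
  mu `[0%R, 1%R]%classic = 1 /\
  forall lambda : R, (0 <= lambda)%R ->
    \int[mu]_x ((1 + lambda * x) `^ (- (alpha * theta)))%R%:E =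
    ((1 - p + p * (1 + lambda) `^ alpha) `^ (- theta))%R%:E.

End definitions.
Arguments exp_tilt {R} c {d T} P L {d' T'} P' Lt.


Section integral_density.
Context {d : measure_display} {Y : measurableType d} {R : realType}.
Variables (mu nu : {measure set Y -> \bar R}) (f : Y -> R).
Hypotheses (f0 : forall x, (0 <= f x)%R) (mf : measurable_fun [set: Y] f).
Hypothesis nuE : forall A, measurable A -> nu A = \int[mu]_(x in A) (f x)%:E.

Import HBNNSimple.

Lemma integral_density (w : Y -> R) (A : set Y) : measurable A ->
  (forall x, (0 <= w x)%R) -> measurable_fun [set: Y] w ->
  \int[nu]_(x in A) (w x)%:E = \int[mu]_(x in A) (w x * f x)%:E.
Proof.
move=> mA w0 mw.
have mwA : measurable_fun A (EFin \o w).
  by apply/measurable_EFinP; exact: measurable_funTS.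
have w0A x : A x -> 0 <= (EFin \o w) x by rewrite lee_fin.
pose h := nnsfun_approx mA mwA.
have -> : \int[nu]_(x in A) (w x)%:E =
    lim (\int[nu]_(x in A) (EFin \o h n) x @[n --> \oo]).
  have fE x : A x -> (w x)%:E = lim ((EFin \o h n) x @[n --> \oo]).
    by move=> Ax; apply/esym/cvg_lim => //; exact: (cvg_nnsfun_approx mA mwA w0A).
  under eq_integral => x /[!inE] /fE -> //.
  apply: monotone_convergence => //.
  - move=> n; apply/measurable_EFinP.
    by apply: (measurable_funS measurableT) => //; exact/measurable_funP.
  - by move=> n x Ex //=; rewrite lee_fin.
  - by move=> x Ex a b ab; rewrite lee_fin; exact/lefP/(nd_nnsfun_approx mA mwA).
have -> : \int[mu]_(x in A) (w x * f x)%:E =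
    lim (\int[mu]_(x in A) ((EFin \o h n) x * (f x)%:E) @[n --> \oo]).
  have fg x : A x ->
      (w x * f x)%:E = lim ((EFin \o h n) x * (f x)%:E @[n --> \oo]).
    move=> Ax; apply/esym/cvg_lim => //; rewrite EFinM.
    by apply: cvgeZr => //; exact: (cvg_nnsfun_approx mA mwA w0A).
  under eq_integral => x /[!inE] /fg -> //.
  apply: monotone_convergence => [//| | |].
  - move=> n; apply/emeasurable_funM; apply/measurable_funTS.
      exact/measurable_EFinP/measurable_funP.
    exact/measurable_EFinP.
  - by move=> n x Ax /=; rewrite mule_ge0 ?lee_fin.
  - by move=> x Ax a b ab/=; rewrite lee_wpmul2r ?lee_fin//;
      exact/lefP/(nd_nnsfun_approx mA mwA).
suff suf n : \int[mu]_(x in A) ((EFin \o h n) x * (f x)%:E) =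
    \int[nu]_(x in A) (EFin \o h n) x.
  by under [in RHS]eq_fun do rewrite suf.
transitivity (\int[nu]_(x in A)
   (\sum_(y \in range (h n)) (y * \1_(h n @^-1` [set y]) x)%:E)); last first.
  by apply: eq_integral => t tE; rewrite /= fimfunE -fsumEFin.
have indich m r :
    measurable_fun A (fun x => (r * \1_(h m @^-1` [set r]) x)%:E).
  by apply: (measurable_comp measurableT) => //; exact: measurable_funM.
rewrite ge0_integral_fsum//; last by move=> m y Ey; exact: nnfun_muleindic_ge0.
transitivity (\int[mu]_(x in A) (\sum_(y \in range (h n))
    (y * \1_(h n @^-1` [set y]) x)%:E * (f x)%:E)).
  under [RHS]eq_integral => x xE.
    rewrite -ge0_mule_fsuml => [|y]; last exact: nnfun_muleindic_ge0.
    rewrite fsumEFin // -(fimfunE _ x); over.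
  by [].
have mfA : measurable_fun A (EFin \o f).
  by apply/measurable_EFinP; exact: measurable_funTS.
rewrite ge0_integral_fsum//; last 2 first.
  - by move=> y; apply: emeasurable_funM.
  - by move=> m y Ey; rewrite mule_ge0 ?lee_fin// -?lee_fin nnfun_muleindic_ge0.
apply: eq_fsbigr => r /set_mem [x _ <-{r}].
have mhx : measurable (h n @^-1` [set h n x]) by [].
have hx0 : (0 <= h n x)%R by exact: fun_ge0.
under eq_integral do rewrite EFinM -muleA.
under [RHS]eq_integral do rewrite EFinM.
have mI : measurable_fun A
    (fun y => (\1_(h n @^-1` [set h n x]) y)%:E : \bar R).
  exact/measurable_EFinP/measurable_funTS.
have mIf : measurable_fun A
    (fun y => (\1_(h n @^-1` [set h n x]) y)%:E * (f y)%:E).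
  exact: emeasurable_funM.
have If0 y : A y -> 0 <= (\1_(h n @^-1` [set h n x]) y)%:E * (f y)%:E.
  by move=> _; rewrite mule_ge0 ?lee_fin.
rewrite !ge0_integralZl//; congr *%E.
rewrite integral_indic// nuE; last exact: measurableI.
rewrite setIC integral_mkcondr; apply: eq_integral => y _.
by rewrite patchE indicE; case: ifPn; rewrite ?mul1e ?mul0e.
Qed.

End integral_density.

Section exp_tilt_density.
Context {R : realType} {d : measure_display} {T : measurableType d}.
Variables (P : probability T R) (L : {RV P >-> R}) (f : R -> R).
Hypotheses (f0 : forall x, (0 <= f x)%R) (mf : measurable_fun [set: R] f).
Hypothesis Lf : has_density P L (EFin \o f).

Lemma exp_tilt_density (c : R) {d' : measure_display} {T' : measurableType d'}
    (P' : probability T' R) (Lt : T' -> R) : exp_tilt c P L P' Lt ->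
  exists2 c' : R, (0 < c')%R &
    has_density P' Lt (fun x => (c' * (expR (- (c * x)) * f x))%:E).
Proof.
have mw : measurable_fun [set: R] (fun x : R => expR (- (c * x)))%R.
  by apply: measurableT_comp => //; apply: measurableT_comp => //;
    exact: measurable_funM.
have w0 (x : R) : (0 <= expR (- (c * x)))%R by exact: expR_ge0.
case=> c' c'0 LtE; exists c' => // A mA.
pose L' : T -> measurableTypeR R := L.
have mL' : measurable_fun [set: T] L' by exact: (measurable_funPT L).
pose nu : {measure set (measurableTypeR R) -> \bar R} :=
  distribution P (HB.pack_for {mfun T >-> measurableTypeR R} L'
    (isMeasurableFun.Build _ _ _ _ _ mL')).
have tilt_nu : \int[distribution P L]_(x in A) (expR (- (c * x)))%:E =
    \int[nu]_(x in A) (expR (- (c * x)))%:E.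
  have mwA : measurable_fun A (fun x : R => (expR (- (c * x)))%:E).
    by apply/measurable_EFinP; exact: measurable_funTS.
  rewrite (ge0_integral_pushforward (measurable_funPT L) P mA)//.
  by rewrite (ge0_integral_pushforward mL' P).
rewrite LtE// tilt_nu (@integral_density _ _ _ lebesgue_measure nu f)//.
under [RHS]eq_integral do rewrite EFinM.
rewrite ge0_integralZl//.
- have mwf := measurable_funM mw mf.
  by apply/measurable_EFinP; apply: (measurable_funS _ _ mwf).
- by move=> x _; rewrite lee_fin mulr_ge0.
- by rewrite lee_fin ltW.
Qed.

End exp_tilt_density.

Section measurability.
Context {R : realType}.

Lemma measurable_invR : measurable_fun [set: R] (fun x : R => x^-1)%R.
Proof.
rewrite (_ : (fun x : R => x^-1)%R = (fun x => x * (x ^+ 2) `^ (-1))%R).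
  apply: measurable_funM => //.
  apply: (measurableT_comp (measurable_powR (R:=R) (-1))).
  exact: measurable_funX.
apply/funext => x.
have [->|x0] := eqVneq x 0%R; first by rewrite invr0 mul0r.
by rewrite powR_inv1 ?sqr_ge0// expr2 invfM mulrA mulfV// mul1r.
Qed.

Lemma measurable_funV {d : measure_display} {T : measurableType d}
    (f : T -> R) : measurable_fun [set: T] f ->
  measurable_fun [set: T] (fun t => (f t)^-1)%R.
Proof. exact: measurableT_comp measurable_invR. Qed.

Lemma measurable_fun_div {d : measure_display} {T : measurableType d}
    (f g : T -> R) : measurable_fun [set: T] f -> measurable_fun [set: T] g ->
  measurable_fun [set: T] (fun t => f t / g t)%R.
Proof. by move=> mf mg; apply: measurable_funM => //; exact: measurable_funV. Qed.

Lemma measurable_fun_powR {d : measure_display} {T : measurableType d}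
    (f : T -> R) a : measurable_fun [set: T] f ->
  measurable_fun [set: T] (fun t => f t `^ a)%R.
Proof. exact: measurableT_comp (measurable_powR a). Qed.

Definition odds_to_prob (x : R) : R := (x / (x + 1))%R.

Lemma measurable_odds_to_prob : measurable_fun [set: R] odds_to_prob.
Proof. by apply: measurable_fun_div => //; exact: measurable_funD. Qed.

HB.instance Definition _ :=
  isMeasurableFun.Build _ _ _ _ odds_to_prob measurable_odds_to_prob.

End measurability.

(* H^(1,1) *)
Definition odds_law {R : realType} (H : probability R R) : probability R R :=
  distribution H odds_to_prob.

(* The density rho_{alpha,H}, extended by 0 outside (0, +oo). *)
Section rho.
Context {R : realType}.
Implicit Types (alpha x r : R) (H : probability R R).

Definition rho_kernel alpha x r : R :=
  (x `^ (alpha - 1) * r /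
   (x `^ (2 * alpha) + 2 * x `^ alpha * r * cos (alpha * pi) + r ^+ 2))%R.

Definition rho alpha H x : \bar R :=
  if (0 < x)%R then
    (sin (pi * alpha) / pi)%:E *
    \int[H]_(r in `]0%R, +oo[) (rho_kernel alpha x r)%:E
  else 0.

Definition rho_measure alpha H (_ : (0 < alpha < 1)%R) (A : set R) : \bar R :=
  \int[lebesgue_measure]_(x in A) rho alpha H x.

Lemma rho_kernel_ge0 alpha x r : (0 <= r)%R -> (0 <= rho_kernel alpha x r)%R.
Proof.
move=> r0; rewrite /rho_kernel divr_ge0//; first by rewrite mulr_ge0// powR_ge0.
have -> : (x `^ (2 * alpha) = (x `^ alpha) ^+ 2)%R.
  by rewrite mulrC powRrM powR_mulrn// powR_ge0.
have := powR_ge0 x alpha; set y := (x `^ alpha)%R => y0.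
have -> : (y ^+ 2 + 2 * y * r * cos (alpha * pi) + r ^+ 2 =
    (y - r) ^+ 2 + 2 * (y * r) * (cos (alpha * pi) + 1))%R.
  by ring.
by rewrite addr_ge0 ?sqr_ge0// !mulr_ge0// -lerBlDr sub0r cos_geN1.
Qed.

Lemma rho_ge0 alpha H x : (0 < alpha < 1)%R -> 0 <= rho alpha H x.
Proof.
case/andP => a0 a1; rewrite /rho; case: ifPn => // x0; apply: mule_ge0.
  rewrite lee_fin divr_ge0 ?pi_ge0// sin_ge0_pi//.
  by rewrite mulr_ge0 ?pi_ge0 ?ler_piMr ?pi_ge0// ltW.
apply: integral_ge0 => r /=; rewrite in_itv/= andbT => r0.
by rewrite lee_fin rho_kernel_ge0// ltW.
Qed.

Lemma measurable_rho alpha H : measurable_fun [set: R] (rho alpha H).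
Proof.
apply: measurable_fun_ifT => //; first exact: measurable_fun_ltr.
apply: measurable_funeM.
pose g (z : R * R) : \bar R :=
  (rho_kernel alpha z.1 (maxr 0 z.2) * \1_(`]0%R, +oo[%classic) z.2)%:E.
rewrite (_ : (fun x => _) = fun x => \int[H]_r g (x, r)); last first.
  apply/funext => x; rewrite integral_mkcond; apply: eq_integral => r _.
  rewrite patchE /g/= indicE; case: ifPn => rD; last by rewrite mulr0.
  rewrite mulr1; congr (rho_kernel _ _ _)%:E.
  by move: rD; rewrite inE/= in_itv/= andbT => r0; rewrite max_r// ltW.
apply: (measurable_fun_fubini_tonelli_F g); last first.
  move=> z; rewrite /g lee_fin mulr_ge0// rho_kernel_ge0//.
  by rewrite le_max lexx.
apply/measurable_EFinP; apply: measurable_funM; last first.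
  by apply: (measurableT_comp (f := \1_(`]0%R, +oo[%classic) : R -> R)) => //.
have m2 : measurable_fun [set: R * R] (fun z => maxr 0 z.2)%R.
  exact: measurable_maxr.
apply: measurable_fun_div.
  by apply: measurable_funM => //; exact: measurable_fun_powR.
apply: measurable_funD; last exact: measurable_funX.
apply: measurable_funD; first exact: measurable_fun_powR.
apply: measurable_funM => //; apply: measurable_funM => //.
by apply: measurable_funM => //; exact: measurable_fun_powR.
Qed.

Section measure.
Variables (alpha : R) (H : probability R R) (a01 : (0 < alpha < 1)%R).

Let rho_measure0 : rho_measure H a01 set0 = 0.
Proof. by rewrite /rho_measure integral_set0. Qed.

Let rho_measure_ge0 A : 0 <= rho_measure H a01 A.
Proof. by apply: integral_ge0 => x _; exact: rho_ge0. Qed.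

Let rho_measure_sigma_additive : semi_sigma_additive (rho_measure H a01).
Proof.
have mrho : measurable_fun [set: measurableTypeR R] (rho alpha H).
  exact: measurable_rho.
exact: (semi_sigma_additive_nng_induced (mu := lebesgue_measure) mrho
  (fun x => rho_ge0 H x a01)).
Qed.

HB.instance Definition _ := isMeasure.Build _ _ _ (rho_measure H a01)
  rho_measure0 rho_measure_ge0 rho_measure_sigma_additive.

End measure.
End rho.

Section Lambda.
Context {R : realType} {d : measure_display} {T : measurableType d}.
Variables (alpha : R) (P : probability T R) (X : {RV P >-> R}).

(* Lambda_{alpha,p}, where X has the law of X_alpha *)
Definition skew_law (p : R) : set R -> \bar R :=
  let c := ((p / (1 - p)) `^ alpha^-1)%R in
  pushforward P (fun t => c * X t / (1 + c * X t))%R.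

(* Lambda_{alpha,H} *)
Definition mixed_skew_law (H : probability R R) (A : set R) : \bar R :=
  \int[H]_(r in `]0%R, +oo[) skew_law (r / (1 + r)) A.

Lemma skew_law_ge0 p A : 0 <= skew_law p A.
Proof. by rewrite /skew_law /pushforward; exact: measure_ge0. Qed.

Lemma measurable_skew_law A : measurable A ->
  measurable_fun [set: R] (skew_law ^~ A).
Proof.
move=> mA.
pose G (z : R * T) : R :=
  (let c := (z.1 / (1 - z.1)) `^ alpha^-1 in c * X z.2 / (1 + c * X z.2))%R.
have mc : measurable_fun [set: R * T]
    (fun z => (z.1 / (1 - z.1)) `^ alpha^-1)%R.
  apply: measurable_fun_powR; apply: measurable_fun_div => //.
  exact: measurable_funB.
have mcX : measurable_fun [set: R * T]
    (fun z => (z.1 / (1 - z.1)) `^ alpha^-1 * X z.2)%R.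
  by apply: measurable_funM => //; exact: measurableT_comp.
have mG : measurable_fun [set: R * T] G.
  by apply: measurable_fun_div => //; exact: measurable_funD.
have mGA : measurable (G @^-1` A) by rewrite -[X in measurable X]setTI; exact: mG.
have := measurable_fun_xsection P mGA.
congr measurable_fun; apply/funext => p /=.
by rewrite xsectionE.
Qed.

Section measure.
Variable H : probability R R.

Let mixed_skew_law0 : mixed_skew_law H set0 = 0.
Proof.
rewrite /mixed_skew_law integral0_eq// => r _.
by rewrite /skew_law /pushforward preimage_set0 measure0.
Qed.

Let mixed_skew_law_ge0 A : 0 <= mixed_skew_law H A.
Proof. by apply: integral_ge0 => r _; exact: skew_law_ge0. Qed.

Let mixed_skew_law_sigma_additive : semi_sigma_additive (mixed_skew_law H).
Proof.
move=> F mF tF mUF; rewrite /mixed_skew_law.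
have mskew (A : set R) : measurable A -> measurable_fun
    (`]0%R, +oo[%classic : set R) (fun r => skew_law (r / (1 + r)) A).
  move=> mA; apply/measurable_funTS.
  apply: (measurableT_comp (measurable_skew_law mA)).
  by apply: measurable_fun_div => //; exact: measurable_funD.
have skewE r : skew_law (r / (1 + r)) (\bigcup_n F n) =
    \sum_(0 <= n <oo) skew_law (r / (1 + r)) (F n).
  pose c := ((r / (1 + r) / (1 - r / (1 + r))) `^ alpha^-1)%R.
  pose g t := (c * X t / (1 + c * X t))%R.
  have mcX : measurable_fun [set: T] (fun t => c * X t)%R.
    exact: measurable_funM.
  have mg : measurable_fun [set: T] g.
    by apply: measurable_fun_div => //; exact: measurable_funD.
  exact: (measure_semi_bigcup
    (distribution P (HB.pack_for {mfun T >-> R} g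
      (isMeasurableFun.Build _ _ _ _ _ mg)))).
under [X in _ --> X]eq_integral do rewrite skewE.
apply/cvg_closeP; split.
  by apply: is_cvg_nneseries => n _ _; apply: integral_ge0 => r _; exact: skew_law_ge0.
rewrite closeE// integral_nneseries//.
  by move=> n; exact: mskew.
by move=> n r _; exact: skew_law_ge0.
Qed.

HB.instance Definition _ := isMeasure.Build _ _ _ (mixed_skew_law H)
  mixed_skew_law0 mixed_skew_law_ge0 mixed_skew_law_sigma_additive.

End measure.
End Lambda.
Arguments skew_law {R d T} alpha P X p.
Arguments mixed_skew_law {R d T} alpha P X H A.

Section xi.
Context {R : realType} {d : measure_display} {T : measurableType d}.
Variable P : probability T R.

(* The odds are 0 instead of +oo at xi = 1; this event is null when
   H `]0, +oo[ = 1, since then H has no atom at 0. *)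
Definition odds_variable (H : probability R R) (X xi : T -> R) :=
  [/\ P (xi @^-1` `[0%R, 1%R]) = 1, independent P xi X &
      has_law P (fun t => xi t / (1 - xi t))%R H].

(* xi has the law of xi_theta, where M has the law of M_theta(H). *)
Definition size_biased_odds (theta : R) (xi : T -> R)
    {d' : measure_display} {T' : measurableType d'} (P' : probability T' R)
    (M : {RV P' >-> R}) :=
  law_proportional P xi (fun u => (1 - u) `^ theta)%R
    (distribution (distribution P' M) odds_to_prob).

End xi.
Arguments size_biased_odds {R d T} P theta xi {d' T'} P' M.

(* Main.v *)
(* The Stieltjes transform of X_alpha, E[1 / (1 + l X_alpha)] = 1 / (1 + l^alpha),
   follows from the Laplace transforms of the two stable variables.  With
   l = exp s it says that the expectation of the logistic function of
   s + log X_alpha is the logistic function of alpha s; moving s to the line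
   s + i b, with b -> pi, gives the density of r^(1/alpha) X_alpha, and mixing
   over r gives rho_{alpha,H}.  Integrating the Stieltjes transform over [1, 1 + l]
   gives the log transform of Lambda_{alpha,H}:
     alpha int log(1 + l x) Lambda_{alpha,H}(dx)
       = int (log(1 + (1 + l)^alpha r) - log(1 + r)) H(dr).
   Frullani's integral turns log transforms into Lévy measures, the tilt shifts
   the argument of a log transform by 1, and the laws of the Dirichlet means are
   read off their generalized Stieltjes transforms, the bias (1 - u)^theta being
   absorbed by (1 + l u) (1 - u)^-1 = 1 + (1 + l) m for u = m / (m + 1). *)
Require Import Defs.
From HB Require Import structures.
From mathcomp Require Import all_boot all_order all_algebra.
From mathcomp Require Import all_classical all_reals all_analysis.
From mathcomp Require Import measurable_realfun ring lra.

Set Implicit Arguments.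
Unset Strict Implicit.
Unset Printing Implicit Defensive.

Import Order.TTheory GRing.Theory Num.Def Num.Theory.
Import numFieldNormedType.Exports.

Local Open Scope classical_set_scope.
Local Open Scope ring_scope.

(** The move off the real line uses real integrals only. The logistic function of a z + k is
    multiplied by exp (- (z - i b)^2) and integrated along horizontal lines; by the Cauchy-Riemann
    equations the integral does not depend on the height. At height 0 the logistic factor is real,
    so that the identity on real arguments can be used; at height b the Gaussian factor is real and
    positive, and small steps a concentrate the average at one point. The poles at odd multiples of
    i pi restrict the heights to b < pi. On the side of step alpha the height is alpha b, and alpha
    < 1 keeps it away from the pole even at b = pi: this is why the limit is a density. The second
    obstacle is null sets. Positivity is only almost sure, while division by 0 and logarithms off
    their domain take default values; variables are therefore replaced by everywhere positive ones
    that agree with them almost surely. The endpoints 0 and 1 of the odds have to be shown null as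
    well: an atom of M_theta(H) at 0 is excluded by the growth of the log transform of H at
    infinity. *)

(** * Laws, almost sure equality and independence *)

Section almost_surely.
Local Open Scope ereal_scope.
Context {R : realType} {d : measure_display} {T : measurableType d}.
Variable P : probability T R.

Lemma integrable_bounded (f : T -> R) (C : R) : measurable_fun setT f ->
  (forall t, (`|f t| <= C)%R) -> P.-integrable setT (EFin \o f).
Proof.
move=> mf fC.
have C0 : (0 <= C)%R by exact: le_trans (normr_ge0 _) (fC point).
have := finite_measure_integrable_cst P C measurableT; apply: le_integrable => //.
  exact/measurable_EFinP.
by move=> t _; rewrite /= lee_fin (ger0_norm C0).
Qed.

Lemma expectation_onem (f : T -> R) : measurable_fun setT f ->
  (forall t, 0 <= f t <= 1)%R ->
  'E_P[fun t => (1 - f t)%R] = 1 - 'E_P[f].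
Proof.
move=> mf f01.
have intf : P.-integrable setT (EFin \o f).
  apply: (integrable_bounded (C := 1)) => // t.
  by have /andP[f0 f1] := f01 t; rewrite ger0_norm.
rewrite unlock; under eq_integral do rewrite EFinB.
rewrite integralB//; last exact: finite_measure_integrable_cst.
by rewrite integral_cst// mul1e; congr (_ - _)%E; exact: probability_setT.
Qed.

(** With A the event that a variable is positive, this lets an integrand be changed where its
    formula loses its meaning. *)
Lemma eq_integral_as (A : set T) (f g : T -> \bar R) : measurable A -> P A = 1 ->
  measurable_fun setT f -> measurable_fun setT g ->
  (forall t, A t -> f t = g t) -> \int[P]_t f t = \int[P]_t g t.
Proof.
move=> mA A1 mf mg fg; apply: ae_eq_integral => //.
have AC0 : P (~` A) = 0 by rewrite probability_setC// A1 subee.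
exists (~` A); split; [exact: measurableC|exact: AC0|].
by move=> t /=; apply: contra_not => At _; exact: fg.
Qed.

Lemma eq_probability_as (A B C : set T) : measurable A -> P A = 1 ->
  measurable B -> measurable C -> (forall t, A t -> B t <-> C t) -> P B = P C.
Proof.
move=> mA A1 mB mC BC; rewrite -[B]setIT -[C]setIT -!integral_indic//.
apply: (eq_integral_as mA A1).
- exact/measurable_EFinP.
- exact/measurable_EFinP.
- move=> t At; rewrite !indicE; congr ((nat_of_bool _)%:R%:E).
  by apply/idP/idP; rewrite !inE => /(BC t At).
Qed.

Lemma setI_probability1 (A B : set T) : measurable A -> measurable B ->
  P A = 1 -> P B = 1 -> P (A `&` B) = 1.
Proof.
move=> mA mB A1 B1; rewrite -[RHS]B1.
by apply: (eq_probability_as mA A1) => //; [exact: measurableI|move=> t At; split=> [[]|]].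
Qed.

Lemma law_integral (X : T -> R) (mu : {measure set R -> \bar R}) (g : R -> \bar R) :
  measurable_fun setT X -> has_law P X mu ->
  measurable_fun setT g -> (forall x, 0 <= g x) ->
  \int[P]_t g (X t) = \int[mu]_x g x.
Proof.
move=> mX Xmu mg g0.
have := @ge0_integral_pushforward _ _ _ _ R X mX P setT g measurableT mg _.
rewrite preimage_setT => <-; last by move=> x _; exact: g0.
by apply: eq_measure_integral => A mA _; rewrite -Xmu.
Qed.

End almost_surely.

Section tonelli.
Local Open Scope ereal_scope.
Context {R : realType} {d1 d2 : measure_display}.
Context {T1 : measurableType d1} {T2 : measurableType d2}.
Variables (m1 : {sigma_finite_measure set T1 -> \bar R})
  (m2 : {sigma_finite_measure set T2 -> \bar R}).

(** Nonnegativity is asked on A x B only, because integrands such as (1 - exp (- l s)) / s exp (- s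
    / x) lose their sign or meaning off the domain; multiplying by the two indicators reduces to
    Tonelli on the whole product. *)
Lemma ge0_fubini_in (A : set T1) (B : set T2) (f : T1 * T2 -> R) :
  measurable A -> measurable B -> measurable_fun setT f ->
  (forall x y, A x -> B y -> (0 <= f (x, y))%R) ->
  \int[m1]_(x in A) \int[m2]_(y in B) (f (x, y))%:E =
  \int[m2]_(y in B) \int[m1]_(x in A) (f (x, y))%:E.
Proof.
move=> mA mB mf f0.
pose g z := (f z * (\1_A z.1 * \1_B z.2))%:E.
have mg : measurable_fun setT g.
  apply/measurable_EFinP; apply: measurable_funM => //; apply: measurable_funM.
    by apply: (measurableT_comp (f := \1_A : T1 -> R)).
  by apply: (measurableT_comp (f := \1_B : T2 -> R)).
have g0 z : 0 <= g z.
  rewrite /g lee_fin !indicE; case: z => x y /=.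
  have [xA|_] := boolP (x \in A); last by rewrite mul0r mulr0.
  have [yB|_] := boolP (y \in B); last by rewrite mulr0 mulr0.
  by rewrite !mulr1 f0//; [move: xA|move: yB]; rewrite inE.
transitivity (\int[m1]_x \int[m2]_y g (x, y)).
  rewrite integral_mkcond; apply: eq_integral => x _; rewrite patchE.
  case: ifPn => xA; last first.
    by rewrite integral0_eq// => y _; rewrite /g/= indicE (negbTE xA) mul0r mulr0.
  rewrite integral_mkcond; apply: eq_integral => y _; rewrite patchE /g/= !indicE xA mul1r.
  by case: ifPn; rewrite ?mulr1 ?mulr0.
rewrite (fubini_tonelli _ mg g0) [RHS]integral_mkcond.
apply: eq_integral => y _; rewrite patchE.
case: ifPn => yB; last first.
  by rewrite integral0_eq// => x _; rewrite /g/= !indicE (negbTE yB) !mulr0.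
rewrite [RHS]integral_mkcond; apply: eq_integral => x _; rewrite patchE /g/= !indicE yB mulr1.
by case: ifPn; rewrite ?mulr1 ?mulr0.
Qed.

End tonelli.

Section independence.
Local Open Scope ereal_scope.
Context {R : realType} {d : measure_display} {T : measurableType d}.
Variable P : probability T R.

Lemma independent_joint (X Y : {RV P >-> R}) (A : set (R * R)) :
  independent P X Y -> measurable A ->
  P [set t | A (X t, Y t)] = (distribution P X \x distribution P Y) A.
Proof.
move=> XY mA.
have mXY : measurable_fun setT (fun t => (X t, Y t)).
  by apply: measurable_fun_pair; exact: measurable_funPT.
rewrite (@product_measure_unique _ _ _ _ _ _ _
  (measure_function_pushforward__canonical__measure_function_Measure P mXY))//.
Qed.

Lemma independent_integral (X Y : {RV P >-> R}) (g : R * R -> \bar R) :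
  independent P X Y -> measurable_fun setT g -> (forall z, 0 <= g z) ->
  \int[P]_t g (X t, Y t) = \int[P]_s \int[P]_t g (X t, Y s).
Proof.
move=> XY mg g0.
have mXY : measurable_fun setT (fun t => (X t, Y t)).
  by apply: measurable_fun_pair; exact: measurable_funPT.
transitivity (\int[distribution P X \x distribution P Y]_z g z).
  have := @ge0_integral_pushforward _ _ _ _ R _ mXY P setT g measurableT mg _.
  rewrite preimage_setT => <-; last by move=> x _; exact: g0.
  by apply: eq_measure_integral => A mA _; exact: independent_joint.
rewrite fubini_tonelli2//.
transitivity (\int[distribution P Y]_y \int[P]_t g (X t, y)).
  apply: eq_integral => y _; rewrite /fubini_G ge0_integral_distribution//.
  exact: (measurableT_comp mg).
rewrite ge0_integral_distribution//; last by move=> y; exact: integral_ge0.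
have mg' : measurable_fun setT (fun z : R * T => g (X z.2, z.1)).
  apply: (measurableT_comp mg); apply: measurable_fun_pair => //.
  exact: (measurableT_comp (measurable_funPT X)).
exact: (measurable_fun_fubini_tonelli_F (fun z : R * T => g (X z.2, z.1))).
Qed.

End independence.

(** * Analytic continuation of a Stieltjes transform *)

Section cauchy_riemann.
Context {R : realType}.
Implicit Types (f g h k : R -> R -> R) (x y : R).

(* f + i g is complex differentiable at x + i y, with derivative f' + i g'. *)
Definition cauchy_riemann f g x y (f' g' : R) :=
  [/\ is_derive x 1 (f ^~ y) f', is_derive x 1 (g ^~ y) g',
      is_derive y 1 (f x) (- g') & is_derive y 1 (g x) f'].

Lemma cauchy_riemannM f g h k x y (f' g' h' k' : R) :
  cauchy_riemann f g x y f' g' -> cauchy_riemann h k x y h' k' ->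
  cauchy_riemann (fun x y => f x y * h x y - g x y * k x y)
    (fun x y => f x y * k x y + g x y * h x y) x y
    (f' * h x y - g' * k x y + (f x y * h' - g x y * k'))
    (f' * k x y + g' * h x y + (f x y * k' + g x y * h')).
Proof.
move=> [f1 g1 f2 g2] [h1 k1 h2 k2]; split.
- by apply: is_derive_eq; rewrite /GRing.scale/=; ring.
- by apply: is_derive_eq; rewrite /GRing.scale/=; ring.
- by apply: is_derive_eq; rewrite /GRing.scale/=; ring.
- by apply: is_derive_eq; rewrite /GRing.scale/=; ring.
Qed.

Lemma cauchy_riemann_exp f g x y (f' g' : R) :
  cauchy_riemann f g x y f' g' ->
  let p x y := expR (f x y) * cos (g x y) in
  let q x y := expR (f x y) * sin (g x y) in
  cauchy_riemann p q x y (p x y * f' - q x y * g') (p x y * g' + q x y * f').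
Proof.
move=> [f1 g1 f2 g2] p q; rewrite /p/q; split.
- by apply: is_derive_eq; rewrite /GRing.scale/=; ring.
- by apply: is_derive_eq; rewrite /GRing.scale/=; ring.
- by apply: is_derive_eq; rewrite /GRing.scale/=; ring.
- by apply: is_derive_eq; rewrite /GRing.scale/=; ring.
Qed.

Lemma cauchy_riemannV f g x y (f' g' : R) :
  cauchy_riemann f g x y f' g' -> f x y ^+ 2 + g x y ^+ 2 != 0 ->
  let n x y := (f x y ^+ 2 + g x y ^+ 2)^-1 in
  let p x y := f x y * n x y in
  let q x y := - g x y * n x y in
  cauchy_riemann p q x y
    (- ((p x y ^+ 2 - q x y ^+ 2) * f' - 2 * p x y * q x y * g'))
    (- ((p x y ^+ 2 - q x y ^+ 2) * g' + 2 * p x y * q x y * f')).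
Proof.
move=> [f1 g1 f2 g2] n0 n p q; rewrite /p/q/n.
have dx : is_derive x 1 (fun x => (f x y ^+ 2 + g x y ^+ 2)^-1)
   (- (f x y ^+ 2 + g x y ^+ 2) ^- 2 * (2 * f x y * f' + 2 * g x y * g')).
  by apply: is_derive_eq; rewrite /GRing.scale/= -!exprVn; ring.
have dy : is_derive y 1 (fun y => (f x y ^+ 2 + g x y ^+ 2)^-1)
   (- (f x y ^+ 2 + g x y ^+ 2) ^- 2 * (- 2 * f x y * g' + 2 * g x y * f')).
  by apply: is_derive_eq; rewrite /GRing.scale/= -!exprVn; ring.
split.
- by apply: is_derive_eq; rewrite /GRing.scale/=; field.
- by apply: is_derive_eq; rewrite /GRing.scale/=; field.
- by apply: is_derive_eq; rewrite /GRing.scale/=; field.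
- by apply: is_derive_eq; rewrite /GRing.scale/=; field.
Qed.
End cauchy_riemann.

Section strip.
Context {R : realType}.
Let mu : {measure set _ -> \bar R} := @lebesgue_measure R.

Lemma cvg_Rintegral_itvNnn (f : R -> R) : mu.-integrable setT (EFin \o f) ->
  \int[mu]_(x in `[- n%:R, n%:R]) f x @[n --> \oo] --> \int[mu]_x f x.
Proof.
move=> intf.
have mf := measurable_int _ intf.
apply: fine_cvg; rewrite fineK; last exact: integrable_fin_num.
under eq_fun do rewrite integral_mkcond.
apply: (@dominated_cvg _ _ _ mu _ measurableT _ _ (abse \o (EFin \o f))) => //.
- move=> n; apply/measurable_restrict => //; rewrite ?setTI.
  exact: measurable_funTS.
- move=> x _; apply: cvg_near_cst; near=> n.
  rewrite patchE mem_set//= in_itv/= -ler_norml.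
  by near: n; exact: nbhs_infty_ger.
- exact: integrable_abse.
- by move=> n x _ /=; rewrite patchE; case: ifPn => _; rewrite ?abse0 ?lexx ?abse_ge0.
Unshelve. all: by end_near. Qed.

(* Rotating the line of integration in a strip: the horizontal derivative of
   the real part is the vertical derivative of the imaginary part. *)
Lemma cauchy_riemann_shift (f g D D' : R -> R -> R) (G : R -> R) (b d : R) :
  0 <= b -> 0 < d ->
  (forall x y, y \in `](- d), (b + d)[ ->
    cauchy_riemann f g x y (D x y) (D' x y)) ->
  (forall y, y \in `](- d), (b + d)[ -> continuous (D ^~ y)) ->
  (forall y, y \in `](- d), (b + d)[ ->
    f n%:R y @[n --> \oo] --> 0 /\ f (- n%:R) y @[n --> \oo] --> 0) ->
  mu.-integrable setT (EFin \o G) ->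
  (forall x y, y \in `](- d), (b + d)[ -> `|D x y| <= G x) ->
  (forall x y, y \in `](- d), (b + d)[ -> `|g x y| <= G x) ->
  \int[mu]_x g x b = \int[mu]_x g x 0.
Proof.
move=> b0 d0 CR cD lim_f intG DG gG.
(* The margin d puts the closed segment of heights [0, b] inside an open interval, on which one can
   differentiate under the integral sign. *)
pose I : set R := `](- d), (b + d)[%classic.
have G0 x : 0 <= G x.
  by apply: le_trans (DG x 0 _); rewrite // in_itv/=; apply/andP; split; lra.
have bI y : y \in `[0, b] -> y \in `](- d), (b + d)[.
  by rewrite !in_itv/= => /andP[y0 yb]; apply/andP; split; lra.
have cg y : y \in `](- d), (b + d)[ -> continuous (g ^~ y).
  move=> yI x; have [_ gx _ _] := CR x y yI.
  exact/differentiable_continuous/derivable1_diffP/ex_derive.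
have cf y : y \in `](- d), (b + d)[ -> continuous (f ^~ y).
  move=> yI x; have [fx _ _ _] := CR x y yI.
  exact/differentiable_continuous/derivable1_diffP/ex_derive.
have intg y : I y -> mu.-integrable setT (EFin \o (g ^~ y)).
  move=> yI; apply: (le_integrable measurableT _ _ intG).
    by apply/measurable_EFinP; apply: continuous_measurable_fun; exact: cg.
  by move=> x _; rewrite /= lee_fin (le_trans (gG _ _ _))// ler_norm.
have intD y : I y -> mu.-integrable setT (EFin \o (D ^~ y)).
  move=> yI; apply: (le_integrable measurableT _ _ intG).
    by apply/measurable_EFinP; apply: continuous_measurable_fun; exact: cD.
  by move=> x _; rewrite /= lee_fin (le_trans (DG _ _ _))// ler_norm.
(* The real part vanishes at both ends of the line, so its horizontal derivative has integral 0. *)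
have D_0 y : I y -> \int[mu]_x D x y = 0.
  move=> yI; have := cvg_Rintegral_itvNnn (intD _ yI).
  have [fn fNn] := lim_f _ yI.
  have lim0 : f n%:R y - f (- n%:R) y @[n --> \oo] --> 0 - (0 : R) by exact: cvgB.
  rewrite subr0 in lim0; move=> lim1.
  rewrite -(cvg_lim _ lim1)//; apply/cvg_lim => //.
  apply: cvg_trans lim0; apply: near_eq_cvg; near=> n.
  rewrite /Rintegral (@continuous_FTC2 _ (D ^~ y) (f ^~ y))//.
  - have : (0 < n)%N by near: n; exact: nbhs_infty_gt.
    by rewrite -(ltr0n R) => n0; lra.
  - by apply: continuous_subspaceT; exact: cD.
  - split.
    + by move=> x _; have [fx _ _ _] := CR x y yI; exact: ex_derive.
    + exact/cvg_at_right_filter/cf.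
    + exact/cvg_at_left_filter/cf.
  - move=> x _; have [fx _ _ _] := CR x y yI.
    by rewrite derive1E; exact: derive_val.
pose F y := \int[mu]_x g x y.
have partial y x : I y -> partial1of2 (fun y x => g x y) y x = D x y.
  move=> yI; have [_ _ _ gy] := CR x y yI.
  by rewrite partial1of2E; exact: derive_val.
have dF y : I y -> is_derive y 1 F 0.
  move=> yI; apply: DeriveDef.
    apply: (@derivable_under_integral _ _ _ mu (fun y x => g x y) setT measurableT
      y (- d) (b + d) yI intg _ G) => //.
    - by move=> z x zI _; have [_ _ _ gy] := CR x z zI; exact: ex_derive.
    - by move=> z x zI _; rewrite partial// DG.
  rewrite -derive1E.
  rewrite (@differentiation_under_integral _ _ _ mu (fun y x => g x y) setT measurableT
      y (- d) (b + d) yI intg _ G) => //.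
  - by under eq_Rintegral do rewrite partial//; exact: D_0.
  - by move=> z x zI _; have [_ _ _ gy] := CR x z zI; exact: ex_derive.
  - by move=> z x zI _; rewrite partial// DG.
have dF_itv y : y \in `]0, b[ -> is_derive y 1 F 0.
  move=> yb; apply: dF; apply: bI.
  by move: yb; rewrite !in_itv/= => /andP[/ltW -> /ltW ->].
have cF : {within `[0, b], continuous F}.
  apply: derivable_within_continuous => y /bI yb.
  by have := dF y yb => ?; exact: ex_derive.
have [c _] := MVT_segment b0 dF_itv cF.
by rewrite mul0r => /eqP; rewrite subr_eq0 => /eqP.
Unshelve. all: by end_near. Qed.

End strip.

(** * The logistic function off the real axis *)

Section logistic.
Context {R : realType}.
Implicit Types s t x y a k : R.

(* The real and imaginary parts of 1 / (1 + exp (- (s + i t))). *)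
Definition logistic_den s t : R :=
  (1 + expR (- s) * cos t) ^+ 2 + (expR (- s) * sin t) ^+ 2.
Definition logistic_re s t : R := (1 + expR (- s) * cos t) / logistic_den s t.
Definition logistic_im s t : R := expR (- s) * sin t / logistic_den s t.

(** With e = exp (- s) and c = cos t the denominator is (1 + c) / 2 (1 + e)^2 + (1 - c) / 2 (1 -
    e)^2. The bound keeps the logistic function away from its poles, uniformly in s. *)
Lemma logistic_den_ge s t :
  (1 + cos t) / 2 * (1 + expR (- s)) ^+ 2 <= logistic_den s t.
Proof.
rewrite /logistic_den; have := cos2Dsin2 t; have := cos_le1 t.
set e := expR _; set c := cos t => c1 cs.
have -> : (e * sin t) ^+ 2 = e ^+ 2 * (1 - c ^+ 2).
  by rewrite exprMn -cs addrC addKr.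
by have : 0 <= (1 - c) * (1 - e) ^+ 2; [rewrite mulr_ge0 ?sqr_ge0 ?subr_ge0|nra].
Qed.

Lemma logistic_den_gt0 s t : -1 < cos t -> 0 < logistic_den s t.
Proof.
move=> ct; apply: lt_le_trans (logistic_den_ge s t).
have := expR_gt0 (- s) => e0.
by rewrite mulr_gt0 ?exprn_gt0// ?divr_gt0//; lra.
Qed.

Lemma logistic_num_le s t : -1 < cos t ->
  (1 + expR (- s)) / logistic_den s t <= 2 / (1 + cos t).
Proof.
move=> ct; have := logistic_den_ge s t; have := logistic_den_gt0 s ct.
have := expR_gt0 (- s); set e := expR _; set n := logistic_den _ _ => e0 n0 ne.
have c0 : 0 < 1 + cos t by lra.
rewrite ler_pdivrMr// mulrAC ler_pdivlMr//.
apply: le_trans (_ : (1 + cos t) * (1 + e) ^+ 2 <= _); last lra.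
rewrite mulrC ler_pM2l//; nra.
Qed.

Lemma normr_logistic_re s t : -1 < cos t ->
  `|logistic_re s t| <= 2 / (1 + cos t).
Proof.
move=> ct; apply: le_trans (logistic_num_le s ct).
have n0 := logistic_den_gt0 s ct.
rewrite normrM normfV (gtr0_norm n0) ler_pM2r ?invr_gt0//.
rewrite (le_trans (ler_normD _ _))// normr1 lerD2l normrM.
by rewrite ger0_norm ?expR_ge0// ler_piMr ?expR_ge0// ler_norml cos_geN1 cos_le1.
Qed.

Lemma normr_logistic_im s t : -1 < cos t ->
  `|logistic_im s t| <= 2 / (1 + cos t).
Proof.
move=> ct; apply: le_trans (logistic_num_le s ct).
have n0 := logistic_den_gt0 s ct.
rewrite normrM normfV (gtr0_norm n0) ler_pM2r ?invr_gt0//.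
rewrite -[leLHS]add0r lerD// normrM.
by rewrite ger0_norm ?expR_ge0// ler_piMr ?expR_ge0// ler_norml sin_geN1 sin_le1.
Qed.

Lemma eq_cauchy_riemann (f g h k : R -> R -> R) x y (f' g' h' k' : R) :
  f =2 h -> g =2 k -> f' = h' -> g' = k' ->
  cauchy_riemann f g x y f' g' -> cauchy_riemann h k x y h' k'.
Proof. by move=> /funeq2P <- /funeq2P <- <- <-. Qed.

(** The derivative is a (w - w^2) with w = p + i q, the logistic differential equation; in this
    form, bounds on w bound the derivative. The function is built as the inverse of 1 plus an
    exponential. *)
Lemma cauchy_riemann_logistic a k x y : -1 < cos (a * y) ->
  let p := logistic_re (a * x + k) (a * y) in
  let q := logistic_im (a * x + k) (a * y) in
  cauchy_riemann (fun x y => logistic_re (a * x + k) (a * y))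
    (fun x y => logistic_im (a * x + k) (a * y)) x y
    (a * (p - p ^+ 2 + q ^+ 2)) (a * (q - 2 * p * q)).
Proof.
move=> ct p q.
have n0 := logistic_den_gt0 (a * x + k) ct.
have CR0 : cauchy_riemann (fun x _ : R => - (a * x + k)) (fun _ y : R => - (a * y))
    x y (- a) 0.
  by split; apply: is_derive_eq; rewrite /GRing.scale/=; ring.
have := cauchy_riemann_exp CR0; rewrite /= !mulr0 subr0 add0r.
set e := expR _ => CR1.
have CR2 : cauchy_riemann
    (fun x y => 1 + expR (- (a * x + k)) * cos (- (a * y)))
    (fun x y => expR (- (a * x + k)) * sin (- (a * y))) x y
    (e * cos (- (a * y)) * - a) (e * sin (- (a * y)) * - a).
  case: CR1 => f1 g1 f2 g2; split.
  - by apply: is_derive_eq; ring.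
  - by apply: is_derive_eq.
  - by apply: is_derive_eq; ring.
  - by apply: is_derive_eq.
have reE x' y' : logistic_re (a * x' + k) (a * y') =
    (1 + expR (- (a * x' + k)) * cos (- (a * y'))) *
    ((1 + expR (- (a * x' + k)) * cos (- (a * y'))) ^+ 2 +
     (expR (- (a * x' + k)) * sin (- (a * y'))) ^+ 2)^-1.
  by rewrite cosN sinN mulrN sqrrN.
have imE x' y' : logistic_im (a * x' + k) (a * y') =
    - (expR (- (a * x' + k)) * sin (- (a * y'))) *
    ((1 + expR (- (a * x' + k)) * cos (- (a * y'))) ^+ 2 +
     (expR (- (a * x' + k)) * sin (- (a * y'))) ^+ 2)^-1.
  by rewrite cosN sinN mulrN sqrrN opprK.
have n0' : (1 + expR (- (a * x + k)) * cos (- (a * y))) ^+ 2 +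
    (expR (- (a * x + k)) * sin (- (a * y))) ^+ 2 != 0.
  by rewrite cosN sinN mulrN sqrrN; exact: lt0r_neq0.
apply: eq_cauchy_riemann (cauchy_riemannV CR2 n0') => //.
- rewrite -reE -imE /p /q /logistic_re /logistic_im cosN sinN -/e.
  have nE : logistic_den (a * x + k) (a * y) =
    (1 + e * cos (a * y)) ^+ 2 + (e * sin (a * y)) ^+ 2 by [].
  by move: n0; rewrite nE => /lt0r_neq0 ?; field.
- rewrite -reE -imE /p /q /logistic_re /logistic_im cosN sinN -/e.
  have nE : logistic_den (a * x + k) (a * y) =
    (1 + e * cos (a * y)) ^+ 2 + (e * sin (a * y)) ^+ 2 by [].
  by move: n0; rewrite nE => /lt0r_neq0 ?; field.
Qed.
End logistic.

Section logistic_shift.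
Context {R : realType}.
Let mu : {measure set _ -> \bar R} := @lebesgue_measure R.
Implicit Types s t x y a k b : R.

Lemma cosN1_lt (t : R) : `|t| < pi -> -1 < cos t.
Proof.
move=> tpi; rewrite -cos_norm -cospi ltr_cos//; rewrite in_itv/= ?lexx ?pi_ge0//.
by rewrite normr_ge0/= ltW.
Qed.

Lemma integrable_half_gauss :
  mu.-integrable setT (fun x : R => (expR (- x ^+ 2 / 2))%:E).
Proof.
have intN := @integrable_normal_pdf R 0 1.
have /= := integrableZl measurableT (normal_peak 1)^-1 intN.
apply: eq_integrable => // x _.
rewrite -EFinM normal_pdfE ?oner_neq0// mulrA mulVf; last first.
  by rewrite gt_eqF// normal_peak_gt0// oner_neq0.
by rewrite mul1r /normal_fun subr0 expr1n.
Qed.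

(** Half of the Gaussian exponent absorbs a linear factor, since 1 + |x| <= 2 (1 + x^2 / 2) <= 2 exp
    (x^2 / 2). The linear factor comes from differentiating the Gaussian. *)
Lemma gauss_fun_half x : (1 + `|x|) * gauss_fun x <= 2 * expR (- x ^+ 2 / 2).
Proof.
rewrite /gauss_fun {1}(_ : - x ^+ 2 = - x ^+ 2 / 2 + - x ^+ 2 / 2); last by field.
rewrite expRD mulrA ler_pM2r ?expR_gt0//.
rewrite mulNr expRN -ler_pdivlMr ?invr_gt0 ?expR_gt0// invrK.
have : 2 * (1 + x ^+ 2 / 2) <= 2 * expR (x ^+ 2 / 2).
  by rewrite ler_pM2l// expR_ge1Dx.
apply: le_trans; rewrite -(real_normK (num_real x)).
have := sqr_ge0 (`|x| - 1); nra.
Qed.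

Lemma cvg_gauss_fun_nat :
  gauss_fun n%:R @[n --> \oo] --> (0 : R) /\
  gauss_fun (- n%:R) @[n --> \oo] --> (0 : R).
Proof.
have -> : (fun n => gauss_fun (- n%:R)) = (fun n => gauss_fun n%:R : R).
  by apply/funext => n; rewrite /gauss_fun sqrrN.
by have := cvg_comp _ _ (@cvgr_idn R) cvg_gauss_fun.
Qed.

(* exp (- (z - i b)^2) *)
Let gre b x y := expR (- (x ^+ 2 - (y - b) ^+ 2)) * cos (- (2 * x * (y - b))).
Let gim b x y := expR (- (x ^+ 2 - (y - b) ^+ 2)) * sin (- (2 * x * (y - b))).

Let cauchy_riemann_gauss b x y : let p := gre b x y in let q := gim b x y in
  cauchy_riemann (gre b) (gim b) x y
    (p * (- 2 * x) - q * (- 2 * (y - b))) (p * (- 2 * (y - b)) + q * (- 2 * x)).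
Proof.
apply: (@cauchy_riemann_exp _ (fun x y => - (x ^+ 2 - (y - b) ^+ 2))
  (fun x y => - (2 * x * (y - b)))).
by split; apply: is_derive_eq; rewrite /GRing.scale/=; ring.
Qed.

Let normr_gre b B x y : (y - b) ^+ 2 <= B -> `|gre b x y| <= expR B * gauss_fun x.
Proof.
move=> yB; rewrite normrM ger0_norm ?expR_ge0// /gauss_fun -expRD.
apply: le_trans (_ : expR (- (x ^+ 2 - (y - b) ^+ 2)) <= _).
  by rewrite ler_piMr ?expR_ge0// cos_max.
by rewrite ler_expR; lra.
Qed.

Let normr_gim b B x y : (y - b) ^+ 2 <= B -> `|gim b x y| <= expR B * gauss_fun x.
Proof.
move=> yB; rewrite normrM ger0_norm ?expR_ge0// /gauss_fun -expRD.
apply: le_trans (_ : expR (- (x ^+ 2 - (y - b) ^+ 2)) <= _).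
  by rewrite ler_piMr ?expR_ge0// sin_max.
by rewrite ler_expR; lra.
Qed.

(** The two sides are the integrals, at heights b and 0, of the imaginary part of the logistic
    function of a z + k times exp (- (z - i b)^2). The factor that multiplies the logistic function
    on the right does not involve a, which is what allows two different steps to be compared. *)
Lemma logistic_shift a k b : 0 < a -> 0 <= b -> a * b < pi ->
  \int[mu]_x (logistic_im (a * x + k) (a * b) * gauss_fun x) =
  \int[mu]_x ((1 + expR (- (a * x + k)))^-1 *
              (expR (b ^+ 2 - x ^+ 2) * sin (2 * x * b))).
Proof.
move=> a0 b0 ab.
(* Chosen so that a (b + d) is the midpoint of a b and pi: the enlarged strip stays below the pole,
   and [c0] is the least cosine on it. *)
pose d := (pi - a * b) / (2 * a).
have d0 : 0 < d by rewrite divr_gt0 ?subr_gt0// mulr_gt0.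
have ad : a * d = (pi - a * b) / 2 by rewrite /d; field; rewrite gt_eqF.
pose c0 := cos ((pi + a * b) / 2).
have ab0 : 0 <= a * b by rewrite mulr_ge0// ltW.
have c0N1 : -1 < c0.
  by apply: cosN1_lt; rewrite ger0_norm; lra.
have cosE y : y \in `](- d), (b + d)[ -> c0 < cos (a * y).
  rewrite in_itv/= => /andP[dy yb].
  have nay : `|a * y| < (pi + a * b) / 2.
    rewrite ltr_norml; apply/andP; split.
      have : a * - d < a * y by rewrite ltr_pM2l.
      by rewrite mulrN ad; lra.
    have : a * y < a * (b + d) by rewrite ltr_pM2l.
    by rewrite mulrDr ad; lra.
  rewrite /c0 -(cos_norm (a * y)) ltr_cos// in_itv/= ?normr_ge0/=; last by lra.
  by lra.
(* On the strip, [C] bounds the logistic function and [B] the distance to height b; hence [M] below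
   bounds the growth of the Gaussian off the line of height b. *)
pose C := 2 / (1 + c0); pose B := b + d.
have C0 : 0 < C by rewrite divr_gt0//; lra.
have B0 : 0 <= B by rewrite /B addr_ge0// ltW.
have yB' y : y \in `](- d), (b + d)[ -> `|y - b| <= B.
  by rewrite in_itv/= /B ler_norml => /andP[dy yb]; apply/andP; split; lra.
have yB y : y \in `](- d), (b + d)[ -> (y - b) ^+ 2 <= B ^+ 2.
  by move=> /yB' yI; rewrite -(real_normK (num_real _)) lerXn2r ?nnegrE.
have cy y : y \in `](- d), (b + d)[ -> -1 < cos (a * y).
  by move=> /cosE; exact: lt_trans.
have reC x y : y \in `](- d), (b + d)[ -> `|logistic_re (a * x + k) (a * y)| <= C.
  move=> yI; apply: le_trans (normr_logistic_re _ (cy _ yI)) _.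
  have := cosE _ yI => ?; rewrite /C ler_pM2l// lef_pV2 ?posrE; lra.
have imC x y : y \in `](- d), (b + d)[ -> `|logistic_im (a * x + k) (a * y)| <= C.
  move=> yI; apply: le_trans (normr_logistic_im _ (cy _ yI)) _.
  have := cosE _ yI => ?; rewrite /C ler_pM2l// lef_pV2 ?posrE; lra.
pose sre x y := logistic_re (a * x + k) (a * y).
pose sim x y := logistic_im (a * x + k) (a * y).
pose M := expR (B ^+ 2).
have M0 : 0 < M by exact: expR_gt0.
have greM x y : y \in `](- d), (b + d)[ -> `|gre b x y| <= M * gauss_fun x.
  by move=> /yB; exact: normr_gre.
have gimM x y : y \in `](- d), (b + d)[ -> `|gim b x y| <= M * gauss_fun x.
  by move=> /yB; exact: normr_gim.
(* Bounds the two parts of a (w - w^2). *)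
pose S1 := a * (C + 2 * C ^+ 2).
have S1_re x y : y \in `](- d), (b + d)[ ->
    `|a * (sre x y - sre x y ^+ 2 + sim x y ^+ 2)| <= S1.
  move=> yI; rewrite normrM (gtr0_norm a0) ler_pM2l//.
  have := reC x _ yI; have := imC x _ yI; rewrite -/(sre x y) -/(sim x y).
  move: (sre x y) (sim x y) => p q qC pC.
  have p2 : `|p ^+ 2| <= C ^+ 2 by rewrite normrX lerXn2r ?nnegrE// ltW.
  have q2 : `|q ^+ 2| <= C ^+ 2 by rewrite normrX lerXn2r ?nnegrE// ltW.
  have := ler_normB p (p ^+ 2); have := ler_normD (p - p ^+ 2) (q ^+ 2).
  lra.
have S1_im x y : y \in `](- d), (b + d)[ ->
    `|a * (sim x y - 2 * sre x y * sim x y)| <= S1.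
  move=> yI; rewrite normrM (gtr0_norm a0) ler_pM2l//.
  have := reC x _ yI; have := imC x _ yI; rewrite -/(sre x y) -/(sim x y).
  move: (sre x y) (sim x y) => p q qC pC.
  have pq : `|p * q| <= C ^+ 2 by rewrite normrM expr2 ler_pM.
  have := ler_normB q (2 * p * q).
  rewrite -mulrA (normrM 2) (ger0_norm (_ : 0 <= 2 :> R))//.
  lra.
(* Bounds the two parts of the derivative - 2 (z - i b) exp (- (z - i b)^2) of the Gaussian. *)
pose Q1 (x : R) := 2 * (`|x| + B) * (2 * (M * gauss_fun x)).
have Q1_ub x y (p q : R) : y \in `](- d), (b + d)[ ->
    `|p| <= M * gauss_fun x -> `|q| <= M * gauss_fun x ->
    `|p * (- 2 * x) - q * (- 2 * (y - b))| <= Q1 x /\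
    `|p * (- 2 * (y - b)) + q * (- 2 * x)| <= Q1 x.
  move=> /yB' yI pM qM.
  have g0 : 0 <= M * gauss_fun x by exact: mulr_ge0 (ltW M0) (gauss_fun_ge0 x).
  have xB : `|- 2 * x| <= 2 * (`|x| + B).
    by rewrite normrM normrN (ger0_norm (ler0n R 2)) ler_pM2l// lerDl.
  have bB : `|- 2 * (y - b)| <= 2 * (`|x| + B).
    by rewrite normrM normrN (ger0_norm (ler0n R 2)) ler_pM2l// (le_trans yI)// lerDr.
  have le (u v : R) : `|u| <= M * gauss_fun x -> `|v| <= 2 * (`|x| + B) ->
      `|u * v| <= M * gauss_fun x * (2 * (`|x| + B)).
    by move=> ? ?; rewrite normrM ler_pM.
  have := le _ _ pM xB; have := le _ _ pM bB.
  have := le _ _ qM xB; have := le _ _ qM bB.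
  rewrite /Q1; split.
    apply: le_trans (ler_normB _ _) _; lra.
  apply: le_trans (ler_normD _ _) _; lra.
(* One dominating function [G] has to serve twice: the first two terms of [K] dominate the
   derivative of the product, the last one the product itself. *)
pose K := 2 * S1 * M + 8 * C * M * (1 + B) + 2 * C * M.
pose G (x : R) := K * (2 * expR (- x ^+ 2 / 2)).
have S10 : 0 <= S1.
  by rewrite mulr_ge0 ?ltW// addr_gt0// mulr_gt0// exprn_gt0.
have GE x : 2 * S1 * (M * gauss_fun x) + 2 * C * Q1 x <= G x.
  rewrite /G; apply: le_trans (_ : K * ((1 + `|x|) * gauss_fun x) <= _); last first.
    rewrite ler_wpM2l ?gauss_fun_half// /K.
    have ? : 0 <= S1 * M by rewrite mulr_ge0// ltW.
    have ? : 0 <= C * M by rewrite mulr_ge0// ltW.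
    have ? : 0 <= C * M * B by rewrite mulr_ge0// mulr_ge0// ltW.
    by lra.
  rewrite /Q1 /K.
  have -> : 2 * S1 * (M * gauss_fun x) + 2 * C * (2 * (`|x| + B) * (2 * (M * gauss_fun x))) =
    (2 * S1 * M + 8 * C * M * (`|x| + B)) * gauss_fun x by ring.
  rewrite [leRHS]mulrA ler_wpM2r ?gauss_fun_ge0//.
  have x0 : 0 <= `|x| by [].
  have ? : 0 <= S1 * M by rewrite mulr_ge0// ltW.
  have CM : 0 <= C * M by rewrite mulr_ge0// ltW.
  have ? : 0 <= S1 * M * `|x| by rewrite mulr_ge0.
  have ? : 0 <= C * M * `|x| by rewrite mulr_ge0.
  have ? : 0 <= C * M * (B * `|x|) by rewrite mulr_ge0// mulr_ge0.
  have ? : 0 <= C * M * B by rewrite mulr_ge0.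
  by lra.
have GE2 x : 2 * C * (M * gauss_fun x) <= G x.
  rewrite /G; apply: le_trans (_ : K * ((1 + `|x|) * gauss_fun x) <= _); last first.
    rewrite ler_wpM2l ?gauss_fun_half// /K.
    have ? : 0 <= S1 * M by rewrite mulr_ge0// ltW.
    have ? : 0 <= C * M by rewrite mulr_ge0// ltW.
    have ? : 0 <= C * M * B by rewrite mulr_ge0// mulr_ge0// ltW.
    by lra.
  rewrite /K [leLHS]mulrA [leRHS]mulrA ler_wpM2r ?gauss_fun_ge0//.
  have x0 : 0 <= `|x| by [].
  have ? : 0 <= S1 * M by rewrite mulr_ge0// ltW.
  have CM : 0 <= C * M by rewrite mulr_ge0// ltW.
  have ? : 0 <= S1 * M * `|x| by rewrite mulr_ge0.
  have ? : 0 <= C * M * `|x| by rewrite mulr_ge0.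
  have ? : 0 <= C * M * (B * `|x|) by rewrite mulr_ge0// mulr_ge0.
  have ? : 0 <= C * M * B by rewrite mulr_ge0.
  by lra.
have mix (p q u v c m : R) : 0 <= c -> `|p| <= c -> `|q| <= c ->
    `|u| <= m -> `|v| <= m -> `|p * u - q * v| <= 2 * c * m /\
    `|p * u + q * v| <= 2 * c * m.
  move=> c1 pc qc um vm.
  have h1 : `|p * u| <= c * m by rewrite normrM ler_pM.
  have h2 : `|q * v| <= c * m by rewrite normrM ler_pM.
  have := ler_normB (p * u) (q * v); have := ler_normD (p * u) (q * v).
  by split; lra.
(* [D] + i [D'] is the derivative of the product given by Leibniz' rule. *)
pose D x y := a * (sre x y - sre x y ^+ 2 + sim x y ^+ 2) * gre b x y -
  a * (sim x y - 2 * sre x y * sim x y) * gim b x y +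
  (sre x y * (gre b x y * (- 2 * x) - gim b x y * (- 2 * (y - b))) -
   sim x y * (gre b x y * (- 2 * (y - b)) + gim b x y * (- 2 * x))).
pose D' x y := a * (sre x y - sre x y ^+ 2 + sim x y ^+ 2) * gim b x y +
  a * (sim x y - 2 * sre x y * sim x y) * gre b x y +
  (sre x y * (gre b x y * (- 2 * (y - b)) + gim b x y * (- 2 * x)) +
   sim x y * (gre b x y * (- 2 * x) - gim b x y * (- 2 * (y - b)))).
have lim0 (u : R^nat) (f : R -> R) : (gauss_fun \o u) n @[n --> \oo] --> (0 : R) ->
    (forall x, `|f x| <= 2 * C * (M * gauss_fun x)) ->
    f (u n) @[n --> \oo] --> 0.
  move=> u0 fM; apply: norm_cvg0.
  apply: (@squeeze_cvgr _ _ _ _ (cst 0) (fun n => 2 * C * (M * (gauss_fun \o u) n))).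
  - by apply/nearW => n /=; rewrite normr_ge0 fM.
  - exact: cvg_cst.
  - have : 2 * C * (M * (gauss_fun \o u) n) @[n --> \oo] --> 2 * C * (M * (0 : R)).
      by apply: cvgM; [exact: cvg_cst|apply: cvgM => //; exact: cvg_cst].
    by rewrite !mulr0.
pose re x y := sre x y * gre b x y - sim x y * gim b x y.
pose im x y := sre x y * gim b x y + sim x y * gre b x y.
(* At height b the Gaussian is real. *)
transitivity (\int[mu]_x im x b).
  apply: eq_Rintegral => x _; rewrite /im /sim /gre /gim /gauss_fun subrr.
  by rewrite !mulr0 oppr0 sin0 cos0 expr0n/= subr0 !mulr0 add0r mulr1.
(* At height 0 the logistic function is real, and only the imaginary part of the Gaussian is
   left. *)
transitivity (\int[mu]_x im x 0); last first.
  apply: eq_Rintegral => x _.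
  rewrite /im /sim /sre /gre /gim /logistic_re /logistic_im /logistic_den.
  rewrite mulr0 sin0 cos0 !mulr0 mul0r mul0r addr0 !mulr1 expr0n/= addr0.
  rewrite sub0r sqrrN mulrN opprK opprB; congr (_ * _).
  have := expR_gt0 (- (a * x + k)) => e0; field.
  by rewrite gt_eqF// addr_gt0.
apply: (@cauchy_riemann_shift R re im D D' G b d b0 d0).
- move=> x y yI; apply: cauchy_riemannM (cauchy_riemann_gauss b x y).
  exact: cauchy_riemann_logistic (cy y yI).
- move=> y yI x.
  have [sx1 sx2 _ _] := cauchy_riemann_logistic k x (cy y yI).
  have [gx1 gx2 _ _] := cauchy_riemann_gauss b x y.
  apply/differentiable_continuous/derivable1_diffP.
  by apply: (@ex_derive _ _ _ _ _ (fun x => D x y)); rewrite /D/sre/sim; apply: is_derive_eq.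
- move=> y yI; have [g1 g2] := cvg_gauss_fun_nat.
  have fM x : `|sre x y * gre b x y - sim x y * gim b x y| <= 2 * C * (M * gauss_fun x).
    by apply: (mix _ _ _ _ _ _ (ltW C0) _ _ _ _).1; [exact: reC|exact: imC|exact: greM|exact: gimM].
  by split; apply: lim0 fM.
- have := integrableZl measurableT (K * 2) integrable_half_gauss.
  by apply: eq_integrable => // x _; rewrite -EFinM /= /G mulrA.
- move=> x y yI; have [h1 h2] := Q1_ub x y _ _ yI (greM x y yI) (gimM x y yI).
  apply: le_trans (GE x); apply: le_trans (ler_normD _ _) _; apply: lerD.
    by apply: (mix _ _ _ _ _ _ _ _ _ _ _).1; [|exact: S1_re|exact: S1_im|exact: greM|exact: gimM].
  by apply: (mix _ _ _ _ _ _ (ltW C0) _ _ _ _).1; [exact: reC|exact: imC| |].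
- move=> x y yI; apply: le_trans (GE2 x).
  by apply: (mix _ _ _ _ _ _ (ltW C0) _ _ _ _).2; [exact: reC|exact: imC|exact: gimM|exact: greM].
Qed.

End logistic_shift.

Section continuation.
Context {R : realType} {d : measure_display} {T : measurableType d}.
Variable P : probability T R.
Local Notation mu := (@lebesgue_measure R).

(** A bound that depends on x alone is enough, because P has total mass 1. *)
Lemma integrable_prod_dominated (f : T * measurableTypeR R -> R)
    (g : measurableTypeR R -> R) :
  measurable_fun setT f -> mu.-integrable setT (EFin \o g) ->
  (forall t x, `|f (t, x)| <= g x) ->
  (P \x mu)%E.-integrable setT (EFin \o f).
Proof.
move=> mf intg fg.
have mg := measurable_int _ intg.
have mEf : measurable_fun setT (EFin \o f) by exact/measurable_EFinP.
apply/(integrable12ltyP P mu mEf).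
have [_ gy] := integrableP _ _ _ intg.
apply: le_lt_trans gy.
have -> : (\int[mu]_x `|(EFin \o g) x| = \int[P]_t \int[mu]_x `|(EFin \o g) x|)%E.
  by rewrite -[LHS]mule1 -(probability_setT P) -integral_cst.
apply: ge0_le_integral => //=.
- by move=> t _; exact: integral_ge0.
- apply: (measurable_fun_fubini_tonelli_F (fun z => `|(EFin \o f) z|%E)) => //.
  exact: measurableT_comp.
- move=> t _; apply: ge0_le_integral => //=.
  + apply/measurable_EFinP; apply: measurableT_comp => //.
    exact: (measurableT_comp mf).
  + by apply/measurable_EFinP/measurableT_comp => //; exact/measurable_EFinP.
  + by move=> x _; rewrite lee_fin (le_trans (fg _ _))// ler_norm.
Qed.

Lemma measurable_logistic_im d' (T' : measurableType d') (f : T' -> R) (b : R) :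
  measurable_fun setT f -> measurable_fun setT (fun t => logistic_im (f t) b).
Proof.
move=> mf.
have me : measurable_fun setT (fun t => expR (- f t)).
  by apply: measurableT_comp => //; exact: measurableT_comp.
have mec (c : R) : measurable_fun setT (fun t => expR (- f t) * c).
  exact: measurable_funM.
apply: measurable_fun_div => //.
apply: measurable_funD; apply: measurable_funX => //.
exact: measurable_funD.
Qed.

Lemma continuous_logistic_im (b : R) : -1 < cos b ->
  continuous (fun s => logistic_im s b).
Proof.
move=> cb.
rewrite (_ : logistic_im^~ b = fun s => logistic_im (1 * s + 0) (1 * b)); last first.
  by apply/funext => s; rewrite !mul1r addr0.
have cb1 : -1 < cos (1 * b) by rewrite mul1r.
move=> s; have [_ sx _ _] := cauchy_riemann_logistic 0 s cb1.
exact/differentiable_continuous/derivable1_diffP/ex_derive.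
Qed.

Lemma cvg_logistic_im (u : R^nat) (s b : R) : -1 < cos b ->
  u n @[n --> \oo] --> s ->
  logistic_im (u n) b @[n --> \oo] --> logistic_im s b.
Proof. by move=> cb us; exact: (cvg_comp _ _ us (@continuous_logistic_im b cb s)). Qed.

Lemma integrable_logistic_gauss (a k b : R) : -1 < cos b ->
  mu.-integrable setT (fun x => (logistic_im (a * x + k) b * gauss_fun x)%:E).
Proof.
move=> cb.
have := integrableZl measurableT (2 / (1 + cos b)) (@integrableT_gauss R).
apply: le_integrable => //.
  apply/measurable_EFinP; apply: measurable_funM; last exact: measurable_gauss_fun.
  by apply: measurable_logistic_im; apply: measurable_funD => //; exact: measurable_funM.
move=> x _; rewrite lee_fin; apply: le_trans (ler_norm _).
rewrite normrM (ger0_norm (gauss_fun_ge0 x)) ler_wpM2r ?gauss_fun_ge0//.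
exact: normr_logistic_im.
Qed.

Lemma logistic_gt0 (s : R) : 0 < (1 + expR (- s))^-1.
Proof. by rewrite invr_gt0 addr_gt0// expR_gt0. Qed.

Lemma logistic_le1 (s : R) : (1 + expR (- s))^-1 <= 1.
Proof. by rewrite invf_le1 ?lerDl ?expR_ge0// addr_gt0// expR_gt0. Qed.

(** The imaginary part of exp (- (x - i b)^2) at real x. *)
Let kern (b : R) (x : measurableTypeR R) : R :=
  expR (b ^+ 2 - x ^+ 2) * sin (2 * x * b).

Let measurable_kern b : measurable_fun setT (kern b).
Proof.
apply: measurable_funM.
  by apply: measurableT_comp => //; apply: measurable_funB => //; exact: measurable_funX.
apply: (measurableT_comp (continuous_measurable_fun (@continuous_sin R))).
by apply: measurable_funM => //; exact: measurable_funM.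
Qed.

Let normr_kern b x : `|kern b x| <= expR (b ^+ 2) * gauss_fun x.
Proof.
rewrite normrM ger0_norm ?expR_ge0// /gauss_fun -expRD.
by rewrite ler_piMr ?expR_ge0// sin_max.
Qed.

Let measurable_logistic d' (T' : measurableType d') (f : T' -> R) :
  measurable_fun setT f -> measurable_fun setT (fun t => (1 + expR (- f t))^-1).
Proof.
move=> mf; apply: measurable_funV; apply: measurable_funD => //.
by apply: measurableT_comp => //; exact: measurableT_comp.
Qed.

Let normr_logistic_kern s b x :
  `|(1 + expR (- s))^-1 * kern b x| <= expR (b ^+ 2) * gauss_fun x.
Proof.
rewrite normrM (le_trans _ (normr_kern b x))// ler_piMl//.
by rewrite ger0_norm ?logistic_le1// ltW// logistic_gt0.
Qed.

Let integrable_logistic_kern a k b :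
  mu.-integrable setT (fun x => ((1 + expR (- (a * x + k)))^-1 * kern b x)%:E).
Proof.
have := integrableZl measurableT (expR (b ^+ 2)) (@integrableT_gauss R).
apply: le_integrable => //.
  apply/measurable_EFinP; apply: measurable_funM => //.
  by apply: measurable_logistic; apply: measurable_funD => //; exact: measurable_funM.
move=> x _; rewrite lee_fin (le_trans (normr_logistic_kern _ _ _))//.
exact: ler_norm.
Qed.

Let logistic_shiftE a k b : 0 < a -> 0 <= b -> a * b < pi ->
  (\int[mu]_x (logistic_im (a * x + k)%R (a * b)%R * gauss_fun x)%:E =
   \int[mu]_x ((1 + expR (- (a * x + k)))^-1 * kern b x)%:E)%E.
Proof.
move=> a0 b0 ab.
have cab : -1 < cos (a * b).
  by apply: cosN1_lt; rewrite ger0_norm// mulr_ge0// ltW.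
have := logistic_shift k a0 b0 ab; rewrite /Rintegral => shift.
rewrite -[LHS]fineK; last first.
  exact: integrable_fin_num (integrable_logistic_gauss _ _ cab).
rewrite -[RHS]fineK ?shift//.
exact: integrable_fin_num (integrable_logistic_kern _ _ _).
Qed.

(* Both sides of [logistic_shift], with steps [eta] and [alpha * eta], involve
   the same real kernel; letting [eta] tend to 0 localizes them. *)
Lemma logistic_continuation (Y : {RV P >-> R}) (alpha k : R) :
  0 < alpha < 1 ->
  (forall s, 'E_P[fun t => ((1 + expR (- (s + Y t)))^-1)%R] =
             ((1 + expR (- (alpha * s + k)))^-1)%:E)%E ->
  forall b s, 0 <= b < pi ->
  ('E_P[fun t => logistic_im (s + Y t)%R b] =
   (logistic_im (alpha * s + k) (alpha * b))%:E)%E.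
Proof.
move=> /andP[a0 a1] YE b s /andP[b0 bpi].
have mY : measurable_fun setT (Y : T -> R) by exact: measurable_funPT.
have cb : -1 < cos b by apply: cosN1_lt; rewrite ger0_norm.
have ab0 : 0 <= alpha * b by rewrite mulr_ge0// ltW.
have abb : alpha * b <= b by rewrite ler_piMl// ltW.
have cab : -1 < cos (alpha * b).
  by apply: cosN1_lt; rewrite ger0_norm// (le_lt_trans abb).
(* The line is shifted by b / [eta n], so that after multiplication by the step [eta n] the height
   is b for every n. *)
pose eta (n : nat) : R := n.+1%:R^-1.
have eta0 n : 0 < eta n by rewrite invr_gt0.
have etaK n : eta n * (b / eta n) = b by rewrite mulrC divfK// gt_eqF.
pose C := 2 / (1 + cos b); pose C' := 2 / (1 + cos (alpha * b)).
pose F n (z : T * measurableTypeR R) : R :=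
  logistic_im (eta n * z.2 + (s + Y z.1)) b * gauss_fun z.2.
pose F0 (z : T * measurableTypeR R) : R := logistic_im (s + Y z.1) b * gauss_fun z.2.
have mgauss : measurable_fun setT (fun z : T * measurableTypeR R => gauss_fun z.2 : R).
  by apply: (measurableT_comp measurable_gauss_fun).
have mYz : measurable_fun setT (fun z : T * measurableTypeR R => s + Y z.1).
  by apply: measurable_funD => //; exact: (measurableT_comp mY).
have mF n : measurable_fun setT (F n).
  apply: measurable_funM => //; apply: measurable_logistic_im.
  by apply: measurable_funD => //; apply: measurable_funM.
have mF0 : measurable_fun setT F0.
  by apply: measurable_funM => //; exact: measurable_logistic_im.
have intg (c : R) : mu.-integrable setT (EFin \o (fun x => c * gauss_fun x)).
  by have := integrableZl measurableT c (@integrableT_gauss R).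
have bnd (v t x : R) : -1 < cos t ->
    `|logistic_im v t * gauss_fun x| <= 2 / (1 + cos t) * gauss_fun x.
  move=> ct; rewrite normrM (ger0_norm (gauss_fun_ge0 x)).
  by rewrite ler_wpM2r ?gauss_fun_ge0// normr_logistic_im.
have intF n : (P \x mu)%E.-integrable setT (EFin \o F n).
  by apply: (integrable_prod_dominated (mF n) (intg C)) => t x; exact: bnd.
have intF0 : (P \x mu)%E.-integrable setT (EFin \o F0).
  by apply: (integrable_prod_dominated mF0 (intg C)) => t x; exact: bnd.
have intCz : (P \x mu)%E.-integrable setT (EFin \o (fun z => C * gauss_fun z.2)).
  apply: (integrable_prod_dominated _ (intg C)) => [|t x /=].
    by apply: measurable_funM.
  by rewrite ger0_norm// mulr_ge0 ?gauss_fun_ge0// divr_ge0//; lra.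
have cvgF : (\int[P \x mu]_z (F n z)%:E @[n --> \oo] -->
             \int[P \x mu]_z (F0 z)%:E)%E.
  apply: (@dominated_cvg _ _ _ (P \x mu)%E setT measurableT _ _
    (EFin \o (fun z => C * gauss_fun z.2))) => //.
  - by move=> n; exact/measurable_EFinP.
  - move=> z _; apply: cvg_EFin; first exact: nearW.
    apply: cvgM; last exact: cvg_cst.
    apply: (cvg_logistic_im (u := fun n => eta n * z.2 + (s + Y z.1))) => //.
    rewrite -[X in _ --> X]add0r; apply: cvgD; last exact: cvg_cst.
    by rewrite -[X in _ --> X](mul0r z.2); apply: cvgM; [exact: cvg_harmonic|exact: cvg_cst].
  - by move=> n z _; rewrite lee_fin; exact: bnd.
have F0E : (\int[P \x mu]_z (F0 z)%:E =
    'E_P[fun t => logistic_im (s + Y t)%R b] * (Num.sqrt pi)%:E)%E.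
  rewrite -integral12_prod_meas1// unlock -integralZr//=; last first.
    apply: (integrable_bounded P (C := C)) => [|t]; last exact: normr_logistic_im.
    by apply: measurable_logistic_im; exact: measurable_funD.
  apply: eq_integral => t _; rewrite /fubini_F /F0 /=.
  under eq_integral do rewrite EFinM.
  by rewrite integralZl ?integralT_gauss//; exact: integrableT_gauss.
pose G n (z : T * measurableTypeR R) : R :=
  (1 + expR (- (eta n * z.2 + (s + Y z.1))))^-1 * kern (b / eta n) z.2.
have intG n : (P \x mu)%E.-integrable setT (EFin \o G n).
  have intM : mu.-integrable setT
      (EFin \o (fun x => expR ((b / eta n) ^+ 2) * gauss_fun x)) by exact: intg.
  apply: (integrable_prod_dominated _ intM) => [|t x]; last exact: normr_logistic_kern.
  apply: measurable_funM; last exact: (measurableT_comp (measurable_kern _)).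
  by apply: measurable_logistic; apply: measurable_funD => //; exact: measurable_funM.
(* For each outcome the line is moved down to height 0 with step [eta n]; there the hypothesis on
   real arguments gives the average over P, and the line is moved up again with step alpha [eta n].
   Both moves involve the same kernel at height 0. *)
have FE n : (\int[P \x mu]_z (F n z)%:E =
  \int[mu]_x (logistic_im (alpha * eta n * x + (alpha * s + k))%R (alpha * b)%R *
              gauss_fun x)%:E)%E.
  have be0 : 0 <= b / eta n by rewrite divr_ge0// ltW.
  transitivity (\int[P]_t \int[mu]_x (G n (t, x))%:E)%E.
    have -> : (\int[P \x mu]_z (F n z)%:E = \int[P]_t \int[mu]_x (F n (t, x))%:E)%E.
      exact/esym/(integral12_prod_meas1 (intF n)).
    apply: eq_integral => t _; rewrite /F /G /= -logistic_shiftE ?etaK//.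
  rewrite (Fubini (intG n)).
  rewrite -(etaK n) (mulrA alpha) logistic_shiftE ?mulr_gt0//; last first.
    by rewrite -mulrA etaK (le_lt_trans abb).
  apply: eq_integral => x _; rewrite /G /=.
  under eq_integral do rewrite EFinM.
  rewrite integralZr//=; last first.
    apply: (integrable_bounded P (C := 1)) => [|t].
      by apply: measurable_logistic; apply: measurable_funD => //; exact: measurable_funD.
    by rewrite ger0_norm ?logistic_le1// ltW// logistic_gt0.
  have := YE (eta n * x + s); rewrite unlock.
  under eq_integral do rewrite -addrA.
  by move=> ->; rewrite -EFinM mulrDr mulrA addrA.
have cvgG : (\int[P \x mu]_z (F n z)%:E @[n --> \oo] -->
   (logistic_im (alpha * s + k) (alpha * b))%:E * (Num.sqrt pi)%:E)%E.
  under eq_fun do rewrite FE.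
  rewrite -integralT_gauss -integralZl//; last exact: integrableT_gauss.
  apply: (@dominated_cvg _ _ _ mu setT measurableT _ _
    (EFin \o (fun x => C' * gauss_fun x))) => //.
  - by move=> n; exact: measurable_int (integrable_logistic_gauss _ _ cab).
  - move=> x _; apply: cvg_EFin; first exact: nearW.
    apply: cvgM; last exact: cvg_cst.
    apply: cvg_logistic_im => //.
    rewrite -[X in _ --> X]add0r; apply: cvgD; last exact: cvg_cst.
    rewrite -[X in _ --> X](mul0r x); apply: cvgM; last exact: cvg_cst.
    by rewrite -[X in _ --> X](mulr0 alpha); apply: cvgM; [exact: cvg_cst|exact: cvg_harmonic].
  - by move=> n x _; rewrite lee_fin; exact: bnd.
have := cvg_unique _ cvgF cvgG; rewrite F0E => /(_ (@ereal_hausdorff R) _).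
move=> eqE; have spi : Num.sqrt pi != 0 :> R by rewrite gt_eqF// sqrtr_gt0 pi_gt0.
have := f_equal (fun x : \bar R => x * (Num.sqrt pi)^-1%:E)%E eqE.
by rewrite -muleA -!EFinM mulfV// mule1 mulfK.
Qed.

End continuation.

(** * Inversion of the Stieltjes transform *)

Section poisson_kernel.
Context {R : realType}.
Local Notation mu := (@lebesgue_measure R).
Implicit Types b x y r : R.

(* - Im (1 / (x + y exp (i b))) *)
Definition poisson_kernel b y x : R :=
  y * sin b / ((x + y * cos b) ^+ 2 + (y * sin b) ^+ 2).

(** For y > 0 and 0 < b < pi this is pi / 2 minus the argument of x + y exp (i b). *)
Definition poisson_primitive b y x : R :=
  atan ((x + y * cos b) / (y * sin b)).

Lemma poisson_den_gt0 b y x : 0 < b < pi -> 0 < y ->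
  0 < (x + y * cos b) ^+ 2 + (y * sin b) ^+ 2.
Proof.
move=> bpi y0; rewrite ltr_wpDl ?sqr_ge0// exprn_gt0// mulr_gt0//.
exact: sin_gt0_pi.
Qed.

Lemma poisson_kernel_ge0 b y x : 0 <= b <= pi -> 0 <= y -> 0 <= poisson_kernel b y x.
Proof.
move=> bpi y0; rewrite divr_ge0 ?addr_ge0 ?sqr_ge0// mulr_ge0//.
exact: sin_ge0_pi.
Qed.

Lemma is_derive_poisson_primitive b y x : 0 < b < pi -> 0 < y ->
  is_derive x 1 (poisson_primitive b y) (poisson_kernel b y x).
Proof.
move=> bpi y0; have s0 : y * sin b != 0.
  by rewrite gt_eqF// mulr_gt0// sin_gt0_pi.
have n0 := poisson_den_gt0 x bpi y0.
rewrite /poisson_primitive; apply: is_derive_eq.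
rewrite /poisson_kernel/= /GRing.scale/=; field.
by rewrite (gt_eqF n0)/= -negb_or -mulf_eq0 mulrC.
Qed.

Lemma continuous_poisson_kernel b y : 0 < b < pi -> 0 < y ->
  continuous (poisson_kernel b y).
Proof.
move=> bpi y0 x; have n0 := lt0r_neq0 (poisson_den_gt0 x bpi y0).
apply/differentiable_continuous/derivable1_diffP.
apply: derivableM => //; apply: derivableV => //.
Qed.

Lemma integral_poisson_kernel b y x1 x2 : 0 < b < pi -> 0 < y -> x1 < x2 ->
  (\int[mu]_(x in `[x1, x2]) (poisson_kernel b y x)%:E =
   (poisson_primitive b y x2 - poisson_primitive b y x1)%:E)%E.
Proof.
move=> bpi y0 x12.
have dP x : derivable (poisson_primitive b y) x 1.
  by have := is_derive_poisson_primitive x bpi y0 => ?; exact: ex_derive.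
have cP : continuous (poisson_primitive b y).
  by move=> x; exact/differentiable_continuous/derivable1_diffP.
rewrite (@continuous_FTC2 _ _ (poisson_primitive b y)) ?EFinB//.
- by apply: continuous_subspaceT; exact: continuous_poisson_kernel.
- split => //; first exact/cvg_at_right_filter/cP.
  exact/cvg_at_left_filter/cP.
- move=> x _; have := is_derive_poisson_primitive x bpi y0 => ?.
  by rewrite derive1E derive_val.
Qed.

(** The denominator y sin b tends to 0 from above while the numerator tends to x - y, so the sign of
    x - y decides which end of the range of atan is reached. *)
Lemma cvg_poisson_primitive (u : R^nat) y x : 0 < y ->
  (forall n, 0 < u n < pi) -> u n @[n --> \oo] --> (pi : R) ->
  poisson_primitive (u n) y x @[n --> \oo] --> pi / 2 * Num.sg (x - y).
Proof.
move=> y0 un upi.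
have cosu : cos (u n) @[n --> \oo] --> (- 1 : R).
  by rewrite -cospi; apply: (cvg_comp _ _ upi (@continuous_cos R pi)).
have sinu : sin (u n) @[n --> \oo] --> (0 : R).
  by rewrite -(@sinpi R); apply: (cvg_comp _ _ upi (@continuous_sin R pi)).
have num_cvg : x + y * cos (u n) @[n --> \oo] --> x - y.
  rewrite -[X in _ --> x + X]mulrN1; apply: cvgD; first exact: cvg_cst.
  by apply: cvgM => //; exact: cvg_cst.
have den_cvg : y * sin (u n) @[n --> \oo] --> (0 : R).
  by rewrite -(mulr0 y); apply: cvgM => //; exact: cvg_cst.
have den0 n : 0 < y * sin (u n) by rewrite mulr_gt0// sin_gt0_pi.
have infty (f : R^nat) (l : R) : 0 < l -> f n @[n --> \oo] --> l ->
    f n / (y * sin (u n)) @[n --> \oo] --> +oo.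
  move=> l0 fl.
  have f0 : \forall n \near \oo, 0 < f n / (y * sin (u n)).
    near=> n; rewrite divr_gt0//; near: n; exact: (cvgr_gt l fl).
  apply/(gtr0_cvgV0 f0).
  have -> : unstable.inv_fun (fun n => f n / (y * sin (u n))) =
      (fun n => (y * sin (u n)) * (f n)^-1).
    by apply/funext => n; rewrite /unstable.inv_fun invf_div.
  rewrite -(mul0r l^-1); apply: cvgM => //; apply: cvgV => //.
  by rewrite gt_eqF.
have catan (f : R^nat) (l : R) : f n @[n --> \oo] --> l ->
    atan (f n) @[n --> \oo] --> atan l.
  by move=> fl; exact: (cvg_comp _ _ fl (@continuous_atan R l)).
have catany (f : R^nat) : f n @[n --> \oo] --> +oo ->
    atan (f n) @[n --> \oo] --> pi / 2.
  by move=> fl; exact: (cvg_comp _ _ fl (@cvgy_atan R)).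
have [xy|xy|->] := ltgtP x y; last first.
- rewrite subrr sgr0 mulr0 -(atan0 R).
  apply: (catan (fun n => (y + y * cos (u n)) / (y * sin (u n)))).
  (* At x = y the quotient has the form 0 / 0; it is resolved by (1 + cos) / sin = sin / (1 -
     cos). *)
  have -> : (fun n => (y + y * cos (u n)) / (y * sin (u n))) =
      (fun n => sin (u n) * (1 - cos (u n))^-1).
    apply/funext => n; have s0 := den0 n.
    have cs : sin (u n) ^+ 2 = (1 - cos (u n)) * (1 + cos (u n)).
      by rewrite sin2cos2; ring.
    have sn0 : 0 < sin (u n) by exact: sin_gt0_pi.
    have c0 : 1 - cos (u n) != 0.
      by apply: contraTneq sn0 => c0; have := cs; rewrite c0 mul0r => /eqP;
        rewrite sqrf_eq0 => /eqP ->; rewrite ltxx.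
    apply: (@mulIf _ (1 - cos (u n))) => //; rewrite mulfVK//.
    apply: (@mulIf _ (y * sin (u n))); rewrite ?gt_eqF// mulrAC mulfVK ?gt_eqF//.
    by rewrite mulrCA -expr2 cs; ring.
  have -> : (0 : R) = 0 * (1 - (- 1))^-1 by rewrite mul0r.
  apply: cvgM => //; apply: cvgV.
    by rewrite opprK gt_eqF.
  by apply: cvgB => //; exact: cvg_cst.
- rewrite gtr0_sg ?subr_gt0// mulr1.
  apply: catany.
  by apply: infty num_cvg; rewrite subr_gt0.
- rewrite ltr0_sg ?subr_lt0// mulrN1.
  have -> : (fun n => poisson_primitive (u n) y x) =
      (fun n => - atan (- (x + y * cos (u n)) / (y * sin (u n)))).
    by apply/funext => n; rewrite mulNr atanN opprK.
  apply: cvgN; apply: catany.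
  by apply: infty (cvgN num_cvg); rewrite opprB subr_gt0.
Unshelve. all: by end_near. Qed.
End poisson_kernel.

Section stieltjes.
Context {R : realType} {d : measure_display} {T : measurableType d}.
Variable P : probability T R.
Local Notation mu := (@lebesgue_measure R).
Variables (alpha r : R) (Y : {RV P >-> R}).
Hypotheses (a01 : 0 < alpha < 1) (r0 : 0 < r) (Y0 : forall t, 0 < Y t).
Hypothesis YS : forall l, 0 < l ->
  ('E_P[fun t => ((1 + l * Y t)^-1)%R] = ((1 + r * l `^ alpha)^-1)%:E)%E.

(** This is - Im (x^(alpha - 1) / (x^alpha + r exp (i alpha b))), the value that the formula for the
    Stieltjes transform predicts for - Im E[1 / (x + Y exp (i b))]. *)
Definition stieltjes_density b x : R :=
  x `^ (alpha - 1) * r * sin (alpha * b) /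
  ((r + x `^ alpha * cos (alpha * b)) ^+ 2 + (x `^ alpha * sin (alpha * b)) ^+ 2).

Let expR_powR (s a : R) : expR s `^ a = expR (a * s).
Proof. by rewrite -expRM mulrC. Qed.

Let mY : measurable_fun setT (Y : T -> R).
Proof. exact: measurable_funPT. Qed.

Let logY : {RV P >-> R} := HB.pack_for {mfun T >-> R} (fun t => ln (Y t))
  (isMeasurableFun.Build _ _ _ _ _ (measurableT_comp (@measurable_ln R) mY)).

Lemma measurable_poisson_kernel b d' (T' : measurableType d') (f g : T' -> R) :
  measurable_fun setT f -> measurable_fun setT g ->
  measurable_fun setT (fun t => poisson_kernel b (f t) (g t)).
Proof.
move=> mf mg; apply: measurable_fun_div; first exact: measurable_funM.
apply: measurable_funD; apply: measurable_funX; last exact: measurable_funM.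
by apply: measurable_funD => //; exact: measurable_funM.
Qed.

(** This is [YS] continued from real l to l = exp (i b) / x. In logistic form it is the continuation
    at s = - ln x; both sides then carry a factor x, which cancels. *)
Lemma stieltjes_poisson b x : 0 < b < pi -> 0 < x ->
  ('E_P[fun t => poisson_kernel b (Y t) x] = (stieltjes_density b x)%:E)%E.
Proof.
move=> /andP[b0 bpi] x0.
have logE s : ('E_P[fun t => ((1 + expR (- (s + logY t)))^-1)%R] =
    ((1 + expR (- (alpha * s + ln r)))^-1)%:E)%E.
  transitivity ('E_P[fun t => (1 - (1 + expR s * Y t)^-1)%R])%E.
    congr expectation; apply/funext => t /=.
    rewrite opprD expRD !expRN lnK ?posrE//.
    have := expR_gt0 s; have := Y0 t; set e := expR s => y0 e0.
    have ? : 0 < e * Y t + 1 by rewrite addr_gt0// mulr_gt0.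
    by field; rewrite !gt_eqF// addrC.
  rewrite expectation_onem.
  - rewrite YS ?expR_gt0// expR_powR -EFinB opprD expRD !expRN lnK ?posrE//.
    have := expR_gt0 (alpha * s); set e := expR _ => e0; congr EFin.
    have ? : 0 < e * r + 1 by rewrite addr_gt0// mulr_gt0.
    by field; rewrite !gt_eqF.
  - by apply: measurable_funV; apply: measurable_funD => //; exact: measurable_funM.
  - move=> t; have e0 := expR_gt0 s; have y0 := Y0 t.
    have ? : 0 < expR s * Y t by rewrite mulr_gt0.
    by rewrite invr_ge0 invf_le1 ?addr_gt0// lerDl !ltW// addr_gt0.
have bpi' : 0 <= b < pi by rewrite ltW.
have lx : expR (- (- ln x)) = x by rewrite opprK lnK.
have E1 t : logistic_im (- ln x + logY t) b = x * poisson_kernel b (Y t) x.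
  rewrite /logistic_im /logistic_den opprD expRD lx /= expRN lnK ?posrE//.
  rewrite /poisson_kernel.
  have n0 := poisson_den_gt0 x (introT andP (conj b0 bpi)) (Y0 t).
  have y0 := Y0 t.
  (* Y + x exp (i b) and x + Y exp (i b) have the same modulus. *)
  have n1 : 0 < (Y t + x * cos b) ^+ 2 + (x * sin b) ^+ 2.
    rewrite (_ : _ + _ = (x + Y t * cos b) ^+ 2 + (Y t * sin b) ^+ 2)//.
    rewrite !exprMn !sin2cos2; ring.
  have -> : (x + Y t * cos b) ^+ 2 + (Y t * sin b) ^+ 2 =
    (Y t + x * cos b) ^+ 2 + (x * sin b) ^+ 2.
    by rewrite !exprMn !sin2cos2; ring.
  by field; rewrite !gt_eqF.
have ab : 0 < alpha * b < pi.
  move: a01 => /andP[a0 a1]; rewrite mulr_gt0//=.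
  by rewrite (le_lt_trans _ bpi)// ler_piMl// ltW.
have xa0 : 0 < x `^ alpha by rewrite powR_gt0.
have E2 : logistic_im (alpha * - ln x + ln r) (alpha * b) =
    x * stieltjes_density b x.
  rewrite /logistic_im /logistic_den opprD expRD mulrN opprK expRN lnK ?posrE//.
  rewrite (_ : expR (alpha * ln x) = x `^ alpha); last first.
    by rewrite /powR gt_eqF.
  rewrite /stieltjes_density.
  have -> : x * (x `^ (alpha - 1) * r * sin (alpha * b) /
      ((r + x `^ alpha * cos (alpha * b)) ^+ 2 + (x `^ alpha * sin (alpha * b)) ^+ 2)) =
      x `^ alpha * r * sin (alpha * b) /
      ((r + x `^ alpha * cos (alpha * b)) ^+ 2 + (x `^ alpha * sin (alpha * b)) ^+ 2).
    rewrite !mulrA -{1}(powRr1 (ltW x0)) -powRD; last by apply/implyP => _; rewrite gt_eqF.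
    by rewrite addrC subrK.
  have n1 : 0 < (r + x `^ alpha * cos (alpha * b)) ^+ 2 + (x `^ alpha * sin (alpha * b)) ^+ 2.
    by rewrite ltr_wpDl ?sqr_ge0// exprn_gt0// mulr_gt0// sin_gt0_pi.
  by field; rewrite !gt_eqF.
have := logistic_continuation a01 logE (- ln x) bpi'; rewrite E2.
rewrite unlock; under eq_integral do rewrite E1 EFinM.
rewrite ge0_integralZl//=; last 3 first.
- by apply/measurable_EFinP; exact: measurable_poisson_kernel.
- move=> t _; rewrite lee_fin poisson_kernel_ge0 ?(ltW b0) ?(ltW bpi)//; exact/ltW/Y0.
- by rewrite lee_fin ltW.
rewrite EFinM => eqE.
have := f_equal (fun z : \bar R => x^-1%:E * z)%E eqE.
by rewrite !muleA -!EFinM mulVf ?gt_eqF// !mul1e mul1r.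
Qed.

Lemma measurable_stieltjes_density b : measurable_fun setT (stieltjes_density b).
Proof.
have mpow (p c : R) : measurable_fun setT (fun x : R => x `^ p * c).
  by apply: measurable_funM => //; exact: measurable_fun_powR.
apply: measurable_fun_div; first by apply: measurable_funM => //; exact: mpow.
apply: measurable_funD; apply: measurable_funX => //.
exact: measurable_funD.
Qed.

Let alpha_pi b : 0 < b <= pi -> 0 < alpha * b < pi.
Proof.
move=> /andP[b0 bpi]; have /andP[a0 a1] := a01.
by rewrite mulr_gt0//= (lt_le_trans _ bpi)// gtr_pMl.
Qed.

(** With z = x^alpha and c' = cos (alpha b), the right side is (1 + c') / 2 (r + z)^2 + (1 - c') / 2
    (r - z)^2, and c' >= cos (alpha pi) > -1. The bound is uniform in b up to and including pi, so
    that dominated convergence applies as b tends to pi. *)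
Let den_ge b x : 0 <= x -> 0 < b <= pi ->
  (1 + cos (alpha * pi)) / 2 * r ^+ 2 <=
  (r + x `^ alpha * cos (alpha * b)) ^+ 2 + (x `^ alpha * sin (alpha * b)) ^+ 2.
Proof.
move=> x0 /andP[b0 bpi]; have /andP[a0 a1] := a01.
have := powR_ge0 x alpha; set z := x `^ alpha => z0.
have pi0 := pi_gt0 R.
have /andP[ab0 abpi] := alpha_pi (introT andP (conj b0 bpi)).
have /andP[ap0 appi] := alpha_pi (introT andP (conj pi0 (lexx _))).
have cosle : cos (alpha * pi) <= cos (alpha * b).
  move: bpi; rewrite le_eqVlt => /predU1P[->//|bpi]; apply: ltW.
  by rewrite ltr_cos ?in_itv/= ?ltW//= ltr_pM2l.
rewrite exprMn sin2cos2.
have := cos_le1 (alpha * b); have := cos_geN1 (alpha * pi).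
move: cosle; set c := cos (alpha * pi); set c' := cos (alpha * b) => cc c1 c2.
have h1 : 0 <= (1 + c') * (2 * r * z + z ^+ 2).
  rewrite mulr_ge0//; first by lra.
  by rewrite addr_ge0 ?sqr_ge0// !mulr_ge0// ltW.
have h2 : 0 <= (1 - c') * (r - z) ^+ 2 by rewrite mulr_ge0 ?sqr_ge0//; lra.
have h3 : 0 <= (c' - c) * r ^+ 2 by rewrite mulr_ge0 ?sqr_ge0//; lra.
nra.
Qed.

Let one_cos_gt0 : 0 < 1 + cos (alpha * pi).
Proof.
have /andP[ap0 appi] := alpha_pi (introT andP (conj (pi_gt0 R) (lexx _))).
by rewrite -ltrBlDl sub0r cosN1_lt// gtr0_norm.
Qed.

Lemma stieltjes_density_ge0 b x : 0 <= x -> 0 < b <= pi -> 0 <= stieltjes_density b x.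
Proof.
move=> x0 /alpha_pi /andP[ab0 abpi].
rewrite divr_ge0 ?addr_ge0 ?sqr_ge0// !mulr_ge0 ?powR_ge0 ?(ltW r0)//.
by rewrite sin_ge0_pi// !ltW.
Qed.

Lemma stieltjes_density_le b x1 x2 x : 0 < x1 -> x1 <= x <= x2 -> 0 < b <= pi ->
  stieltjes_density b x <=
  x2 `^ alpha / x1 * r / ((1 + cos (alpha * pi)) / 2 * r ^+ 2).
Proof.
move=> x10 /andP[x1x xx2] bpi; have x0 := lt_le_trans x10 x1x.
have /andP[a0 a1] := a01.
have := den_ge (ltW x0) bpi.
have c0 : 0 < (1 + cos (alpha * pi)) / 2 * r ^+ 2.
  by rewrite mulr_gt0 ?exprn_gt0// divr_gt0//; exact: one_cos_gt0.
move=> den; rewrite /stieltjes_density ler_pM//.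
- have /andP[ab0 abpi] := alpha_pi bpi.
  by rewrite !mulr_ge0 ?powR_ge0 ?(ltW r0)// sin_ge0_pi// !ltW.
- by rewrite invr_ge0 addr_ge0 ?sqr_ge0.
- rewrite -[leRHS]mulr1 ler_pM ?sin_le1//.
  + by rewrite mulr_ge0 ?powR_ge0// ltW.
  + have /andP[ab0 abpi] := alpha_pi bpi.
    by rewrite sin_ge0_pi// !ltW.
  + rewrite ler_pM2r//.
    have -> : x `^ (alpha - 1) = x `^ alpha * x^-1.
      by rewrite powRD ?powRN ?powRr1 ?(ltW x0)//; apply/implyP => _; rewrite gt_eqF.
    rewrite ler_pM ?powR_ge0 ?invr_ge0 ?(ltW x0)//.
      by rewrite ge0_ler_powR// ?nnegrE ltW// (lt_le_trans x0).
    by rewrite lef_pV2.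
- by rewrite lef_pV2// posrE (lt_le_trans c0).
Qed.

Lemma cvg_stieltjes_density (u : R^nat) x : 0 < x ->
  u n @[n --> \oo] --> (pi : R) ->
  stieltjes_density (u n) x @[n --> \oo] --> stieltjes_density pi x.
Proof.
move=> x0 upi.
have au : alpha * u n @[n --> \oo] --> alpha * pi.
  by apply: cvgM => //; exact: cvg_cst.
have cosu : cos (alpha * u n) @[n --> \oo] --> cos (alpha * pi).
  exact: (cvg_comp _ _ au (@continuous_cos R (alpha * pi))).
have sinu : sin (alpha * u n) @[n --> \oo] --> sin (alpha * pi).
  exact: (cvg_comp _ _ au (@continuous_sin R (alpha * pi))).
apply: cvgM; first by apply: cvgM => //; exact: cvg_cst.
apply: cvgV.
  rewrite gt_eqF// (lt_le_trans _ (den_ge _ _)) ?(ltW x0) ?lexx ?pi_gt0//.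
  by rewrite mulr_gt0 ?exprn_gt0// divr_gt0//; exact: one_cos_gt0.
apply: cvgD.
  rewrite expr2; under eq_fun do rewrite expr2.
  by apply: cvgM; (apply: cvgD; first exact: cvg_cst); apply: cvgM => //; exact: cvg_cst.
rewrite expr2; under eq_fun do rewrite expr2.
by apply: cvgM; apply: cvgM => //; exact: cvg_cst.
Qed.

Let mprim b x : measurable_fun setT (fun t => poisson_primitive b (Y t) x).
Proof.
apply: (measurableT_comp (continuous_measurable_fun (@continuous_atan R))).
apply: measurable_fun_div; last exact: measurable_funM.
by apply: measurable_funD => //; exact: measurable_funM.
Qed.

Let normr_prim (b y x : R) : `|poisson_primitive b y x| <= pi / 2.
Proof. by rewrite ler_norml (ltW (atan_gtNpi2 _)) (ltW (atan_ltpi2 _)). Qed.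

Lemma stieltjes_primitive b x1 x2 : 0 < b < pi -> 0 < x1 < x2 ->
  ('E_P[fun t => (poisson_primitive b (Y t) x2 - poisson_primitive b (Y t) x1)%R] =
   \int[mu]_(x in `[x1, x2]) (stieltjes_density b x)%:E)%E.
Proof.
move=> bpi /andP[x10 x12].
pose f (z : T * measurableTypeR R) : \bar R :=
  (poisson_kernel b (Y z.1) z.2 * \1_(`[x1, x2]%classic) z.2)%:E.
have mf : measurable_fun setT f.
  apply/measurable_EFinP; apply: measurable_funM.
    by apply: measurable_poisson_kernel => //; exact: (measurableT_comp mY).
  by apply: (measurableT_comp (f := \1_(`[x1, x2]%classic) : measurableTypeR R -> R)).
have pk0 t x : 0 <= poisson_kernel b (Y t) x.
  by have /andP[b0 bpi'] := bpi; rewrite poisson_kernel_ge0 ?(ltW b0) ?(ltW bpi')// ltW.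
have f0 z : (0 <= f z)%E by rewrite /f lee_fin mulr_ge0.
transitivity (\int[P]_t \int[mu]_x f (t, x))%E.
  rewrite unlock; apply: eq_integral => t _.
  rewrite -integral_poisson_kernel// integral_mkcond.
  apply: eq_integral => x _; rewrite /f/= patchE indicE.
  by case: ifPn => _; rewrite ?mulr1 ?mulr0.
rewrite (fubini_tonelli _ mf f0) [RHS]integral_mkcond.
apply: eq_integral => x _; rewrite /f patchE.
case: ifPn => xI; last by rewrite integral0_eq// => t _; rewrite /= indicE (negbTE xI) mulr0.
rewrite -stieltjes_poisson//; last first.
  by move: xI; rewrite inE/= in_itv/= => /andP[+ _]; exact: lt_le_trans.
by rewrite unlock; apply: eq_integral => t _; rewrite /= indicE xI mulr1.
Qed.

(** Limit of the integrated identity as b tends to pi. The difference on the left is pi when Y lies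
    strictly between x1 and x2 and pi / 2 when Y is an endpoint: Stieltjes-Perron inversion, with
    atoms not yet excluded. *)
Lemma stieltjes_sg x1 x2 : 0 < x1 < x2 ->
  ('E_P[fun t => (pi / 2 * Num.sg (x2 - Y t) - pi / 2 * Num.sg (x1 - Y t))%R] =
   \int[mu]_(x in `[x1, x2]) (stieltjes_density pi x)%:E)%E.
Proof.
move=> x012; have /andP[x10 x12] := x012.
(* Positive because 1 / (n + 1) <= 1 < 2 <= pi. *)
pose u n : R := pi - n.+1%:R^-1.
have un n : 0 < u n < pi.
  have := pi_ge2 R; have : 0 < n.+1%:R^-1 :> R by rewrite invr_gt0.
  have : n.+1%:R^-1 <= 1 :> R by rewrite invf_le1// ler1n.
  rewrite /u; move: (n.+1%:R^-1) => i i1 i0 pi2; apply/andP; split; lra.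
have upi : u n @[n --> \oo] --> (pi : R).
  by rewrite -[X in _ --> X]subr0; apply: cvgB; [exact: cvg_cst|exact: cvg_harmonic].
have un' n : 0 < u n <= pi by have /andP[-> /ltW ->] := un n.
pose C := x2 `^ alpha / x1 * r / ((1 + cos (alpha * pi)) / 2 * r ^+ 2).
have cvgR : (\int[mu]_(x in `[x1, x2]) (stieltjes_density (u n) x)%:E @[n --> \oo]
    --> \int[mu]_(x in `[x1, x2]) (stieltjes_density pi x)%:E)%E.
  apply: (@dominated_cvg _ _ _ mu _ _ _ _ (fun=> C%:E)) => //.
  - by move=> n; apply/measurable_EFinP/measurable_funTS; exact: measurable_stieltjes_density.
  - move=> x; rewrite /= in_itv/= => /andP[x1x _].
    apply: cvg_EFin; first exact: nearW.
    by apply: cvg_stieltjes_density => //; exact: lt_le_trans x1x.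
  - apply: (@continuous_compact_integrable _ (cst C)); first exact: segment_compact.
    by apply: continuous_subspaceT; exact: cst_continuous.
  - move=> n x; rewrite /= in_itv/= => x12x; have /andP[x1x _] := x12x.
    have x0 : 0 <= x by rewrite ltW// (lt_le_trans x10).
    rewrite lee_fin ger0_norm ?stieltjes_density_ge0//.
    exact: stieltjes_density_le.
have cvgL : ('E_P[fun t => (poisson_primitive (u n) (Y t) x2 -
                            poisson_primitive (u n) (Y t) x1)%R] @[n --> \oo] -->
    'E_P[fun t => (pi / 2 * Num.sg (x2 - Y t) - pi / 2 * Num.sg (x1 - Y t))%R])%E.
  rewrite unlock.
  apply: (@dominated_cvg _ _ _ P setT measurableT _ _ (cst pi%:E)) => //.
  - by move=> n; apply/measurable_EFinP; exact: measurable_funB.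
  - move=> t _; apply: cvg_EFin; first exact: nearW.
    by apply: cvgB; exact: cvg_poisson_primitive.
  - exact: finite_measure_integrable_cst.
  - move=> n t _; rewrite lee_fin (le_trans (ler_normB _ _))//.
    have := normr_prim (u n) (Y t) x1; have := normr_prim (u n) (Y t) x2; lra.
have := cvg_unique _ cvgL; apply => //.
apply: cvg_trans cvgR; apply: near_eq_cvg; apply: nearW => n.
by rewrite stieltjes_primitive.
Qed.

End stieltjes.

(** * From the masses of intervals to the law *)

Section stieltjes_law.
Context {R : realType} {d : measure_display} {T : measurableType d}.
Variable P : probability T R.
Local Notation mu := (@lebesgue_measure R).
Variables (alpha r : R) (Y : {RV P >-> R}).
Hypotheses (a01 : 0 < alpha < 1) (r0 : 0 < r) (Y0 : forall t, 0 < Y t).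
Hypothesis YS : forall l, 0 < l ->
  ('E_P[fun t => ((1 + l * Y t)^-1)%R] = ((1 + r * l `^ alpha)^-1)%:E)%E.

Let mY : measurable_fun setT (Y : T -> R).
Proof. exact: measurable_funPT. Qed.

Lemma measurable_rho_kernel x : measurable_fun setT (rho_kernel alpha x).
Proof.
apply: measurable_fun_div; first exact: measurable_funM.
apply: measurable_funD; last exact: measurable_funX.
by apply: measurable_funD => //; apply: measurable_funM => //; apply: measurable_funM.
Qed.

(** For a point mass at r the density is 1 / pi times the boundary value found by inversion; the
    case of a single r is thus an instance of [rho_measure]. *)
Lemma rho_dirac x : rho alpha (\d_r : probability R R) x =
  if 0 < x then (stieltjes_density alpha r pi x / pi)%:E else 0%E.
Proof.
rewrite /rho; case: ifPn => // x0.
rewrite integral_dirac//; last first.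
  by apply/measurable_EFinP/measurable_funTS; exact: measurable_rho_kernel.
rewrite diracE mem_set/= ?in_itv/= ?r0// mul1e -EFinM; congr EFin.
rewrite /rho_kernel /stieltjes_density.
have -> : x `^ (2 * alpha) = (x `^ alpha) ^+ 2.
  by rewrite mulrC powRrM powR_mulrn// powR_ge0.
rewrite (mulrC pi alpha).
have -> : (r + x `^ alpha * cos (alpha * pi)) ^+ 2 + (x `^ alpha * sin (alpha * pi)) ^+ 2
  = (x `^ alpha) ^+ 2 + 2 * x `^ alpha * r * cos (alpha * pi) + r ^+ 2.
  by rewrite !exprMn sin2cos2; ring.
by ring.
Qed.

Let measurable_sgB x : measurable_fun setT (fun t => Num.sg (x - Y t)).
Proof.
rewrite (_ : (fun t => _) = (fun t => (if 0 < x - Y t then 1 else 0) -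
      (if x - Y t < 0 then 1 else 0))); last first.
  apply/funext => t; case: (ltgtP (x - Y t) 0) => [z|z|->].
  - by rewrite (ltr0_sg z) sub0r.
  - by rewrite (gtr0_sg z) subr0.
  - by rewrite sgr0 subrr.
have mB : measurable_fun setT (fun t => x - Y t) by exact: measurable_funB.
apply: measurable_funB.
  by apply: measurable_fun_ifT => //; exact: measurable_fun_ltr.
by apply: measurable_fun_ifT => //; exact: measurable_fun_ltr.
Qed.

Let sgB_ge0 x1 x2 y : x1 <= x2 -> 0 <= Num.sg (x2 - y) - Num.sg (x1 - y) :> R.
Proof.
move=> x12; rewrite subr_ge0.
have [z|z|z] := ltgtP x1 y.
- by rewrite (ltr0_sg (_ : x1 - y < 0)) ?subr_lt0//; case: sgrP.
- by rewrite !gtr0_sg ?subr_gt0// (lt_le_trans z).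
- by rewrite z subrr sgr0 sgr_ge0 subr_ge0 -z.
Qed.

Let nu : {measure set R -> \bar R} := rho_measure (\d_r : probability R R) a01.

Let nu_itv x1 x2 : 0 < x1 < x2 -> nu `[x1, x2]%classic =
  ('E_P[fun t => ((Num.sg (x2 - Y t) - Num.sg (x1 - Y t)) / 2)%R])%E.
Proof.
move=> x12; have pi0 := pi_gt0 R.
have /andP[x10 _] := x12.
rewrite /nu/= /rho_measure.
transitivity ((pi^-1)%:E *
    \int[mu]_(x in `[x1, x2]) (stieltjes_density alpha r pi x)%:E)%E.
  rewrite -ge0_integralZl//; last 3 first.
  - by apply/measurable_EFinP/measurable_funTS; exact: measurable_stieltjes_density.
  - move=> x; rewrite /= in_itv/= => /andP[x1x _].
    rewrite lee_fin stieltjes_density_ge0// ?lexx ?pi0//.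
    by rewrite ltW// (lt_le_trans x10).
  - by rewrite lee_fin invr_ge0 ltW.
  apply: eq_integral => x; rewrite inE/= in_itv/= => /andP[x1x _].
  by rewrite rho_dirac (lt_le_trans x10 x1x) -EFinM mulrC.
rewrite -(stieltjes_sg a01 r0 Y0 YS x12) unlock -ge0_integralZl//.
- apply: eq_integral => t _; rewrite -EFinM; congr EFin.
  by rewrite -mulrBr !mulrA mulVf ?gt_eqF// mul1r mulrC.
- by apply/measurable_EFinP; apply: measurable_funB; apply: measurable_funM => //;
    exact: measurable_sgB.
- move=> t _; rewrite lee_fin -mulrBr mulr_ge0 ?divr_ge0 ?pi_ge0//.
  by rewrite sgB_ge0// ltW; have /andP[] := x12.
- by rewrite lee_fin invr_ge0 ltW.
Qed.

Let nu_set1 x : nu [set x] = 0%E.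
Proof. by rewrite /nu/= /rho_measure integral_set1. Qed.

Let nu_itv_fin x1 x2 : 0 < x1 < x2 -> (nu `[x1, x2]%classic < +oo)%E.
Proof.
move=> x12; rewrite nu_itv//; apply: (@le_lt_trans _ _ 1%E); last exact: ltry.
rewrite -[leRHS](@expectation_cst _ _ _ P) unlock; apply: ge0_le_integral => //.
- by move=> t _; rewrite lee_fin divr_ge0// sgB_ge0// ltW; have /andP[] := x12.
- by apply/measurable_EFinP; apply: measurable_funM => //; apply: measurable_funB;
    exact: measurable_sgB.
- exact/measurable_EFinP.
- move=> t _; rewrite lee_fin /= ler_pdivrMr//.
  have sg1 (z : R) : -1 <= Num.sg z <= 1.
    by rewrite -ler_norml normr_sg; case: (_ == _).
  by have /andP[? _] := sg1 (x1 - Y t); have /andP[_ ?] := sg1 (x2 - Y t); lra.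
Qed.

(** An atom at x would contribute half of its mass to the measure [nu] of every interval
    [x, x + 1 / (n + 1)]; these measures decrease to that of the single point x, which is 0 because
    [nu] has a density. *)
Let atom0 x : 0 < x -> P (Y @^-1` [set x]) = 0%E.
Proof.
move=> x0; apply/eqP; rewrite -measure_le0.
pose F n := `[x, x + n.+1%:R^-1]%classic : set R.
have xn n : 0 < x < x + n.+1%:R^-1 by rewrite x0 ltrDl invr_gt0 ltr0n.
have half n : (2^-1%:E * P (Y @^-1` [set x]) <= nu (F n))%E.
  have mset : measurable (Y @^-1` [set x]).
    by rewrite -[X in measurable X]setTI; exact: mY.
  rewrite /F nu_itv// -[X in P X]setIT -integral_indic//.
  rewrite -ge0_integralZl//; last by apply/measurable_EFinP.
  rewrite unlock; apply: ge0_le_integral => //.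
  - by apply: measurable_funeM; exact/measurable_EFinP.
  - by apply/measurable_EFinP; apply: measurable_funM => //; apply: measurable_funB;
      exact: measurable_sgB.
  - move=> t _; rewrite -EFinM lee_fin indicE; have [|_] := boolP (t \in _).
    + rewrite inE/= => ->; rewrite subrr sgr0 subr0 mulr1 gtr0_sg ?mul1r//.
      by rewrite addrAC subrr add0r invr_gt0.
    + by rewrite mulr0 divr_ge0// sgB_ge0// ltW//; have /andP[] := xn n.
have bigF : \bigcap_n F n = [set x].
  apply/seteqP; split => y /=; last first.
    by move=> -> m _; rewrite /F/= in_itv/= lexx/= lerDl.
  move=> Fy; apply/eqP; rewrite eq_le; apply/andP; split; last first.
    by have := Fy 0 I; rewrite /F/= in_itv/= => /andP[].
  apply/ler_addgt0Pr => e e0.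
  have [k ke] : exists k : nat, k.+1%:R^-1 < e.
    have [k _ ke] := near_infty_natSinv_lt (PosNum e0).
    by exists k; exact: ke k (leqnn k).
  have := Fy k I; rewrite /F/= in_itv/= => /andP[_ yn].
  by rewrite (le_trans yn)// lerD2l ltW.
have cvgF : (nu \o F) n @[n --> \oo] --> nu (\bigcap_n F n).
  apply: nonincreasing_cvg_mu => //.
  - by rewrite nu_itv_fin.
  - by move=> i; rewrite /F; exact: measurable_itv.
  - by rewrite bigF.
  - move=> i j ij; apply/subsetPset => y; rewrite /F/= !in_itv/= => /andP[-> yn]/=.
    by rewrite (le_trans yn)// lerD2l lef_pV2 ?posrE ?ltr0n// ler_nat.
rewrite bigF nu_set1 in cvgF.
have : (2^-1%:E * P (Y @^-1` [set x]) <= 0)%E.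
  rewrite -(cvg_lim _ cvgF)//; apply: lime_ge; first by apply/cvg_ex; eexists; exact: cvgF.
  by apply: nearW => n; exact: half.
by rewrite pmule_rle0// lte_fin.
Qed.

(** The endpoints are null, so half the difference of signs is almost surely an indicator. *)
Let law_itv x1 x2 : 0 < x1 < x2 ->
  P (Y @^-1` `]x1, x2]%classic) = nu `]x1, x2]%classic.
Proof.
move=> x012; have /andP[x10 x12] := x012.
have x20 := lt_trans x10 x12.
transitivity (nu `[x1, x2]%classic); last first.
  rewrite /nu/= /rho_measure integral_itv_obnd_cbnd//.
  by apply: measurable_funTS; exact: measurable_rho.
have mitv : measurable (Y @^-1` `]x1, x2]%classic).
  by rewrite -[X in measurable X]setTI; exact: mY.
rewrite nu_itv// -[X in P X]setIT -integral_indic// unlock.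
apply: ae_eq_integral => //.
- by apply/measurable_EFinP.
- by apply/measurable_EFinP; apply: measurable_funM => //; apply: measurable_funB;
    exact: measurable_sgB.
have mset x : measurable (Y @^-1` [set x]).
  by rewrite -[X in measurable X]setTI; exact: mY.
exists (Y @^-1` [set x1] `|` Y @^-1` [set x2]); split.
- exact: measurableU.
- have : (P (Y @^-1` [set x1] `|` Y @^-1` [set x2]) <=
    P (Y @^-1` [set x1]) + P (Y @^-1` [set x2]))%E by exact: measureU2.
  by rewrite !atom0// adde0 measure_le0 => /eqP.
move=> t /=; rewrite not_implyE => -[_]; apply: contra_notP => /not_orP[/eqP tx1 /eqP tx2].
congr EFin; rewrite indicE.
have [z1|z1|z1] := ltgtP (Y t) x1; last by rewrite z1 eqxx in tx1.
- rewrite memNset/=; last by rewrite in_itv/= lt_gtF.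
  by rewrite !gtr0_sg ?subr_gt0// ?subrr ?mul0r// (lt_trans z1).
- have [z2|z2|z2] := ltgtP (Y t) x2; last by rewrite z2 eqxx in tx2.
  + rewrite mem_set/=; last by rewrite in_itv/= z1 ltW.
    by rewrite gtr0_sg ?subr_gt0// ltr0_sg ?subr_lt0// opprK divff.
  + rewrite memNset/=; last by rewrite in_itv/= z1/= leNgt z2.
    by rewrite !ltr0_sg ?subr_lt0// subrr mul0r.
Qed.

Let nu_pos A : nu A = nu (A `&` `]0, +oo[%classic).
Proof.
rewrite /nu/= /rho_measure integral_mkcondr; apply: eq_integral => x _.
rewrite patchE; case: ifPn => //; rewrite notin_setE/= in_itv/= andbT => /negP x0.
by rewrite /rho (negbTE x0).
Qed.

Let logY : {mfun T >-> R} := HB.pack_for {mfun T >-> R} (fun t => ln (Y t))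
  (isMeasurableFun.Build _ _ _ _ _ (measurableT_comp (@measurable_ln R) mY)).

(* Both laws are carried by the positive half-line, so it is enough to compare
   their images by the logarithm. *)
Lemma stieltjes_law_pos A : measurable A -> P (Y @^-1` A) = nu A.
Proof.
pose m1 : {measure set R -> \bar R} := distribution P logY.
pose m2 : {measure set R -> \bar R} :=
  measure_function_pushforward__canonical__measure_function_Measure
    nu (@measurable_ln R).
have ln_itv a b x : 0 < x -> (ln x \in `]a, b]) = (x \in `]expR a, expR b]).
  by move=> x0; rewrite !in_itv/= -(ltr_expR a) -(ler_expR _ b) lnK.
have itvE a b : m1 `]a, b]%classic = m2 `]a, b]%classic.
  have [ba|ab] := leP b a; first by rewrite set_itv_ge ?bnd_simp -?leNgt// !measure0.
  transitivity (P (Y @^-1` `]expR a, expR b]%classic)).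
    by congr (P _); apply/seteqP; split => t /=; rewrite ln_itv.
  rewrite law_itv ?expR_gt0 ?ltr_expR//.
  change (nu `]expR a, expR b]%classic = nu (@ln R @^-1` `]a, b]%classic)).
  rewrite nu_pos [RHS]nu_pos; congr (nu _); apply/seteqP.
  by split => x [/= + x0]; move: (x0); rewrite in_itv/= andbT => x0';
    rewrite ln_itv.
have m12 B : measurable B -> m1 B = m2 B.
  apply: (@measure_unique _ _ _ (@ocitv R) (fun n => `]- n%:R, n%:R]%classic)) => //.
  - exact: ocitvI.
  - by move=> n; exists (- n%:R, n%:R).
  - apply/seteqP; split => // x _.
    have [k _ xk] := nbhs_infty_gtr `|x|.
    exists k => //=; have := xk k (leqnn k); rewrite ltr_norml in_itv/= => /andP[-> /ltW ->].
    by [].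
  - by move=> _ [[a b] _ <-]; exact: itvE.
  - by move=> n; rewrite (le_lt_trans (probability_le1 _ _))// ltry.
move=> mA.
have mexpA : measurable (@expR R @^-1` A).
  by rewrite -[X in measurable X]setTI; exact: measurable_expR.
transitivity (m1 (@expR R @^-1` A)).
  by congr (P _); apply/seteqP; split => t /=; rewrite lnK ?posrE.
rewrite m12//; change (nu (@ln R @^-1` (@expR R @^-1` A)) = nu A).
rewrite nu_pos [RHS]nu_pos; congr (nu _); apply/seteqP.
by split => x [/= + x0]; move: (x0); rewrite in_itv/= andbT => x0'; rewrite lnK ?posrE.
Qed.
End stieltjes_law.

Local Open Scope ereal_scope.

(** * Ratios of independent stable variables *)

Section exponential_integrals.
Context {R : realType}.
Local Notation mu := (@lebesgue_measure R).
Implicit Types c w a z : R.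

Lemma continuous_expRM c : continuous (fun z => expR (- (c * z)))%R.
Proof.
by move=> z; apply/differentiable_continuous/derivable1_diffP/ex_derive.
Qed.

Let is_derive_exp c z :
  is_derive z 1%R (fun z => - expR (- (c * z)))%R (c * expR (- (c * z)))%R.
Proof. by apply: is_derive_eq; rewrite /GRing.scale/=; ring. Qed.

Let continuous_exp c : continuous (fun z => c * expR (- (c * z)))%R.
Proof.
by move=> z; apply/differentiable_continuous/derivable1_diffP/ex_derive.
Qed.

Lemma integral_exp_ge c w : (0 < c)%R ->
  \int[mu]_(z in `[w, +oo[) (c * expR (- (c * z)))%:E = (expR (- (c * w)))%:E.
Proof.
move=> c0; rewrite (@ge0_continuous_FTC2y _ _ (fun z => - expR (- (c * z)))%R _ 0)%R.
- by rewrite sub0e EFinN oppeK.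
- by move=> z _; rewrite mulr_ge0 ?expR_ge0// ltW.
- by apply: continuous_subspaceT; exact: continuous_exp.
- rewrite -oppr0; apply: cvgN.
  rewrite (_ : (fun z => expR (- (c * z))) = (fun z => expR (- z)) \o (fun z => c * z))%R//.
  by apply: (cvg_comp _ _ _ (@cvgr_expR R)); exact: gt0_cvgMry.
- by move=> z _; have := is_derive_exp c z => ?; exact: ex_derive.
- by apply: cvgN; apply: cvg_at_right_filter; exact: continuous_expRM.
- by move=> z _; rewrite derive1E; have := is_derive_exp c z => ?; exact: derive_val.
Qed.

Lemma integral_exp_le c a : (0 <= a)%R ->
  \int[mu]_(z in `[0%R, a]) (c * expR (- (c * z)))%:E = (1 - expR (- (c * a)))%:E.
Proof.
rewrite le_eqVlt => /predU1P[<-|a0].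
  by rewrite set_itv1 integral_set1 mulr0 oppr0 expR0 subrr.
rewrite (@continuous_FTC2 _ _ (fun z => - expR (- (c * z)))%R)//.
- by rewrite mulr0 oppr0 expR0 -EFinB opprK addrC.
- by apply: continuous_subspaceT; exact: continuous_exp.
- split.
  + by move=> z _; have := is_derive_exp c z => ?; exact: ex_derive.
  + by apply: cvgN; apply: cvg_at_right_filter; exact: continuous_expRM.
  + by apply: cvgN; apply: cvg_at_left_filter; exact: continuous_expRM.
- by move=> z _; rewrite derive1E; have := is_derive_exp c z => ?; exact: derive_val.
Qed.

Lemma integral_exp c : (0 < c)%R ->
  \int[mu]_(z in `[0%R, +oo[) (expR (- (c * z)))%:E = (c^-1)%:E.
Proof.
move=> c0; have := integral_exp_ge 0%R c0.
under eq_integral do rewrite EFinM.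
rewrite ge0_integralZl//=; last 2 first.
- apply/measurable_EFinP/measurable_funTS.
  apply: continuous_measurable_fun; exact: continuous_expRM.
- by rewrite lee_fin ltW.
rewrite mulr0 oppr0 expR0 => eq1.
have := f_equal (fun x : \bar R => (c^-1)%:E * x) eq1.
by rewrite muleA -EFinM mulVf ?gt_eqF// mul1e mule1.
Qed.

Lemma integrable_exp (k c : R) : (0 < c)%R ->
  mu.-integrable `[0%R, +oo[ (fun z => (k * expR (- (c * z)))%:E).
Proof.
move=> c0.
have intf : mu.-integrable `[0%R, +oo[ (fun z => (expR (- (c * z)))%:E).
  apply/integrableP; split.
    apply/measurable_EFinP/measurable_funTS.
    by apply: continuous_measurable_fun; exact: continuous_expRM.
  under eq_integral do rewrite gee0_abs ?lee_fin ?expR_ge0//.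
  by rewrite integral_exp// ltry.
have mD : measurable (`[0%R, +oo[%classic : set (measurableTypeR R)) by [].
have := integrableZl mD k intf.
by apply: eq_integrable => // z _; rewrite EFinM.
Qed.

End exponential_integrals.

Section stable.
Context {R : realType} {d : measure_display} {T : measurableType d}.
Variable P : probability T R.
Local Notation mu := (@lebesgue_measure R).
Variables (alpha : R) (S S' : {RV P >-> R}).
Hypotheses (a01 : (0 < alpha < 1)%R) (SS' : independent P S S').
Hypotheses (S0 : forall t, (0 < S t)%R) (S'0 : forall t, (0 < S' t)%R).
Hypothesis SL : forall l : R, (0 <= l)%R ->
  'E_P[fun t => expR (- (l * S t))] = (expR (- (l `^ alpha)))%:E.
Hypothesis S'L : forall l : R, (0 <= l)%R ->
  'E_P[fun t => expR (- (l * S' t))] = (expR (- (l `^ alpha)))%:E.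

Let mS : measurable_fun setT (S : T -> R). Proof. exact: measurable_funPT. Qed.
Let mS' : measurable_fun setT (S' : T -> R). Proof. exact: measurable_funPT. Qed.

Let mexp d' (U : measurableType d') (f : U -> R) : measurable_fun setT f ->
  measurable_fun setT (fun u => expR (- f u)).
Proof. by move=> mf; apply: measurableT_comp => //; exact: measurableT_comp. Qed.

(* Integrating out S, for a given value s of S'. *)
Let stable_integral s l : (0 < s)%R -> (0 < l)%R ->
  \int[P]_t (s / (s + l * S t))%:E =
  \int[mu]_(z in `[0%R, +oo[) (s * expR (- (s * z)) * expR (- ((l * z) `^ alpha)))%:E.
Proof.
move=> s0 l0.
pose f (z : T * measurableTypeR R) : R := (s * expR (- ((s + l * S z.1) * z.2)))%R.
have mf : measurable_fun setT f.
  apply: measurable_funM => //; apply: mexp; apply: measurable_funM => //.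
  by apply: measurable_funD => //; apply: measurable_funM => //; exact: (measurableT_comp mS).
transitivity (\int[P]_t \int[mu]_(z in `[0%R, +oo[) (f (t, z))%:E).
  apply: eq_integral => t _; rewrite /f/=.
  have c0 : (0 < s + l * S t)%R by rewrite addr_gt0// mulr_gt0.
  under eq_integral do rewrite EFinM.
  rewrite ge0_integralZl//=; last 2 first.
  - apply/measurable_EFinP/measurable_funTS.
    apply: continuous_measurable_fun; exact: continuous_expRM.
  - by rewrite lee_fin ltW.
  by rewrite integral_exp// -EFinM.
rewrite (ge0_fubini_in P mu measurableT _ mf)//; last first.
  by move=> t z _ _; rewrite /f mulr_ge0 ?expR_ge0// ltW.
apply: eq_integral => z; rewrite inE/= in_itv/= andbT => z0.
transitivity ((s * expR (- (s * z)))%:E * \int[P]_t (expR (- ((l * z) * S t)))%:E).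
  rewrite -ge0_integralZl//.
  - apply: eq_integral => t _; rewrite /f/= -EFinM; congr EFin.
    have -> : ((s + l * S t) * z = s * z + l * z * S t)%R by ring.
    by rewrite opprD expRD mulrA.
  - by apply/measurable_EFinP; apply: mexp; exact: measurable_funM.
  - by rewrite lee_fin mulr_ge0 ?expR_ge0// ltW.
have := SL (mulr_ge0 (ltW l0) z0); rewrite unlock => ->.
by rewrite -EFinM.
Qed.

Let maxpow_le z y : (0 <= z)%R -> (0 <= y)%R ->
  (z `^ alpha <= y)%R = (z <= y `^ alpha^-1)%R.
Proof.
move=> z0 y0; have /andP[a0 _] := a01.
have ai0 : (0 <= alpha^-1)%R by rewrite invr_ge0 ltW.
apply/idP/idP => zy.
  have := ge0_ler_powR ai0 _ _ zy; rewrite !nnegrE powR_ge0 => /(_ isT y0).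
  by rewrite -powRrM divff ?gt_eqF// powRr1.
have := ge0_ler_powR (ltW a0) _ _ zy; rewrite !nnegrE powR_ge0 => /(_ z0 isT).
by rewrite -powRrM mulVf ?gt_eqF// powRr1.
Qed.

(* The factor exp (- (l z)^alpha) is the tail of an exponential law at
   z^alpha, which turns the remaining integral into a Laplace transform of S'. *)
Let stable_integral2 s l : (0 < s)%R -> (0 < l)%R ->
  \int[P]_t (s / (s + l * S t))%:E =
  \int[mu]_(y in `[0%R, +oo[)
    (l `^ alpha * expR (- (l `^ alpha * y)) * (1 - expR (- (y `^ alpha^-1 * s))))%:E.
Proof.
move=> s0 l0; rewrite stable_integral//.
pose c := (l `^ alpha)%R; have c0 : (0 < c)%R by rewrite powR_gt0.
(* Read in y, the condition z^alpha <= y cuts off an exponential tail; after the exchange of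
   integrals it is read in z as z <= y^(1/alpha). *)
pose f (w : measurableTypeR R * measurableTypeR R) : R :=
  (s * expR (- (s * w.1)) * (c * expR (- (c * w.2))) *
   (if w.1 `^ alpha <= w.2 then 1 else 0))%R.
have mf : measurable_fun setT f.
  apply: measurable_funM.
    apply: measurable_funM; apply: measurable_funM => //; apply: mexp;
      exact: measurable_funM.
  apply: measurable_fun_ifT => //; apply: measurable_fun_ler => //.
  exact: measurable_fun_powR.
have f0 x y : (0 <= f (x, y))%R.
  by rewrite /f !mulr_ge0 ?expR_ge0 ?(ltW s0) ?(ltW c0)//; case: ifP.
have mE (k : R) : measurable_fun setT (fun y : measurableTypeR R => (k * expR (- (k * y)))%R).
  by apply: measurable_funM => //; apply: mexp; exact: measurable_funM.
transitivity (\int[mu]_(z in `[0%R, +oo[) \int[mu]_(y in `[0%R, +oo[) (f (z, y))%:E).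
  apply: eq_integral => z; rewrite inE/= in_itv/= andbT => z0.
  have za : (0 <= z `^ alpha)%R by exact: powR_ge0.
  rewrite powRM ?(ltW l0)// -/c EFinM -(integral_exp_ge _ c0) -ge0_integralZl//; last 3 first.
  - by apply/measurable_EFinP/measurable_funTS; exact: mE.
  - by move=> y _; rewrite lee_fin mulr_ge0 ?expR_ge0// ltW.
  - by rewrite lee_fin mulr_ge0 ?expR_ge0// ltW.
  rewrite integral_mkcond [RHS]integral_mkcond; apply: eq_integral => y _.
  rewrite !patchE /f/= !mem_setE !in_itv/= !andbT.
  case: ifPn => zy; last by rewrite mulr0; case: ifP.
  by rewrite (le_trans za zy) mulr1 -EFinM.
rewrite (ge0_fubini_in mu mu _ _ mf)//.
apply: eq_integral => y; rewrite inE/= in_itv/= andbT => y0.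
have ya : (0 <= y `^ alpha^-1)%R by exact: powR_ge0.
transitivity (\int[mu]_(z in `[0%R, (y `^ alpha^-1)%R])
    ((c * expR (- (c * y)))%:E * (s * expR (- (s * z)))%:E)); last first.
  rewrite ge0_integralZl//.
  - by rewrite integral_exp_le// EFinM (mulrC _ s).
  - by apply/measurable_EFinP/measurable_funTS; exact: mE.
  - by move=> z _; rewrite lee_fin mulr_ge0 ?expR_ge0// ltW.
  - by rewrite lee_fin mulr_ge0 ?expR_ge0// ltW.
rewrite integral_mkcond [RHS]integral_mkcond; apply: eq_integral => z _.
rewrite !patchE /f/= !mem_setE !in_itv/= !andbT.
have [z0|z0] /= := leP 0%R z; last by [].
rewrite maxpow_le//; case: ifPn => _; last by rewrite mulr0.
by rewrite mulr1 -EFinM mulrC.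
Qed.

(** The ratio 1 / (1 + l S / S') is S' / (S' + l S). With c = l^alpha, integrating out S leaves an
    exponential law of rate c in y against 1 - exp (- y^(1/alpha) S'); averaging over S' turns this
    into 1 - exp (- y), and 1 - c / (c + 1) remains. *)
Lemma stable_ratio_stieltjes_pos l : (0 < l)%R ->
  'E_P[fun t => ((1 + l * (S t / S' t))^-1)%R] = ((1 + l `^ alpha)^-1)%:E.
Proof.
(* The absolute value makes the integrand nonnegative on the whole plane, as the integration over
   independent variables requires. *)
move=> l0; pose g (z : R * R) : \bar R := `|z.2 / (z.2 + l * z.1)|%:E.
have mg : measurable_fun setT g.
  apply/measurable_EFinP; apply: measurableT_comp => //.
  apply: measurable_fun_div => //; apply: measurable_funD => //.
  exact: measurable_funM.
transitivity (\int[P]_t g (S t, S' t)).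
  rewrite unlock; apply: eq_integral => t _; rewrite /g/=.
  have c0 : (0 < S' t + l * S t)%R by rewrite addr_gt0// mulr_gt0.
  rewrite ger0_norm ?divr_ge0 ?ltW//; congr EFin; field.
  by rewrite !gt_eqF.
have g0 z : 0 <= g z by rewrite lee_fin.
rewrite independent_integral//.
pose c := (l `^ alpha)%R; have c0 : (0 < c)%R by rewrite powR_gt0.
pose f (w : T * measurableTypeR R) : R :=
  (c * expR (- (c * w.2)) * (1 - expR (- (w.2 `^ alpha^-1 * S' w.1))))%R.
have mf : measurable_fun setT f.
  apply: measurable_funM.
    by apply: measurable_funM => //; apply: mexp; exact: measurable_funM.
  apply: measurable_funB => //; apply: mexp; apply: measurable_funM.
    exact: measurable_fun_powR.
  exact: (measurableT_comp mS').
have e01 (x : R) : (0 <= x)%R -> (0 <= 1 - expR (- x) <= 1)%R.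
  move=> x0; rewrite subr_ge0 lerBlDr lerDl expR_ge0 andbT.
  by rewrite -expR0 ler_expR oppr_le0.
transitivity (\int[P]_s \int[mu]_(y in `[0%R, +oo[) (f (s, y))%:E).
  apply: eq_integral => s _.
  transitivity (\int[P]_t (S' s / (S' s + l * S t))%:E); last first.
    by rewrite (stable_integral2 (S'0 s) l0).
  apply: eq_integral => t _; rewrite /g/= ger0_norm// divr_ge0//; first exact/ltW.
  by rewrite ltW// addr_gt0// mulr_gt0.
rewrite (ge0_fubini_in P mu measurableT _ mf)//; last first.
  move=> s y _ /=; rewrite in_itv/= andbT => y0; rewrite /f/= !mulr_ge0 ?expR_ge0 ?(ltW c0)//.
  by have /andP[] := e01 _ (mulr_ge0 (powR_ge0 y alpha^-1) (ltW (S'0 s))).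
transitivity (\int[mu]_(y in `[0%R, +oo[)
  ((c * expR (- (c * y)))%:E - (c * expR (- ((c + 1) * y)))%:E)).
  apply: eq_integral => y; rewrite inE/= in_itv/= andbT => y0.
  rewrite /f/=; under eq_integral do rewrite EFinM.
  have yS s : (0 <= expR (- (y `^ alpha^-1 * S' s)) <= 1)%R.
    rewrite expR_ge0 -expR0 ler_expR oppr_le0.
    by rewrite mulr_ge0 ?powR_ge0// ltW.
  have my : measurable_fun setT (fun s => expR (- (y `^ alpha^-1 * S' s)))%R.
    by apply: mexp; exact: measurable_funM.
  rewrite ge0_integralZl//; last 3 first.
  - by apply/measurable_EFinP; exact: measurable_funB.
  - by move=> s _; rewrite lee_fin subr_ge0; have /andP[] := yS s.
  - by rewrite lee_fin mulr_ge0 ?expR_ge0// ltW.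
  have := expectation_onem P my yS; rewrite S'L ?powR_ge0// unlock => ->.
  have /andP[a0 _] := a01.
  rewrite -powRrM mulVf ?gt_eqF// powRr1// -EFinB -EFinM -EFinB; congr EFin.
  have -> : (- ((c + 1) * y) = - (c * y) - y)%R by ring.
  by rewrite expRD; ring.
rewrite integralB//; [|exact: integrable_exp|apply: integrable_exp; exact: addr_gt0].
rewrite integral_exp_ge// mulr0 oppr0 expR0.
under [X in (_ - X)%E]eq_integral do rewrite EFinM.
rewrite integralZl//; last first.
  have := integrable_exp 1 (addr_gt0 c0 ltr01).
  by apply: eq_integrable => // z _; rewrite mul1r.
rewrite integral_exp ?addr_gt0// -EFinM -EFinB -/c; congr EFin.
by field; rewrite !gt_eqF// addr_gt0.
Qed.
End stable.

Section make_positive.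
Context {R : realType}.

(** Turns an almost surely positive variable into an everywhere positive one with the same law; the
    value 1 is an arbitrary positive default. *)
Definition make_positive (x : R) : R := if (0 < x)%R then x else 1%R.

Lemma make_positive_gt0 x : (0 < make_positive x)%R.
Proof. by rewrite /make_positive; case: ifPn. Qed.

Lemma make_positiveE x : (0 < x)%R -> make_positive x = x.
Proof. by rewrite /make_positive => ->. Qed.

Lemma measurable_make_positive : measurable_fun [set: R] make_positive.
Proof. by apply: measurable_fun_ifT => //; exact: measurable_fun_ltr. Qed.

End make_positive.

Section independent_ratio.
Context {R : realType} {d : measure_display} {T : measurableType d}.
Variable P : probability T R.

Let posRV (X : {RV P >-> R}) : {RV P >-> R} :=
  HB.pack_for {mfun T >-> R} (fun t => make_positive (X t))
  (isMeasurableFun.Build _ _ _ _ _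
    (measurableT_comp (@measurable_make_positive R) (measurable_funPT X))).

Lemma measurable_gt0 (X : T -> R) : measurable_fun setT X ->
  measurable [set t | (0 < X t)%R].
Proof.
move=> mX; rewrite (_ : [set t | _] = X @^-1` `]0%R, +oo[%classic).
  by rewrite -[X in measurable X]setTI; exact: mX.
by apply/seteqP; split => t /=; rewrite in_itv/= andbT.
Qed.

Lemma stieltjes_law (alpha r : R) (Y : {RV P >-> R}) (a01 : (0 < alpha < 1)%R) :
  (0 < r)%R -> P [set t | (0 < Y t)%R] = 1 ->
  (forall l, (0 < l)%R ->
    'E_P[fun t => ((1 + l * Y t)^-1)%R] = ((1 + r * l `^ alpha)^-1)%:E) ->
  forall A, measurable A ->
  P (Y @^-1` A) = rho_measure (\d_r : probability R R) a01 A.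
Proof.
move=> r0 Y0 YS A mA.
have mY : measurable_fun setT (Y : T -> R) by exact: measurable_funPT.
have mY0 := measurable_gt0 mY.
have mY' : measurable_fun setT (posRV Y : T -> R) by exact: measurable_funPT.
have mS (X : T -> R) l : measurable_fun setT X ->
    measurable_fun setT (fun t => ((1 + l * X t)^-1)%:E).
  move=> mX; apply/measurable_EFinP; apply: measurable_funV.
  by apply: measurable_funD => //; exact: measurable_funM.
rewrite -(stieltjes_law_pos a01 r0 (Y := posRV Y))//.
- apply: (eq_probability_as mY0 Y0).
  + by rewrite -[X in measurable X]setTI; exact: mY.
  + by rewrite -[X in measurable X]setTI; exact: mY'.
  + by move=> t Yt /=; rewrite make_positiveE.
- by move=> t; exact: make_positive_gt0.
- move=> l l0; rewrite -YS// unlock; apply: (eq_integral_as mY0 Y0); [exact: mS|exact: mS|].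
  by move=> t Yt /=; rewrite make_positiveE.
Qed.

(** The absolute value changes nothing almost surely; it makes the integrand a nonnegative function
    of the ratio, so that the identity can be transported to any variable with the same law. *)
Lemma independent_stable_ratio (alpha : R) (S S' : {RV P >-> R}) :
  (0 < alpha < 1)%R ->
  positive_stable P alpha S -> positive_stable P alpha S' -> independent P S S' ->
  forall l, (0 < l)%R ->
  \int[P]_t `|(1 + l * (S t / S' t))^-1|%:E = ((1 + l `^ alpha)^-1)%:E.
Proof.
move=> a01 [S0 SL] [S'0 S'L] SS' l l0.
have mS : measurable_fun setT (S : T -> R) by exact: measurable_funPT.
have mS' : measurable_fun setT (S' : T -> R) by exact: measurable_funPT.
have mS0 := measurable_gt0 mS; have mS'0 := measurable_gt0 mS'.
have LE (X : {RV P >-> R}) : P [set t | (0 < X t)%R] = 1 ->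
    (forall l : R, (0 <= l)%R ->
      'E_P[fun t => expR (- (l * X t))] = (expR (- (l `^ alpha)))%:E) ->
    forall l : R, (0 <= l)%R ->
      'E_P[fun t => expR (- (l * posRV X t))] = (expR (- (l `^ alpha)))%:E.
  move=> X0 XL k k0; rewrite -XL// unlock.
  have me (Z : {RV P >-> R}) : measurable_fun setT (fun t => (expR (- (k * Z t)))%:E).
    apply/measurable_EFinP; apply: measurableT_comp => //; apply: measurableT_comp => //.
    by apply: measurable_funM => //; exact: measurable_funPT.
  apply: (eq_integral_as (measurable_gt0 (measurable_funPT X)) X0); [exact: me|exact: me|].
  by move=> t Xt /=; rewrite make_positiveE.
have ind : independent P (posRV S) (posRV S').
  move=> A B mA mB.
  have mpre C : measurable C -> measurable (@make_positive R @^-1` C).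
    by move=> mC; rewrite -[X in measurable X]setTI; exact: measurable_make_positive.
  exact: SS' (mpre A mA) (mpre B mB).
have pos (X : {RV P >-> R}) t : (0 < posRV X t)%R by exact: make_positive_gt0.
rewrite -(stable_ratio_stieltjes_pos a01 ind (pos S) (pos S') (LE _ S0 SL) (LE _ S'0 S'L) l0).
rewrite unlock; apply: (eq_integral_as (measurableI _ _ mS0 mS'0)).
- exact: setI_probability1.
- apply/measurable_EFinP; apply: measurableT_comp => //; apply: measurable_funV.
  apply: measurable_funD => //; apply: measurable_funM => //.
  exact: measurable_fun_div.
- apply/measurable_EFinP; apply: measurable_funV.
  apply: measurable_funD => //; apply: measurable_funM => //.
  by apply: measurable_fun_div; exact: measurable_funPT.
- move=> t [/= St S't]; rewrite !make_positiveE// ger0_norm// invr_ge0 addr_ge0//.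
  by rewrite mulr_ge0 ?divr_ge0// ltW.
Qed.

End independent_ratio.

Section stable_ratio.
Context {R : realType} {d : measure_display} {T : measurableType d}.
Variable P : probability T R.

Lemma stable_ratio_gt0 (alpha : R) (X : {RV P >-> R}) :
  stable_ratio alpha P X -> P [set t | (0 < X t)%R] = 1.
Proof.
case=> d' [T' [P' [S [S' [[S0 _] [S'0 _] _ XSS]]]]].
have mS : measurable_fun setT (S : T' -> R) by exact: measurable_funPT.
have mS' : measurable_fun setT (S' : T' -> R) by exact: measurable_funPT.
have mS0 := measurable_gt0 mS; have mS'0 := measurable_gt0 mS'.
have mi : measurable (`]0%R, +oo[%classic : set R) by [].
have -> : [set t | (0 < X t)%R] = X @^-1` `]0%R, +oo[%classic.
  by apply/seteqP; split => t /=; rewrite in_itv/= andbT.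
rewrite (XSS _ mi) /pushforward -[RHS](setI_probability1 mS0 mS'0 S0 S'0).
apply: (eq_probability_as (measurableI _ _ mS0 mS'0)).
- exact: setI_probability1.
- rewrite -[X in measurable X]setTI; apply: measurable_fun_div => //.
- exact: measurableI.
- move=> t [/= St S't]; rewrite in_itv/= andbT; split => // _.
  exact: divr_gt0.
Qed.

Lemma stable_ratio_stieltjes (alpha : R) (X : {RV P >-> R}) :
  (0 < alpha < 1)%R -> stable_ratio alpha P X -> forall l, (0 < l)%R ->
  'E_P[fun t => ((1 + l * X t)^-1)%R] = ((1 + l `^ alpha)^-1)%:E.
Proof.
move=> a01 Xr l l0; have X0 := stable_ratio_gt0 Xr.
case: Xr => d' [T' [P' [S [S' [Sst S'st SS' XSS]]]]].
rewrite -(independent_stable_ratio a01 Sst S'st SS' l0).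
have mX : measurable_fun setT (X : T -> R) by exact: measurable_funPT.
have mS : measurable_fun setT (S : T' -> R) by exact: measurable_funPT.
have mS' : measurable_fun setT (S' : T' -> R) by exact: measurable_funPT.
have mSS : measurable_fun setT (fun t => S t / S' t)%R by exact: measurable_fun_div.
pose h (x : R) : \bar R := `|(1 + l * x)^-1|%:E.
have mh : measurable_fun setT h.
  apply/measurable_EFinP; apply: measurableT_comp => //; apply: measurable_funV.
  by apply: measurable_funD => //; exact: measurable_funM.
pose mu := measure_function_pushforward__canonical__measure_function_Measure P' mSS.
transitivity (\int[P]_t h (X t)).
  rewrite unlock; apply: (eq_integral_as (measurable_gt0 mX) X0).
  - apply/measurable_EFinP; apply: measurable_funV.
    by apply: measurable_funD => //; exact: measurable_funM.
  - exact: (measurableT_comp mh).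
  - by move=> t Xt; rewrite /h ger0_norm// invr_ge0 addr_ge0// mulr_ge0// ltW.
rewrite (law_integral (mu := mu) mX XSS mh)//; last by move=> x; rewrite lee_fin.
rewrite -(@law_integral _ _ _ P' (fun t => S t / S' t)%R mu h mSS)//.
by move=> x; rewrite lee_fin.
Qed.

(** Scaling by r^(1/alpha) replaces l^alpha by r l^alpha in the Stieltjes transform, which is the
    form inverted above. *)
Lemma scaled_stable_ratio_law (alpha r : R) (a01 : (0 < alpha < 1)%R) (X : {RV P >-> R}) :
  stable_ratio alpha P X -> (0 < r)%R -> forall A, measurable A ->
  P ((fun t => r `^ alpha^-1 * X t)%R @^-1` A) =
  rho_measure (\d_r : probability R R) a01 A.
Proof.
move=> Xr r0 A mA.
have mX : measurable_fun setT (X : T -> R) by exact: measurable_funPT.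
have mY : measurable_fun setT (fun t => r `^ alpha^-1 * X t)%R by exact: measurable_funM.
pose Y : {RV P >-> R} := HB.pack_for {mfun T >-> R} (fun t => r `^ alpha^-1 * X t)%R
  (isMeasurableFun.Build _ _ _ _ _ mY).
have c0 : (0 < r `^ alpha^-1)%R by exact: powR_gt0.
apply: (@stieltjes_law _ _ _ P alpha r Y a01 r0) => //.
- rewrite -(stable_ratio_gt0 Xr); congr (P _); apply/seteqP.
  by split => t /=; rewrite pmulr_rgt0.
- move=> l l0; have /andP[a0 _] := a01.
  transitivity ('E_P[fun t => ((1 + (l * r `^ alpha^-1) * X t)^-1)%R]).
    by congr expectation; apply/funext => t /=; rewrite mulrA.
  rewrite (stable_ratio_stieltjes a01 Xr) ?mulr_gt0//.
  rewrite powRM ?(ltW l0) ?(ltW c0)// -powRrM mulVf ?gt_eqF// powRr1 ?(ltW r0)//.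
  by rewrite mulrC.
Qed.

End stable_ratio.

(** * From Stieltjes transforms to log transforms *)

Section log_transform_stieltjes.
Context {R : realType}.
Local Notation mu := (@lebesgue_measure R).

Lemma integral_ln (y a b : R) : (0 < y)%R -> (0 <= a < b)%R ->
  \int[mu]_(u in `[a, b]) (y / (1 + u * y))%:E =
  (ln (1 + b * y) - ln (1 + a * y))%:E.
Proof.
move=> y0 /andP[a0 ab].
have pos (u : R) : (0 <= u)%R -> (0 < 1 + u * y)%R.
  by move=> u0; rewrite ltr_wpDr ?mulr_ge0// ltW.
have dF (u : R) : (0 <= u)%R ->
    is_derive u 1%R (fun u : R => ln (1 + u * y))%R (y / (1 + u * y))%R.
  move=> u0; have dln := is_derive1_ln (pos u u0).
  by apply: is_derive_eq; rewrite /GRing.scale/=; ring.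
have df (u : R) : (0 <= u)%R -> derivable (fun u : R => y / (1 + u * y))%R u 1%R.
  move=> u0; apply: derivableM => //; apply: derivableV => //.
  by rewrite gt_eqF// pos.
have cF (u : R) : (0 <= u)%R -> {for u, continuous (fun u : R => ln (1 + u * y))%R}.
  move=> u0; apply/differentiable_continuous/derivable1_diffP.
  by have := dF u u0 => ?; exact: ex_derive.
rewrite (@continuous_FTC2 _ _ (fun u : R => ln (1 + u * y))%R) ?EFinB//.
- apply: derivable_within_continuous => u; rewrite in_itv/= => /andP[u1 _].
  by apply: df; exact: le_trans u1.
- split.
  + move=> u; rewrite in_itv/= => /andP[u1 _].
    by have := dF u (ltW (le_lt_trans a0 u1)) => ?; exact: ex_derive.
  + by apply: cvg_at_right_filter; exact: cF.
  + by apply: cvg_at_left_filter; apply: cF; rewrite (le_trans a0)// ltW.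
- move=> u; rewrite in_itv/= => /andP[u1 _]; rewrite derive1E.
  by have := dF u (ltW (le_lt_trans a0 u1)) => ?; exact: derive_val.
Qed.

(** The quotient of the endpoint values is (1 + (1 + l) y) / (1 + y) = 1 + l y / (y + 1). *)
Lemma integral_ln_shift (y l : R) : (0 < y)%R -> (0 < l)%R ->
  \int[mu]_(u in `[1%R, (1 + l)%R]) (y / (1 + u * y))%:E =
  (ln (1 + l * (y / (y + 1))))%:E.
Proof.
move=> y0 l0; rewrite integral_ln ?ler01 ?ltrDl//.
have pos (u : R) : (0 < u)%R -> (0 < 1 + u * y)%R.
  by move=> u0; rewrite addr_gt0// mulr_gt0.
rewrite -ln_div ?posrE ?pos//; last by rewrite addr_gt0.
congr (ln _)%:E; field.
by rewrite !gt_eqF//= ?addr_gt0// addrC pos.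
Qed.

Lemma integral_ln_powR (alpha r l : R) : (0 < alpha)%R -> (0 < r)%R -> (0 < l)%R ->
  \int[mu]_(u in `[1%R, (1 + l)%R]) (r * u `^ (alpha - 1) / (1 + r * u `^ alpha))%:E =
  (alpha^-1 * (ln (1 + r * (1 + l) `^ alpha) - ln (1 + r)))%:E.
Proof.
move=> a0 r0 l0.
have pos (u : R) : (0 < u)%R -> (0 < 1 + r * u `^ alpha)%R.
  by move=> u0; rewrite addr_gt0// mulr_gt0// powR_gt0.
have dF (u : R) : (0 < u)%R -> is_derive u 1%R (fun u : R => alpha^-1 * ln (1 + r * u `^ alpha))%R
    (r * u `^ (alpha - 1) / (1 + r * u `^ alpha))%R.
  move=> u0; have dln := is_derive1_ln (pos u u0); have dp := is_derive1_powR alpha u0.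
  apply: is_derive_eq; rewrite /GRing.scale/=.
  by field; rewrite !gt_eqF// pos.
have df (u : R) : (0 < u)%R ->
    derivable (fun u : R => r * u `^ (alpha - 1) / (1 + r * u `^ alpha))%R u 1%R.
  move=> u0; have dp := is_derive1_powR alpha u0; have dp1 := is_derive1_powR (alpha - 1) u0.
  apply: derivableM; first by apply: ex_derive.
  by apply: derivableV; [rewrite gt_eqF// pos|apply: ex_derive].
have cF (u : R) : (0 < u)%R -> {for u, continuous
  (fun u : R => alpha^-1 * ln (1 + r * u `^ alpha))%R}.
  move=> u0; apply/differentiable_continuous/derivable1_diffP.
  by have := dF u u0 => ?; exact: ex_derive.
rewrite (@continuous_FTC2 _ _ (fun u : R => alpha^-1 * ln (1 + r * u `^ alpha))%R).
- by rewrite -EFinB -mulrBr powR1 mulr1.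
- by rewrite ltrDl.
- apply: derivable_within_continuous => u; rewrite in_itv/= => /andP[u1 _].
  by apply: df; exact: lt_le_trans u1.
- split.
  + move=> u; rewrite in_itv/= => /andP[u1 _].
    by have := dF u (lt_trans ltr01 u1) => ?; exact: ex_derive.
  + by apply: cvg_at_right_filter; exact: cF.
  + by apply: cvg_at_left_filter; apply: cF; rewrite addr_gt0.
- move=> u; rewrite in_itv/= => /andP[u1 _]; rewrite derive1E.
  by have := dF u (lt_trans ltr01 u1) => ?; exact: derive_val.
Qed.

Context {d : measure_display} {T : measurableType d}.
Variable P : probability T R.

Lemma measurable_ratio_one (f : T -> R) : measurable_fun setT f ->
  measurable_fun setT (fun t => f t / (f t + 1))%R.
Proof. by move=> mf; apply: measurable_fun_div => //; exact: measurable_funD. Qed.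

(* Integrating the Stieltjes transform over [1, 1 + l]. *)
Lemma stieltjes_log (alpha r l : R) (Y : T -> R) :
  (0 < alpha)%R -> (0 < r)%R -> (0 < l)%R ->
  measurable_fun setT Y -> P [set t | (0 < Y t)%R] = 1 ->
  (forall u, (0 < u)%R ->
    'E_P[fun t => ((1 + u * Y t)^-1)%R] = ((1 + r * u `^ alpha)^-1)%:E) ->
  \int[P]_t (ln (1 + l * (Y t / (Y t + 1))))%:E =
  (alpha^-1 * (ln (1 + r * (1 + l) `^ alpha) - ln (1 + r)))%:E.
Proof.
move=> a0 r0 l0 mY Y0 YS; rewrite -integral_ln_powR//.
have mY0 := measurable_gt0 mY.
pose Z t := make_positive (Y t).
have Z0 t : (0 < Z t)%R by exact: make_positive_gt0.
have mZ : measurable_fun setT Z := measurableT_comp (@measurable_make_positive R) mY.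
have mln (X : T -> R) : measurable_fun setT X ->
    measurable_fun setT (fun t => (ln (1 + l * (X t / (X t + 1))))%:E).
  move=> mX; apply/measurable_EFinP; apply: (measurableT_comp (@measurable_ln R)).
  apply: measurable_funD => //; apply: measurable_funM => //.
  exact: measurable_ratio_one.
rewrite (eq_integral_as (g := fun t => (ln (1 + l * (Z t / (Z t + 1))))%:E) mY0 Y0
  (mln _ mY) (mln _ mZ)); last first.
  by move=> t Yt; rewrite /Z make_positiveE.
pose f (z : T * measurableTypeR R) : R := (Z z.1 / (1 + z.2 * Z z.1))%R.
have mZ1 : measurable_fun setT (fun z : T * measurableTypeR R => Z z.1).
  exact: (measurableT_comp mZ).
have mf : measurable_fun setT f.
  apply: measurable_fun_div => //; apply: measurable_funD => //.
  exact: measurable_funM.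
transitivity (\int[P]_t \int[mu]_(u in `[1%R, (1 + l)%R]) (f (t, u))%:E).
  by apply: eq_integral => t _; rewrite -integral_ln_shift.
rewrite (ge0_fubini_in P mu measurableT _ mf)//; last first.
  move=> t u _ /=; rewrite in_itv/= => /andP[u1 _]; have u0 := lt_le_trans ltr01 u1.
  by rewrite divr_ge0 ?addr_ge0 ?mulr_ge0// ltW.
apply: eq_integral => u; rewrite inE/= in_itv/= => /andP[u1 _].
have u0 := lt_le_trans ltr01 u1.
have pos t : (0 < 1 + u * Z t)%R by rewrite addr_gt0// mulr_gt0.
have mV : measurable_fun setT (fun t => ((1 + u * Z t)^-1)%R).
  by apply: measurable_funV; apply: measurable_funD => //; exact: measurable_funM.
have E1 : 'E_P[fun t => ((1 + u * Z t)^-1)%R] = ((1 + r * u `^ alpha)^-1)%:E.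
  rewrite -YS// unlock; apply: (eq_integral_as mY0 Y0).
  - exact/measurable_EFinP.
  - apply/measurable_EFinP; apply: measurable_funV.
    by apply: measurable_funD => //; exact: measurable_funM.
  - by move=> t Yt; rewrite /Z make_positiveE.
have V01 t : (0 <= (1 + u * Z t)^-1 <= 1)%R.
  by rewrite invr_ge0 (ltW (pos t)) invf_le1// lerDl mulr_ge0// ltW.
(* Since z / (1 + u z) = (1 - 1 / (1 + u z)) / u, only the Stieltjes transform at u is needed. *)
transitivity ((u^-1)%:E * 'E_P[fun t => (1 - (1 + u * Z t)^-1)%R]).
  rewrite unlock -ge0_integralZl//.
  - apply: eq_integral => t _; rewrite /f/= -EFinM; congr EFin.
    have ut : (0 < u * Z t + 1)%R by rewrite addrC pos.
    by field; rewrite !gt_eqF.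
  - by apply/measurable_EFinP; exact: measurable_funB.
  - by move=> t _; rewrite lee_fin subr_ge0; have /andP[] := V01 t.
  - by rewrite lee_fin invr_ge0 ltW.
rewrite expectation_onem// E1 -EFinB -EFinM; congr EFin.
have ua : (0 < u `^ alpha)%R by exact: powR_gt0.
have -> : (u `^ (alpha - 1) = u `^ alpha * u^-1)%R.
  by rewrite powRD ?powRN ?powRr1 ?(ltW u0)//; apply/implyP => _; rewrite gt_eqF.
have ru : (0 < 1 + r * u `^ alpha)%R by rewrite addr_gt0// mulr_gt0.
by field; rewrite !gt_eqF.
Qed.

End log_transform_stieltjes.

(** * The mixture of the scaled ratios *)

Section mixture.
Context {R : realType} {d : measure_display} {T : measurableType d}.
Variables (alpha : R) (H : probability R R) (PX : probability T R) (Xa : {RV PX >-> R}).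
Hypotheses (a01 : (0 < alpha < 1)%R) (H_pos : H `]0%R, +oo[%classic = 1).
Hypothesis Xa_law : stable_ratio alpha PX Xa.
Local Notation mu := (@lebesgue_measure R).

Let mX : measurable_fun setT (Xa : T -> R). Proof. exact: measurable_funPT. Qed.

Lemma integral_positive (f : R -> \bar R) : measurable_fun setT f ->
  \int[H]_r f r = \int[H]_(r in `]0%R, +oo[) f r.
Proof.
move=> mf; rewrite [RHS]integral_mkcond.
apply: (@eq_integral_as _ _ _ H `]0%R, +oo[%classic) => //.
  by apply/measurable_restrict => //; rewrite setTI; exact: measurable_funTS.
by move=> r r0; rewrite patchE mem_set.
Qed.

(** The space that witnesses the existence of R: the law of a function of (R, X) is the H-mixture of
    its laws at fixed r. *)
Definition mixture_prob : probability (R * T)%type R := (H \x PX)%E.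
Local Notation P := mixture_prob.

Definition mixing_variable : {RV P >-> R} := HB.pack_for {mfun (R * T)%type >-> R}
  (fun z : R * T => z.1) (isMeasurableFun.Build _ _ _ _ _ (@measurable_fst _ _ R T)).

Definition ratio_variable : {RV P >-> R} := HB.pack_for {mfun (R * T)%type >-> R}
  (fun z : R * T => Xa z.2)
  (isMeasurableFun.Build _ _ _ _ _ (measurableT_comp mX (@measurable_snd _ _ R T))).

Local Notation Rv := mixing_variable.
Local Notation X := ratio_variable.

Lemma mixing_variable_law : has_law P Rv H.
Proof.
move=> A mA; have -> : Rv @^-1` A = A `*` setT.
  by apply/seteqP; split => z /=; [|case].
transitivity (H A * PX setT); first exact: product_measure1E.
by rewrite probability_setT mule1.
Qed.

Lemma ratio_variable_law : same_law P X PX Xa.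
Proof.
move=> A mA; have -> : X @^-1` A = setT `*` (Xa @^-1` A).
  by apply/seteqP; split => z /=; [|case].
have mXA : measurable (Xa @^-1` A) by rewrite -[X in measurable X]setTI; exact: mX.
transitivity (H setT * PX (Xa @^-1` A)); first exact: product_measure1E.
by rewrite probability_setT mul1e.
Qed.

Lemma mixture_independent : independent P Rv X.
Proof.
move=> A B mA mB; rewrite mixing_variable_law// ratio_variable_law//.
have -> : Rv @^-1` A `&` X @^-1` B = A `*` (Xa @^-1` B) by [].
apply: product_measure1E => //.
by rewrite -[X in measurable X]setTI; exact: mX.
Qed.

Lemma mixture_integral (g : R -> \bar R) (phi : R * T -> R) :
  measurable_fun setT g -> (forall x, 0 <= g x) -> measurable_fun setT phi ->
  \int[P]_z g (phi z) = \int[H]_(r in `]0%R, +oo[) \int[PX]_t g (phi (r, t)).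
Proof.
move=> mg g0 mphi; have mgphi : measurable_fun setT (fun z => g (phi z)).
  exact: (measurableT_comp mg).
rewrite /mixture_prob/= (fubini_tonelli1 (fun z => g (phi z)))//.
by rewrite integral_positive//; exact: measurable_fun_fubini_tonelli_F.
Qed.

Lemma mixture_law (phi : R * T -> R) A : measurable_fun setT phi -> measurable A ->
  P (phi @^-1` A) = \int[H]_(r in `]0%R, +oo[) PX ((fun t => phi (r, t)) @^-1` A).
Proof.
move=> mphi mA.
have mphiA : measurable (phi @^-1` A) by rewrite -[X in measurable X]setTI; exact: mphi.
rewrite -[phi @^-1` A]setIT -integral_indic//.
have m1 : measurable_fun setT (fun x : R => (\1_A x)%:E : \bar R) by exact/measurable_EFinP.
have := mixture_integral m1 (fun x => _) mphi.
rewrite (_ : \int[P]_z (\1_A (phi z))%:E = \int[P]_z (\1_(phi @^-1` A) z)%:E)//.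
move=> ->; last by move=> x; rewrite lee_fin.
apply: eq_integral => r _.
have mphir : measurable ((fun t => phi (r, t)) @^-1` A).
  by rewrite -[X in measurable X]setTI; apply: (measurableT_comp mphi).
by rewrite -[in RHS](setIT (_ @^-1` A)) -integral_indic.
Qed.

Definition scaled_ratio (z : R * T) : R := (Rv z `^ alpha^-1 * X z)%R.
Local Notation Y := scaled_ratio.

Lemma measurable_scaled_ratio : measurable_fun setT Y.
Proof.
apply: measurable_funM; first by apply: measurable_fun_powR; exact: measurable_fst.
exact: (measurableT_comp mX (@measurable_snd _ _ R T)).
Qed.

Lemma scaled_ratio_gt0 : P [set z | (0 < Y z)%R] = 1.
Proof.
have -> : [set z | (0 < Y z)%R] = Y @^-1` `]0%R, +oo[%classic.
  by apply/seteqP; split => z /=; rewrite in_itv/= andbT.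
rewrite (mixture_law measurable_scaled_ratio)//.
rewrite -H_pos -[in RHS](setIid `]0%R, +oo[%classic) -integral_indic//.
apply: eq_integral => r rI; rewrite indicE rI.
rewrite -[RHS](stable_ratio_gt0 Xa_law); congr (PX _); apply/seteqP.
have r0 : (0 < r)%R by move: rI; rewrite inE/= in_itv/= andbT.
by split => t /=; rewrite in_itv/= andbT /Y/= pmulr_rgt0// powR_gt0.
Qed.

(** At fixed r the variable r^(1/alpha) X has the density of the point mass at r; exchanging the
    integrals over r and x mixes these densities. *)
Lemma scaled_ratio_density : has_density P Y (rho alpha H).
Proof.
move=> A mA; rewrite (mixture_law measurable_scaled_ratio)//.
transitivity (\int[H]_(r in `]0%R, +oo[) \int[mu]_(x in A `&` `]0%R, +oo[)
    (sin (pi * alpha) / pi * rho_kernel alpha x r)%:E).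
  apply: eq_integral => r; rewrite inE/= in_itv/= andbT => r0.
  rewrite (scaled_stable_ratio_law a01 Xa_law)// /rho_measure.
  rewrite integral_mkcondr; apply: eq_integral => x _.
  rewrite patchE mem_setE in_itv/= andbT /rho; case: ifPn => // x0.
  rewrite integral_dirac//; last first.
    by apply/measurable_EFinP/measurable_funTS; exact: measurable_rho_kernel.
  by rewrite diracE mem_set/= ?in_itv/= ?r0// mul1e -EFinM.
pose f (z : R * measurableTypeR R) : R := (sin (pi * alpha) / pi * rho_kernel alpha z.2 z.1)%R.
have mf : measurable_fun setT f.
  apply: measurable_funM => //; apply: measurable_fun_div.
    by apply: measurable_funM => //; exact: measurable_fun_powR.
  apply: measurable_funD; last exact: measurable_funX.
  apply: measurable_funD; first exact: measurable_fun_powR.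
  apply: measurable_funM => //; apply: measurable_funM => //.
  by apply: measurable_funM => //; exact: measurable_fun_powR.
have sin0 : (0 <= sin (pi * alpha) / pi)%R.
  have /andP[a0 a1] := a01.
  rewrite divr_ge0 ?pi_ge0// sin_ge0_pi// mulr_ge0 ?pi_ge0 ?(ltW a0)//=.
  by rewrite ler_piMr ?pi_ge0// ltW.
rewrite (ge0_fubini_in H mu _ _ mf)//; last 2 first.
- exact: measurableI.
- move=> r x /=; rewrite in_itv/= andbT => r0 _.
  by rewrite /f/= mulr_ge0// rho_kernel_ge0// ltW.
rewrite [RHS](_ : _ = \int[mu]_(x in A `&` `]0%R, +oo[) rho alpha H x); last first.
  rewrite integral_mkcondr; apply: eq_integral => x _.
  by rewrite patchE mem_setE in_itv/= andbT /rho; case: ifP.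
apply: eq_integral => x; rewrite inE/= in_itv/= andbT => -[_ x0].
rewrite /rho x0 /f/=; under eq_integral do rewrite EFinM.
rewrite ge0_integralZl//.
- by apply/measurable_EFinP/measurable_funTS; exact: measurable_rho_kernel.
- by move=> r /=; rewrite in_itv/= andbT => r0; rewrite lee_fin rho_kernel_ge0// ltW.
Qed.

Lemma mixed_skew_lawE : has_law P (fun z => Y z / (Y z + 1))%R (mixed_skew_law alpha PX Xa H).
Proof.
move=> A mA; rewrite mixture_law//; last first.
  exact: measurable_ratio_one measurable_scaled_ratio.
apply: eq_integral => r; rewrite inE/= in_itv/= andbT => r0.
rewrite /skew_law /pushforward.
have -> : (r / (1 + r) / (1 - r / (1 + r)) = r)%R.
  have ? : (0 < 1 + r)%R by rewrite addr_gt0.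
  by field; rewrite gt_eqF//= addrK oner_neq0.
by congr (PX _); apply/seteqP; split => t /=; rewrite /Y/= addrC.
Qed.

End mixture.

(** * Lévy densities and exponential tilts *)

Section frullani.
Context {R : realType}.
Local Notation mu := (@lebesgue_measure R).

(* (1 - exp (- l s)) / s is the integral of exp (- u s) over u in [0, l]. *)
Lemma frullani (x l : R) : (0 < x)%R -> (0 <= l)%R ->
  \int[mu]_(s in `]0%R, +oo[) ((1 - expR (- (l * s))) * (s^-1 * expR (- (s / x))))%:E =
  (ln (1 + l * x))%:E.
Proof.
move=> x0; rewrite le_eqVlt => /predU1P[<-|l0].
  rewrite mul0r addr0 ln1 integral0_eq// => s _.
  by rewrite mul0r oppr0 expR0 subrr mul0r.
pose f (z : measurableTypeR R * measurableTypeR R) : R :=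
  expR (- ((z.2 + x^-1) * z.1)).
have mf : measurable_fun setT f.
  apply: measurableT_comp => //; apply: measurableT_comp => //.
  by apply: measurable_funM => //; exact: measurable_funD.
transitivity (\int[mu]_(s in `]0%R, +oo[) \int[mu]_(u in `[0%R, l]) (f (s, u))%:E).
  apply: eq_integral => s; rewrite inE/= in_itv/= andbT => s0.
  transitivity ((s^-1 * expR (- (s / x)))%:E *
      \int[mu]_(u in `[0%R, l]) (s * expR (- (s * u)))%:E).
    rewrite integral_exp_le ?ltW// -EFinM; congr EFin.
    by rewrite (mulrC l s); exact: mulrC.
  rewrite -ge0_integralZl//.
  - apply: eq_integral => u _; rewrite /f/= -EFinM; congr EFin.
    have -> : (- ((u + x^-1) * s) = - (s / x) - s * u)%R by ring.
    by rewrite expRD; field; rewrite gt_eqF.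
  - apply/measurable_EFinP/measurable_funTS; apply: measurable_funM => //.
    by apply: continuous_measurable_fun; exact: continuous_expRM.
  - by move=> u _; rewrite lee_fin mulr_ge0 ?expR_ge0// ltW.
  - by rewrite lee_fin mulr_ge0 ?expR_ge0// invr_ge0 ltW.
rewrite (ge0_fubini_in mu mu _ _ mf)//; last by move=> *; rewrite expR_ge0.
have l01 : (0 <= (0 : R) < l)%R by apply/andP.
transitivity (\int[mu]_(u in `[0%R, l]) (x / (1 + u * x))%:E); last first.
  by rewrite integral_ln// mul0r addr0 ln1 subr0.
apply: eq_integral => u; rewrite inE/= in_itv/= => /andP[u0 _].
have c0 : (0 < u + x^-1)%R by rewrite ltr_wpDl// invr_gt0.
rewrite /f/= integral_itv_obnd_cbnd; last first.
  apply/measurable_EFinP/measurable_funTS.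
  exact: (continuous_measurable_fun (@continuous_expRM R (u + x^-1)%R)).
rewrite integral_exp//; congr EFin.
have ? : (0 < 1 + u * x)%R by rewrite ltr_wpDr// mulr_ge0// ltW.
have ? : (0 < u * x + 1)%R by rewrite addrC.
by field; rewrite !gt_eqF.
Qed.

End frullani.

Section log_transform.
Context {R : realType} {d : measure_display} {T : measurableType d}.
Variables (P : probability T R) (K : {measure set R -> \bar R}) (Y : T -> R).
Hypotheses (mY : measurable_fun setT Y) (Y0 : P [set t | (0 < Y t)%R] = 1).
Hypothesis YK : has_law P Y K.
Local Notation mu := (@lebesgue_measure R).

Let mY0 := measurable_gt0 mY.

Let mln l : measurable_fun setT (fun x : R => ln (1 + l * x))%R.
Proof.
apply: (measurableT_comp (@measurable_ln R)).
by apply: measurable_funD => //; exact: measurable_funM.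
Qed.

Lemma log_transformE l : (0 <= l)%R ->
  log_transform K l = \int[P]_t (ln (1 + l * Y t))%:E.
Proof.
move=> l0; rewrite /log_transform integral_mkcond.
rewrite -(law_integral mY YK).
- apply: (eq_integral_as mY0 Y0).
  + apply: (measurableT_comp _ mY); apply/measurable_restrict => //.
    by rewrite setTI; apply/measurable_EFinP/measurable_funTS; exact: mln.
  + by apply/measurable_EFinP; exact: (measurableT_comp (mln l) mY).
  + by move=> t /= Yt; rewrite patchE mem_set//= in_itv/= andbT ltW.
- apply/measurable_restrict => //.
  by rewrite setTI; apply/measurable_EFinP/measurable_funTS; exact: mln.
- move=> x; rewrite patchE mem_setE in_itv/= andbT; case: ifPn => // x0.
  by rewrite lee_fin ln_ge0// lerDl mulr_ge0.
Qed.

Lemma log_transform_ge0 l : (0 <= l)%R -> 0 <= log_transform K l.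
Proof.
move=> l0; apply: integral_ge0 => x /=; rewrite in_itv/= andbT => x0.
by rewrite lee_fin ln_ge0// lerDl mulr_ge0.
Qed.

Lemma law_total : K setT = 1.
Proof. by rewrite -YK// preimage_setT probability_setT. Qed.

Lemma law_positive : K `[0%R, +oo[%classic = 1.
Proof.
rewrite -YK// -[RHS]Y0; apply: (eq_probability_as mY0 Y0) => //.
  by rewrite -[X in measurable X]setTI; exact: mY.
by move=> t /= Yt; rewrite in_itv/= andbT; split => // _; exact: ltW.
Qed.

Section levy.
Context {d' : measure_display} {T' : measurableType d'}.
Variables (P' : probability T' R) (L : T' -> R) (tau : R).
Hypothesis tau0 : (0 < tau)%R.

Let Z t := make_positive (Y t).
Let Z0 t : (0 < Z t)%R. Proof. exact: make_positive_gt0. Qed.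
Let mZ : measurable_fun setT Z.
Proof. exact: measurableT_comp (@measurable_make_positive R) mY. Qed.

Let thorinE s : (0 < s)%R -> thorin_levy_density P tau Y s =
  \int[P]_t (tau * (s^-1 * expR (- (s / Z t))))%:E.
Proof.
move=> s0; have mexp (X : T -> R) : measurable_fun setT X ->
    measurable_fun setT (fun t => (expR (- (s / X t)))%:E).
  move=> mX; apply/measurable_EFinP; apply: measurableT_comp => //.
  by apply: measurableT_comp => //; exact: measurable_fun_div.
rewrite /thorin_levy_density unlock.
rewrite (eq_integral_as (g := fun t => (expR (- (s / Z t)))%:E) mY0 Y0).
- rewrite -ge0_integralZl//.
  + apply: eq_integral => t _; rewrite -EFinM; congr EFin.
    by rewrite mulrA.
  + exact: mexp.
  + by rewrite lee_fin divr_ge0// ltW.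
- exact: mexp.
- exact: mexp.
- by move=> t Yt; rewrite /Z make_positiveE.
Qed.

(** Frullani's integral is applied for each outcome, with x the value of Y. *)
Let integral_thorin l : (0 <= l)%R ->
  \int[mu]_(s in `]0%R, +oo[) ((1 - expR (- (l * s)))%:E * thorin_levy_density P tau Y s) =
  tau%:E * log_transform K l.
Proof.
move=> l0; rewrite log_transformE//.
have mlnY (X : T -> R) : measurable_fun setT X ->
    measurable_fun setT (fun t => (ln (1 + l * X t))%:E).
  by move=> mX; apply/measurable_EFinP; exact: (measurableT_comp (mln l) mX).
rewrite (eq_integral_as (g := fun t => (ln (1 + l * Z t))%:E) mY0 Y0); last 3 first.
- exact: mlnY.
- exact: mlnY.
- by move=> t Yt; rewrite /Z make_positiveE.
pose f (z : measurableTypeR R * T) : R :=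
  ((1 - expR (- (l * z.1))) * (tau * (z.1^-1 * expR (- (z.1 / Z z.2)))))%R.
have mZ2 : measurable_fun setT (fun z : measurableTypeR R * T => Z z.2).
  exact: (measurableT_comp mZ).
have m1 : measurable_fun setT (fun z : measurableTypeR R * T => z.1 : R).
  exact: measurable_fst.
have mf : measurable_fun setT f.
  apply: measurable_funM.
    apply: measurable_funB => //; apply: measurableT_comp => //.
    by apply: measurableT_comp => //; exact: measurable_funM.
  apply: measurable_funM => //; apply: measurable_funM.
    exact: measurable_funV.
  apply: measurableT_comp => //; apply: measurableT_comp => //.
  exact: measurable_fun_div.
have e01 (s : R) : (0 < s)%R -> (0 <= 1 - expR (- (l * s)))%R.
  by move=> s0; rewrite subr_ge0 -expR0 ler_expR oppr_le0 mulr_ge0// ltW.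
transitivity (\int[mu]_(s in `]0%R, +oo[) \int[P]_t (f (s, t))%:E).
  apply: eq_integral => s; rewrite inE/= in_itv/= andbT => s0.
  rewrite thorinE// -ge0_integralZl//.
  - apply/measurable_EFinP; apply: measurable_funM => //; apply: measurable_funM => //.
    by apply: measurableT_comp => //; apply: measurableT_comp => //; exact: measurable_fun_div.
  - by move=> t _; rewrite lee_fin !mulr_ge0 ?expR_ge0 ?invr_ge0// ltW.
  - by rewrite lee_fin e01.
rewrite (ge0_fubini_in mu P _ measurableT mf)//; last first.
  move=> s t; rewrite /= in_itv/= andbT => s0 _.
  by rewrite /f/= !mulr_ge0 ?expR_ge0 ?invr_ge0 ?e01// ltW.
rewrite -ge0_integralZl//; last 3 first.
- exact: mlnY.
- by move=> t _; rewrite lee_fin ln_ge0// lerDl mulr_ge0// ltW.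
- by rewrite lee_fin ltW.
apply: eq_integral => t _; rewrite -(frullani (Z0 t) l0) -ge0_integralZl//.
- apply: eq_integral => s _; rewrite /f/= -EFinM; congr EFin.
  exact: mulrCA.
- apply/measurable_EFinP/measurable_funTS; apply: measurable_funM.
    apply: measurable_funB => //; apply: measurableT_comp => //.
    by apply: measurableT_comp => //; exact: measurable_funM.
  apply: measurable_funM; first exact: measurable_invR.
  by apply: measurableT_comp => //; apply: measurableT_comp => //; exact: measurable_funM.
- move=> s; rewrite /= in_itv/= andbT => s0.
  by rewrite lee_fin !mulr_ge0 ?expR_ge0 ?invr_ge0 ?e01// ltW.
- by rewrite lee_fin ltW.
Qed.

Lemma GGC_levy_density : GGC P' tau K L -> log_transform K 1 < +oo ->
  has_levy_density P' L (thorin_levy_density P tau Y).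
Proof.
move=> [L0 LK] K1.
have l0 s : (0 < s)%R -> 0 <= thorin_levy_density P tau Y s.
  move=> s0; rewrite thorinE//; apply: integral_ge0 => t _.
  by rewrite lee_fin !mulr_ge0 ?expR_ge0 ?invr_ge0// ltW.
have ml : measurable_fun (`]0%R, +oo[%classic : set (measurableTypeR R))
  (thorin_levy_density P tau Y).
  apply: measurable_funTS; apply: emeasurable_funM.
    by apply/measurable_EFinP; exact: measurable_fun_div.
  rewrite unlock.
  apply: (measurable_fun_fubini_tonelli_F
    (fun z : R * T => (expR (- (z.1 / Y z.2)))%:E)) => //.
    apply/measurable_EFinP; apply: measurableT_comp => //; apply: measurableT_comp => //.
    by apply: measurable_fun_div; [exact: measurable_fst|exact: (measurableT_comp mY)].
rewrite /has_levy_density /=; split=> //.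
- by move=> s; rewrite in_itv/= andbT; exact: l0.
(* The bound min (1, s) <= 2 (1 - exp (- s)) makes the integral at most 2 tau times the log
   transform at 1. It follows from exp (- s) <= 1 / (1 + s) and min (1, s) <= 2 s / (1 + s). *)
- apply: (@le_lt_trans _ _ (\int[mu]_(s in `]0%R, +oo[)
    (2%:E * ((1 - expR (- (1 * s)))%:E * thorin_levy_density P tau Y s)))).
    apply: ge0_le_integral => //.
    + move=> s; rewrite /= in_itv/= andbT => s0; rewrite mule_ge0 ?l0// lee_fin.
      by rewrite le_min ler01 ltW.
    + apply: emeasurable_funM => //; apply/measurable_EFinP/measurable_funTS.
      exact: measurable_minr.
    + apply: emeasurable_funM => //; apply: emeasurable_funM => //.
      apply/measurable_EFinP/measurable_funTS; apply: measurable_funB => //.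
      by apply: measurableT_comp => //; apply: measurableT_comp => //; exact: measurable_funM.
    + move=> s; rewrite /= in_itv/= andbT => s0; rewrite [leRHS]muleA; apply: lee_wpmul2r;
        first exact: l0.
      rewrite -EFinM lee_fin mul1r.
      have s1 : (0 < 1 + s)%R by rewrite addr_gt0.
      have e1 : (expR (- s) <= (1 + s)^-1)%R.
        by rewrite expRN lef_pV2 ?posrE ?expR_gt0// expR_ge1Dx.
      have e2 : (s / (1 + s) = 1 - (1 + s)^-1)%R by field; rewrite gt_eqF.
      have e3 : (minr 1 s <= 2 * (s / (1 + s)))%R.
        rewrite mulrA ler_pdivlMr//; have [?|?] := leP 1%R s; nra.
      by apply: le_trans e3 _; rewrite e2 ler_pM2l// lerB.
  rewrite ge0_integralZl//.
  + rewrite integral_thorin// lte_mul_pinfty// ?lee_fin//.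
    by rewrite lte_mul_pinfty// lee_fin ltW.
  + apply: emeasurable_funM => //.
    apply/measurable_EFinP/measurable_funTS; apply: measurable_funB => //.
    by apply: measurableT_comp => //; apply: measurableT_comp => //; exact: measurable_funM.
  + move=> s; rewrite /= in_itv/= andbT => s0; rewrite mule_ge0 ?l0// lee_fin mul1r.
    by rewrite subr_ge0 -expR0 ler_expR oppr_le0 ltW.
- by move=> l l0'; rewrite LK// integral_thorin.
Qed.

End levy.
End log_transform.

Lemma expectation_gt0 {R : realType} {d : measure_display} {T : measurableType d}
    (P : probability T R) (f : T -> R) : measurable_fun setT f ->
  (forall t, 0 < f t)%R -> 0 < 'E_P[f].
Proof.
move=> mf f0; rewrite unlock lt0e integral_ge0 ?andbT; last first.
  by move=> t _; rewrite lee_fin ltW.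
apply/eqP => f_eq0.
have /(ae_eq_integral_abs P measurableT) : measurable_fun setT (EFin \o f).
  exact/measurable_EFinP.
move=> -[+ _]; rewrite (_ : \int[P]_t _ = 0); last first.
  rewrite -f_eq0; apply: eq_integral => t _; rewrite /= ger0_norm// ltW//.
move=> /(_ erefl) [N [mN N0 NT]].
have : P setT <= P N.
  apply: le_measure; rewrite ?inE// => t _; apply: NT => /= /(_ I).
  by case=> ft; have := f0 t; rewrite ft ltxx.
by rewrite N0 leNgt => /negP; apply; rewrite probability_setT.
Qed.

(* Otherwise E[exp (- L)] = 0. *)
Lemma GGC_log_transform_fin {R : realType} {d : measure_display} {T : measurableType d}
    (P : probability T R) (L : {RV P >-> R}) (K : {measure set R -> \bar R}) (tau : R) :
  (0 < tau)%R -> GGC P tau K L -> log_transform K 1 < +oo.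
Proof.
move=> tau0 [_ /(_ 1%R ler01) LE]; rewrite ltey; apply/negP => /eqP Ky.
move: LE; rewrite Ky mulry gtr0_sg// mul1e /= => LE.
have mL : measurable_fun setT (fun t => expR (- (1 * L t)))%R.
  apply: measurableT_comp => //; apply: measurableT_comp => //.
  by apply: measurable_funM => //; exact: measurable_funPT.
have := expectation_gt0 P mL (fun t => expR_gt0 _).
by rewrite LE ltxx.
Qed.

Lemma measurable_ge0 {R : realType} {d : measure_display} {T : measurableType d}
    (X : T -> R) : measurable_fun setT X -> measurable [set t | (0 <= X t)%R].
Proof.
move=> mX; rewrite (_ : [set t | _] = X @^-1` `[0%R, +oo[%classic).
  by rewrite -[X in measurable X]setTI; exact: mX.
by apply/seteqP; split => t /=; rewrite in_itv/= andbT.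
Qed.

Section law_proportional.
Context {R : realType} {d : measure_display} {T : measurableType d}.
Variables (P : probability T R) (X : {RV P >-> R}) (w : R -> R) (c : R).
Variable mu : {measure set R -> \bar R}.
Hypotheses (c0 : (0 < c)%R) (w0 : forall x, (0 <= w x)%R) (mw : measurable_fun setT w).
Hypothesis XE : forall A : set R, measurable A ->
  P (X @^-1` A) = c%:E * \int[mu]_(x in A) (w x)%:E.

Lemma law_proportional_integral (g : R -> R) :
  measurable_fun setT g -> (forall x, 0 <= g x)%R ->
  \int[P]_t (g (X t))%:E = c%:E * \int[mu]_x (g x * w x)%:E.
Proof.
move=> mg g0.
have mgE : measurable_fun setT (EFin \o g) by exact/measurable_EFinP.
rewrite -(ge0_integral_distribution X mgE)//.
rewrite (@integral_density _ _ _ mu (distribution P X) (fun x => c * w x)%R)//; last 3 first.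
- by move=> x; rewrite mulr_ge0// ltW.
- exact: measurable_funM.
- move=> A mA; transitivity (c%:E * \int[mu]_(x in A) (w x)%:E); first exact: XE.
  rewrite -ge0_integralZl//.
  + by apply/measurable_EFinP; exact: measurable_funTS.
  + by move=> x _; rewrite lee_fin.
  + by rewrite lee_fin ltW.
rewrite -ge0_integralZl//.
- by apply: eq_integral => x _; rewrite -EFinM mulrCA.
- by apply/measurable_EFinP; exact: measurable_funM.
- by move=> x _; rewrite lee_fin mulr_ge0.
- by rewrite lee_fin ltW.
Qed.

End law_proportional.

Lemma expeR_oppMD {R : realType} (t : R) (x y : \bar R) : 0 <= x -> 0 <= y ->
  expeR (- (t%:E * (x + y))) = expeR (- (t%:E * x)) * expeR (- (t%:E * y)).
Proof.
move=> x0 y0; have [t0|t0] := leP 0%R t.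
  rewrite ge0_muleDr// oppeD ?expeRD// ge0_adde_def// inE mule_ge0//.
have nt0 : (0 <= - t)%R by rewrite oppr_ge0 ltW.
have E z : - (t%:E * z) = (- t)%:E * z by rewrite EFinN mulNe.
by rewrite !E ge0_muleDr// expeRD.
Qed.

(** * From Y to Y / (Y + 1): shifts of log transforms and exponential tilts *)

Section ratio.
Context {R : realType} {d : measure_display} {T : measurableType d}.
Variables (P : probability T R) (K K' : {measure set R -> \bar R}) (Y : T -> R).
Hypotheses (mY : measurable_fun setT Y) (Y0 : P [set t | (0 < Y t)%R] = 1).
Hypotheses (YK : has_law P Y K) (YK' : has_law P (fun t => Y t / (Y t + 1))%R K').

Let mY0 := measurable_gt0 mY.
Let mY' := measurable_ratio_one mY.

Let Z t := make_positive (Y t).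
Let Z0 t : (0 < Z t)%R. Proof. exact: make_positive_gt0. Qed.
Let mZ : measurable_fun setT Z.
Proof. exact: measurableT_comp (@measurable_make_positive R) mY. Qed.
Let mZ' := measurable_ratio_one mZ.

Lemma ratio_one_gt0 : P [set t | (0 < Y t / (Y t + 1))%R] = 1.
Proof.
rewrite -[RHS]Y0; apply: (eq_probability_as mY0 Y0) => //.
  exact: measurable_gt0.
by move=> t /= Yt; split => // _; rewrite divr_gt0// addr_gt0.
Qed.

Let mln l (X : T -> R) : measurable_fun setT X ->
  measurable_fun setT (fun t => (ln (1 + l * X t))%:E).
Proof.
move=> mX; apply/measurable_EFinP; apply: (measurableT_comp (@measurable_ln R)).
by apply: measurable_funD => //; exact: measurable_funM.
Qed.

Let intZ l (h : R -> R) : measurable_fun setT h ->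
  \int[P]_t (ln (1 + l * h (Y t)))%:E = \int[P]_t (ln (1 + l * h (Z t)))%:E.
Proof.
move=> mh; apply: (eq_integral_as mY0 Y0).
- by apply: mln; exact: (measurableT_comp mh mY).
- by apply: mln; exact: (measurableT_comp mh mZ).
- by move=> t Yt; rewrite /Z make_positiveE.
Qed.

Let mratio : measurable_fun setT (fun x : R => x / (x + 1))%R.
Proof. exact: measurable_ratio_one. Qed.

(** The reason is 1 + (1 + l) y = (1 + y) (1 + l y / (y + 1)). It is used with [rho_measure] for the
    tilt and with H itself for the Dirichlet mean of shape theta. *)
Lemma log_transform_shift l : (0 <= l)%R ->
  log_transform K (1 + l) = log_transform K 1 + log_transform K' l.
Proof.
move=> l0; rewrite (log_transformE mY Y0 YK) ?addr_ge0// (log_transformE mY Y0 YK)//.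
rewrite (log_transformE mY' ratio_one_gt0 YK')// !(intZ _
  (@measurable_id _ R setT)) (intZ _ mratio).
rewrite -ge0_integralD//.
- apply: eq_integral => t _; rewrite -EFinD -lnM ?posrE.
  + have z1 : (0 < Z t + 1)%R by rewrite addr_gt0.
    by congr (ln _)%:E; field; rewrite gt_eqF.
  + by rewrite addr_gt0// mul1r.
  + by rewrite ltr_wpDr// mulr_ge0// divr_ge0// ?addr_ge0// ltW.
- by move=> t _; rewrite lee_fin ln_ge0// lerDl mul1r ltW.
- exact: mln.
- move=> t _; rewrite lee_fin ln_ge0// lerDl mulr_ge0// divr_ge0// ?addr_ge0// ltW//.
- exact: mln.
Qed.

Lemma log_transform_ratio_fin l : (0 <= l)%R -> log_transform K' l < +oo.
Proof.
move=> l0; rewrite (log_transformE mY' ratio_one_gt0 YK')// (intZ _ mratio).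
apply: (@le_lt_trans _ _ (\int[P]_t (ln (1 + l))%:E)).
  apply: ge0_le_integral => //.
  - by move=> t _; rewrite lee_fin ln_ge0// lerDl mulr_ge0// divr_ge0// ?addr_ge0// ltW.
  - exact: mln.
  - move=> t _; rewrite lee_fin ler_ln ?posrE.
    + rewrite lerD2l ler_piMr// ler_pdivrMr ?mul1r ?lerDl//.
      by rewrite addr_gt0.
    + by rewrite ltr_wpDr// mulr_ge0// divr_ge0// ?addr_ge0// ltW.
    + by rewrite ltr_wpDr.
by have := expectation_cst P (ln (1 + l)); rewrite unlock => ->; rewrite ltry.
Qed.

Lemma ratio_base_measure : base_measure K'.
Proof.
split; [exact: (law_total YK')|exact: (law_positive mY' ratio_one_gt0 YK')|].
exact: log_transform_ratio_fin.
Qed.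

(** The Laplace transform of the tilt at l is that of L at 1 + l, up to a constant, and the log
    transform at 1 + l splits off the term at 1. *)
Lemma GGC_exp_tilt {dL : measure_display} {TL : measurableType dL}
    (PL : probability TL R) (L : {RV PL >-> R})
    {dt : measure_display} {Tt : measurableType dt}
    (Pt : probability Tt R) (Lt : {RV Pt >-> R}) (tau : R) : (0 < tau)%R ->
  GGC PL tau K L -> exp_tilt 1%R PL L Pt Lt ->
  GGC Pt tau K' Lt.
Proof.
move=> tau0 [L0 LK] [c c0 LtE].
have mw : measurable_fun setT (fun x : R => expR (- (1 * x)))%R.
  by apply: measurableT_comp => //; apply: measurableT_comp => //; exact: measurable_funM.
have w0 (x : R) : (0 <= expR (- (1 * x)))%R by exact: expR_ge0.
have tilt (g : R -> R) : measurable_fun setT g -> (forall x, 0 <= g x)%R ->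
    \int[Pt]_t (g (Lt t))%:E = c%:E * \int[PL]_t (g (L t) * expR (- (1 * L t)))%:E.
  move=> mg g0; rewrite (law_proportional_integral c0 w0 mw LtE mg g0); congr (_ * _).
  rewrite (ge0_integral_distribution L (f := fun x => (g x * expR (- (1 * x)))%:E))//.
    by apply/measurable_EFinP; exact: measurable_funM.
  by move=> x; rewrite lee_fin mulr_ge0.
have mLt : measurable_fun setT (Lt : Tt -> R) by exact: measurable_funPT.
have mL : measurable_fun setT (L : TL -> R) by exact: measurable_funPT.
have laplace l : (0 <= l)%R -> 'E_Pt[fun t => expR (- (l * Lt t))] =
    c%:E * expeR (- (tau%:E * log_transform K 1)) * expeR (- (tau%:E * log_transform K' l)).
  move=> l0; rewrite unlock (tilt (fun x => expR (- (l * x))))//; last first.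
    by apply: measurableT_comp => //; apply: measurableT_comp => //; exact: measurable_funM.
  rewrite -muleA; congr (_ * _).
  transitivity ('E_PL[fun t => expR (- ((1 + l) * L t))]).
    rewrite unlock; apply: eq_integral => t _; congr EFin.
    by rewrite -expRD -opprD addrC -mulrDl.
  by rewrite LK ?addr_ge0// log_transform_shift// expeR_oppMD// log_transform_ge0.
have K'0 : log_transform K' 0 = 0.
  by apply: integral0_eq => x _; rewrite mul0r addr0 ln1.
(* The transform at l = 0 determines the normalizing constant. *)
have c1 : c%:E * expeR (- (tau%:E * log_transform K 1)) = 1.
  have := laplace 0%R (lexx _); rewrite K'0 mule0 oppe0 expeR0 mule1 => <-.
  have E1 := expectation_cst Pt 1%R; rewrite -[RHS]E1 unlock.
  by apply: eq_integral => t _; rewrite mul0r oppr0 expR0.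
split; last by move=> l l0; rewrite laplace// c1 mul1e.
have mge0 := measurable_ge0 mLt.
have m1 : measurable_fun setT (\1_`[0%R, +oo[%classic : R -> R) by [].
have indE (dd : measure_display) (TT : measurableType dd) (X : TT -> R) t :
    \1_`[0%R, +oo[%classic (X t) = \1_[set t | (0 <= X t)%R] t :> R.
  by rewrite !indicE !mem_setE in_itv/= andbT.
rewrite -[X in Pt X]setIT -integral_indic//.
transitivity (\int[Pt]_t (\1_`[0%R, +oo[%classic (Lt t))%:E).
  by apply: eq_integral => t _; rewrite indE.
(* P (Lt >= 0) is c times the integral of exp (- L) over L >= 0, an almost sure event; so it equals
   the total mass. *)
rewrite tilt// -c1.
congr (_ * _); rewrite -LK// unlock.
apply: (eq_integral_as (measurable_ge0 mL) L0).
- apply/measurable_EFinP; apply: measurable_funM.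
    exact: (measurableT_comp m1 mL).
  exact: (measurableT_comp mw mL).
- by apply/measurable_EFinP; exact: (measurableT_comp mw mL).
- by move=> t /= Lt0; rewrite indicE mem_set ?mul1r//= in_itv/= Lt0.
Qed.

End ratio.

Section independence.
Context {R : realType} {d : measure_display} {T : measurableType d}.
Variable P : probability T R.

Lemma independent_comp (X Y : T -> R) (f : R -> R) : measurable_fun setT f ->
  independent P X Y -> independent P (fun t => f (X t)) Y.
Proof.
move=> mf XY A B mA mB; have mfA : measurable (f @^-1` A).
  by rewrite -[X in measurable X]setTI; exact: mf.
exact: XY mfA mB.
Qed.

Lemma independent_joint_eq (V W X : {RV P >-> R}) (A : set (R * R)) :
  independent P V X -> independent P W X -> has_law P V (distribution P W) ->
  measurable A -> P [set t | A (V t, X t)] = P [set t | A (W t, X t)].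
Proof.
move=> VX WX VW mA; rewrite !independent_joint//.
rewrite /product_measure1; apply: eq_measure_integral => B mB _.
exact: VW.
Qed.

End independence.

Lemma powR_div {R : realType} (x y c : R) : (0 <= x)%R -> (0 < y)%R ->
  ((x / y) `^ c = x `^ c / y `^ c)%R.
Proof.
move=> x0 y0; rewrite powRM ?invr_ge0 ?(ltW y0)//.
by rewrite -[(y^-1)%R]powR_inv1 ?(ltW y0)// -powRrM mulN1r powRN.
Qed.

Lemma occupation_ratioE {R : realType} (x y c : R) : (0 < x)%R -> (x < 1)%R ->
  (x `^ c * y / (x `^ c * y + (1 - x) `^ c) =
   (x / (1 - x)) `^ c * y / ((x / (1 - x)) `^ c * y + 1))%R.
Proof.
move=> x0 x1; have y0 : (0 < 1 - x)%R by rewrite subr_gt0.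
rewrite powR_div ?(ltW x0)//.
have : (0 < (1 - x) `^ c)%R by exact: powR_gt0.
move: ((1 - x) `^ c)%R (x `^ c)%R => b a b0.
have -> : (a / b * y + 1 = (a * y + b) / b)%R by field; rewrite gt_eqF.
by rewrite invfM invrK; move: (a * y + b)^-1%R => k; field; rewrite gt_eqF.
Qed.

(** * Variables xi whose odds have law H *)

Section mixture.
Context {R : realType} {d : measure_display} {T : measurableType d}.
Variables (alpha : R) (H : probability R R) (PX : probability T R) (Xa : {RV PX >-> R}).
Hypotheses (a01 : (0 < alpha < 1)%R) (H_pos : H `]0%R, +oo[%classic = 1).
Hypothesis Xa_law : stable_ratio alpha PX Xa.

Local Notation P := (mixture_prob H PX).
Local Notation Rv := (mixing_variable H PX).
Local Notation X := (ratio_variable H Xa).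
Local Notation Y := (scaled_ratio alpha H Xa).

Let mY : measurable_fun setT Y. Proof. exact: measurable_scaled_ratio. Qed.
Let Y0 : P [set z | (0 < Y z)%R] = 1. Proof. exact: scaled_ratio_gt0. Qed.
Let mYr r : measurable_fun setT (fun t => Y (r, t)).
Proof. by rewrite /scaled_ratio/=; apply: measurable_funM. Qed.

Lemma scaled_ratio_log (l : R) : (0 < l)%R ->
  \int[P]_z (ln (1 + l * (Y z / (Y z + 1))))%:E =
  \int[H]_(r in `]0%R, +oo[)
    (alpha^-1 * (ln (1 + r * (1 + l) `^ alpha) - ln (1 + r)))%:E.
Proof.
move=> l0; have /andP[a0 _] := a01.
(* The absolute value makes the integrand nonnegative off the positive half-line too. *)
pose g (x : R) : \bar R := `|ln (1 + l * x)|%:E.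
have mg : measurable_fun setT g.
  apply/measurable_EFinP; apply: measurableT_comp => //.
  apply: (measurableT_comp (@measurable_ln R)).
  by apply: measurable_funD => //; exact: measurable_funM.
have mln (dd : measure_display) (TT : measurableType dd) (Z : TT -> R) : measurable_fun setT Z ->
    measurable_fun setT (fun t => (ln (1 + l * (Z t / (Z t + 1))))%:E).
  move=> mZ; apply/measurable_EFinP; apply: (measurableT_comp (@measurable_ln R)).
  apply: measurable_funD => //; apply: measurable_funM => //.
  exact: measurable_ratio_one.
have gE (y : R) : (0 < y)%R -> (ln (1 + l * (y / (y + 1))))%:E = g (y / (y + 1))%R.
  move=> y0; rewrite /g ger0_norm// ln_ge0// lerDl mulr_ge0// ?ltW// divr_gt0// addr_gt0//.
have mYP := measurable_ratio_one mY.
transitivity (\int[P]_z g (Y z / (Y z + 1))%R).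
  apply: (eq_integral_as (measurable_gt0 mY) Y0).
  - exact: mln.
  - exact: (measurableT_comp mg mYP).
  - by move=> z /= Yz; rewrite gE.
rewrite (mixture_integral PX H_pos (phi := fun z => Y z / (Y z + 1))%R mg); [|by move=> x;
  rewrite lee_fin|exact: mYP].
apply: eq_integral => r; rewrite inE/= in_itv/= andbT => r0.
have c0 : (0 < r `^ alpha^-1)%R by exact: powR_gt0.
have YrE t : Y (r, t) = (r `^ alpha^-1 * Xa t)%R by [].
have Yr0 : PX [set t | (0 < Y (r, t))%R] = 1.
  rewrite -(stable_ratio_gt0 Xa_law); congr (PX _); apply/seteqP.
  by split => t /=; rewrite YrE pmulr_rgt0.
rewrite -(stieltjes_log a0 r0 l0 (mYr r) Yr0).
- apply: (eq_integral_as (measurable_gt0 (mYr r)) Yr0).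
  + exact: (measurableT_comp mg (measurable_ratio_one (mYr r))).
  + exact: mln (mYr r).
  + by move=> t /= Yt; rewrite gE.
- move=> u u0.
  transitivity ('E_PX[fun t => ((1 + (u * r `^ alpha^-1) * Xa t)^-1)%R]).
    by congr expectation; apply/funext => t /=; rewrite YrE mulrA.
  rewrite (stable_ratio_stieltjes a01 Xa_law) ?mulr_gt0//.
  rewrite powRM ?(ltW u0) ?(ltW c0)// -powRrM mulVf ?gt_eqF// powRr1 ?(ltW r0)//.
  by rewrite mulrC.
Qed.

Let Rv0 : P [set z | (0 < Rv z)%R] = 1.
Proof.
rewrite -H_pos -(mixing_variable_law H PX)//; congr (P _).
by apply/seteqP; split => z /=; rewrite in_itv/= andbT.
Qed.

Let mRv : measurable_fun setT (Rv : R * T -> R). Proof. exact: measurable_funPT. Qed.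

Lemma odds_variable_exists : exists xi : {RV P >-> R}, odds_variable P H X xi.
Proof.
have mxi : measurable_fun setT (fun z => Rv z / (Rv z + 1))%R by exact: measurable_ratio_one.
pose xi : {RV P >-> R} := HB.pack_for {mfun (R * T)%type >-> R}
  (fun z => Rv z / (Rv z + 1))%R (isMeasurableFun.Build _ _ _ _ _ mxi).
exists xi; split.
- rewrite -[RHS]Rv0; apply: (eq_probability_as (measurable_gt0 mRv) Rv0).
  + by rewrite -[X in measurable X]setTI; apply: (mxi).
  + exact: measurable_gt0.
  + move=> z /= Rz; split=> // _; rewrite in_itv/= divr_ge0 ?addr_ge0 ?(ltW Rz)//=.
    by rewrite ler_pdivrMr ?addr_gt0// mul1r lerDl.
- apply: (@independent_comp _ _ _ P Rv X (fun x => x / (x + 1))%R).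
    exact: measurable_ratio_one.
  exact: mixture_independent.
- move=> A mA; rewrite -(mixing_variable_law H PX)//.
  apply: (eq_probability_as (measurable_gt0 mRv) Rv0).
  + rewrite -[X in measurable X]setTI; apply: measurable_fun_div => //.
    exact: measurable_funB.
  + by rewrite -[X in measurable X]setTI; exact: mRv.
  + move=> z /= Rz; have -> //: (Rv z / (Rv z + 1) / (1 - Rv z / (Rv z + 1)) = Rv z)%R.
    have R1 : (0 < Rv z + 1)%R by rewrite addr_gt0.
    move: (Rv z) R1 => r R1; have -> : (1 - r / (r + 1) = (r + 1)^-1)%R by field; rewrite gt_eqF.
    by rewrite invrK divfK// gt_eqF.
Qed.

(** At both endpoints the odds are 0, since division by 0 gives 0, and H gives no mass to 0. *)
Lemma odds_variable_interior (xi : {RV P >-> R}) : odds_variable P H X xi ->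
  P [set z | (0 < xi z < 1)%R] = 1.
Proof.
move=> [xi01 _ xiH].
have mxi : measurable_fun setT (xi : R * T -> R) by exact: measurable_funPT.
have mV : measurable_fun setT (fun z => xi z / (1 - xi z))%R.
  by apply: measurable_fun_div => //; exact: measurable_funB.
have mi : measurable (xi @^-1` `[0%R, 1%R]) by rewrite -[X in measurable X]setTI; exact: mxi.
have V0 : P [set z | (0 < xi z / (1 - xi z))%R] = 1.
  rewrite -H_pos -xiH//; congr (P _).
  by apply/seteqP; split => z /=; rewrite in_itv/= andbT.
rewrite -(setI_probability1 mi (measurable_gt0 mV) xi01 V0).
apply: (eq_probability_as mi xi01).
- rewrite (_ : [set z | _] = xi @^-1` `]0%R, 1%R[); last first.
    by apply/seteqP; split => z /=; rewrite in_itv.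
  by rewrite -[X in measurable X]setTI; exact: mxi.
- exact: measurableI (measurable_gt0 mV).
- move=> z /=; rewrite in_itv/= => /andP[x0 x1]; split.
  + by move=> /andP[x0' x1']; split; [exact/andP|rewrite divr_gt0// subr_gt0].
  + move=> [_ V]; apply/andP; split; rewrite lt_neqAle ?x0 ?x1 andbT.
      by apply: contraTneq V => <-; rewrite mul0r ltxx.
    by apply: contraTneq V => ->; rewrite subrr invr0 mulr0 ltxx.
Qed.

Lemma measurable_occupation_ratio (xi : {RV P >-> R}) :
  measurable_fun setT (occupation_ratio alpha xi X).
Proof.
have mxi : measurable_fun setT (xi : R * T -> R) by exact: measurable_funPT.
have mxiX : measurable_fun setT (fun z => xi z `^ alpha^-1 * X z)%R.
  by apply: measurable_funM => //; exact: measurable_fun_powR.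
rewrite /occupation_ratio; apply: measurable_fun_div => //; apply: measurable_funD => //.
by apply: measurable_fun_powR; exact: measurable_funB.
Qed.

(** Here xi is any variable with these odds, not the one built from R. For 0 < xi < 1 the occupation
    ratio is a function of the odds and of X, and by independence the pair (odds, X) has the joint
    law of (R, X). *)
Lemma occupation_ratio_law (xi : {RV P >-> R}) : odds_variable P H X xi ->
  same_law P (occupation_ratio alpha xi X) P (fun z => Y z / (Y z + 1))%R.
Proof.
move=> xiP A mA; have xi01 := odds_variable_interior xiP; case: xiP => _ xiX xiH.
have mxi : measurable_fun setT (xi : R * T -> R) by exact: measurable_funPT.
have mV : measurable_fun setT (fun z => xi z / (1 - xi z))%R.
  by apply: measurable_fun_div => //; exact: measurable_funB.
pose V : {RV P >-> R} := HB.pack_for {mfun (R * T)%type >-> R}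
  (fun z => xi z / (1 - xi z))%R (isMeasurableFun.Build _ _ _ _ _ mV).
pose g (x : R * R) : R := (x.1 `^ alpha^-1 * x.2 / (x.1 `^ alpha^-1 * x.2 + 1))%R.
have mg : measurable_fun setT g.
  apply: measurable_ratio_one; apply: measurable_funM; last exact: measurable_snd.
  by apply: measurable_fun_powR; exact: measurable_fst.
have mgA : measurable (g @^-1` A) by rewrite -[X in measurable X]setTI; exact: mg.
have VX : independent P V X.
  apply: (@independent_comp _ _ _ P xi X (fun x => x / (1 - x))%R) => //.
  by apply: measurable_fun_div => //; exact: measurable_funB.
have VR : has_law P V (distribution P Rv).
  by move=> B mB; rewrite xiH// -(mixing_variable_law H PX).
have := independent_joint_eq VX (mixture_independent H Xa) VR mgA.
rewrite /= => E; transitivity (P ((fun t => g (V t, X t)) @^-1` A)); last exact: E.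
have mgVX : measurable_fun setT (fun t => g (V t, X t)).
  by apply: (measurableT_comp mg); apply: measurable_fun_pair; exact: measurable_funPT.
have mi : measurable [set z | (0 < xi z < 1)%R].
  rewrite (_ : [set z | _] = xi @^-1` `]0%R, 1%R[); last first.
    by apply/seteqP; split => z /=; rewrite in_itv.
  by rewrite -[X in measurable X]setTI; exact: mxi.
apply: (eq_probability_as mi xi01).
- by rewrite -[X in measurable X]setTI; exact: (measurable_occupation_ratio xi).
- by rewrite -[X in measurable X]setTI; exact: mgVX.
- move=> z /= /andP[x0 x1].
  have E1 : occupation_ratio alpha xi X z = g (V z, X z) by exact: occupation_ratioE.
  rewrite E1; exact: iff_refl.
Qed.

Lemma occupation_ratio_gt0 (xi : {RV P >-> R}) : odds_variable P H X xi ->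
  P [set z | (0 < occupation_ratio alpha xi X z)%R] = 1.
Proof.
move=> xiP; rewrite -(ratio_one_gt0 mY Y0).
have E (Z : R * T -> R) : [set z | (0 < Z z)%R] = Z @^-1` `]0%R, +oo[%classic.
  by apply/seteqP; split => z /=; rewrite in_itv/= andbT.
rewrite !E; exact: occupation_ratio_law xiP _ _.
Qed.

End mixture.

(** * Dirichlet means *)

Section conditional_law.
Context {R : realType} {d : measure_display} {T : measurableType d}.
Variable P : probability T R.

(** The law of A is the mixture of the k p under the law of Y; it is written as the composition of k
    with a constant kernel on the one-point space, so that the integral formula for compositions
    applies. *)
Lemma conditional_law_integral (A Y : {RV P >-> R}) (k : R.-pker R ~> R) (g : R -> \bar R) :
  conditional_law P A Y k -> measurable_fun setT g -> (forall x, 0 <= g x) ->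
  \int[P]_t g (A t) = \int[distribution P Y]_p \int[k p]_x g x.
Proof.
move=> AY mg g0.
pose l := @kprobability _ _ unit R R (cst (distribution P Y : pprobability R R))
  (@measurable_cst _ _ unit _ setT _).
pose mu : {measure set R -> \bar R} := kcomp l (kernel.kernel_snd k) tt.
rewrite (@law_integral _ _ _ P A mu)//; last first.
  move=> B mB; rewrite -[A @^-1` B]setTI -(preimage_setT Y).
  exact: AY.
exact: (integral_kcomp l (kernel.kernel_snd k) tt g0 mg).
Qed.

End conditional_law.

(** With t = x / (x + 1), concavity of ln between 1 and 1 + l gives t ln (1 + l) <= ln (1 + l t),
    and t <= x. *)
Lemma ln_ratio_le {R : realType} (l x : R) : (0 <= l)%R -> (0 < x)%R ->
  (ln (1 + l) * (x / (x + 1)) <= ln (1 + l * x))%R.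
Proof.
move=> l0 x0; have x1 : (0 < x + 1)%R by rewrite addr_gt0.
have t01 : (0 <= x / (x + 1) <= 1)%R.
  by rewrite divr_ge0 ?(ltW x0) ?(ltW x1)//= ler_pdivrMr// mul1r lerDl.
have l1 : (0 < 1 + l)%R by rewrite ltr_pwDl.
have := @concave_ln R (Itv01 (andP t01).1 (andP t01).2) (1 + l)%R 1%R l1 ltr01.
rewrite !convRE/= ln1 mulr0 addr0 mulrC => /le_trans; apply.
have tx : (x / (x + 1) <= x)%R by rewrite ler_pdivrMr// ler_peMr ?(ltW x0)// lerDr ltW.
have /andP[t0 _] := t01; move: (x / (x + 1))%R t0 tx => t t0 tx.
have -> : (t * (1 + l) + (1 - t) * 1 = 1 + l * t)%R by ring.
have pos y : (0 <= y)%R -> (0 < 1 + l * y)%R by move=> y0; rewrite ltr_wpDr// mulr_ge0.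
by rewrite ler_ln ?posrE ?pos ?(ltW x0)// lerD2l ler_wpM2l.
Qed.

Section dirichlet.
Context {R : realType}.
Variables (H : probability R R) (H_pos : H `]0%R, +oo[%classic = 1).

Let H0 : H [set x | (0 < x)%R] = 1.
Proof.
rewrite -H_pos; congr (H _).
by apply/seteqP; split => x /=; rewrite in_itv/= andbT.
Qed.

Let mid : measurable_fun [set: R] (fun x : R => x). Proof. exact: measurable_id. Qed.

Let H_id : has_law H (fun x : R => x) H. Proof. by []. Qed.

Let H_odds : has_law H (fun x => x / (x + 1))%R (odds_law H). Proof. by []. Qed.

Lemma odds_law_base_measure : base_measure (odds_law H).
Proof. exact: ratio_base_measure mid H0 H_odds. Qed.

Lemma log_transform_odds l : (0 <= l)%R ->
  log_transform H (1 + l) = log_transform H 1 + log_transform (odds_law H) l.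
Proof. exact: log_transform_shift mid H0 H_id H_odds l. Qed.

Lemma log_transform_positive l : (0 <= l)%R ->
  log_transform H l = \int[H]_(x in `]0%R, +oo[) (ln (1 + l * x))%:E.
Proof.
move=> l0; rewrite (log_transformE mid H0 H_id)// integral_positive//.
apply/measurable_EFinP; apply: (measurableT_comp (@measurable_ln R)).
by apply: measurable_funD => //; exact: measurable_funM.
Qed.

(** The constant is the mean of x / (x + 1) under H. The resulting logarithmic growth in l is what
    excludes an atom of the Dirichlet mean at 0. *)
Lemma log_transform_ge_ln : exists2 m : R, (0 < m)%R &
  forall l, (0 <= l)%R -> (ln (1 + l) * m)%:E <= log_transform H l.
Proof.
pose Z (x : R) := make_positive x.
have Z0 x : (0 < Z x)%R by exact: make_positive_gt0.
have mZ : measurable_fun setT Z by exact: measurable_make_positive.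
have mZ' := measurable_ratio_one mZ.
have t0 x : (0 < Z x / (Z x + 1))%R by rewrite divr_gt0// addr_gt0.
have m0 := expectation_gt0 H mZ' t0.
have E l : (0 <= l)%R -> (ln (1 + l))%:E * 'E_H[fun x => (Z x / (Z x + 1))%R] <= log_transform H l.
  move=> l0; have mln (X : R -> R) : measurable_fun setT X ->
      measurable_fun setT (fun x => (ln (1 + l * X x))%:E).
    move=> mX; apply/measurable_EFinP; apply: (measurableT_comp (@measurable_ln R)).
    by apply: measurable_funD => //; exact: measurable_funM.
  rewrite (log_transformE mid H0 H_id)//.
  rewrite (eq_integral_as (g := fun x => (ln (1 + l * Z x))%:E) (measurable_gt0 mid) H0);
    last 3 first.
  - exact: mln.
  - exact: mln.
  - by move=> x x0; rewrite /Z make_positiveE.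
  rewrite unlock -ge0_integralZl//.
  - apply: ge0_le_integral => //.
    + by move=> x _; rewrite -EFinM lee_fin mulr_ge0 ?ln_ge0 ?lerDl// ltW.
    + by apply: emeasurable_funM => //; exact/measurable_EFinP.
    + exact: mln.
    + by move=> x _; rewrite -EFinM lee_fin ln_ratio_le.
  - exact/measurable_EFinP.
  - by move=> x _; rewrite lee_fin ltW.
  - by rewrite lee_fin ln_ge0// lerDl.
move: m0 E; move: ('E_H[_]) => [m m0 E| |//].
- by exists m => // l /E; rewrite -EFinM.
(* If the mean were infinite, then so would be the log transform at every l > 0, and any constant
   would do. *)
- move=> _ E; exists 1%R => // l l0; rewrite mulr1.
  have [->|l_neq0] := eqVneq l 0%R.
    rewrite addr0 ln1 (log_transformE mid H0 H_id)//.
    by rewrite integral0_eq// => x _; rewrite mul0r addr0 ln1.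
  have := E l l0; rewrite gt0_muley ?lte_fin ?ln_gt0// ?ltrDl ?lt0r ?l_neq0//.
  by rewrite leye_eq => /eqP ->; rewrite leey.
Qed.

Context {d : measure_display} {T : measurableType d}.
Variables (P : probability T R) (M : {RV P >-> R}) (theta : R).
Hypotheses (theta0 : (0 < theta)%R) (MH : dirichlet_mean P theta H M).

(** The integrand (1 + l M)^(- theta) is 1 on the event M = 0, so its probability is at most exp (-
    theta m ln (1 + l)) for every l = exp s - 1, and this tends to 0. *)
Lemma dirichlet_mean_gt0 : P [set t | (0 < M t)%R] = 1.
Proof.
have [M0 MS] := MH; have [m m0 Hm] := log_transform_ge_ln.
have mM : measurable_fun setT (M : T -> R) by exact: measurable_funPT.
pose B := M @^-1` [set 0%R].
have mB : measurable B by rewrite -[X in measurable X]setTI; exact: mM.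
have PB s : (0 <= s)%R -> P B <= (expR (- (theta * (s * m))))%:E.
  move=> s0; have l0 : (0 <= expR s - 1)%R by rewrite subr_ge0 -expR0 ler_expR.
  have := MS _ l0; have := Hm _ l0; rewrite addrC subrK expRK => Hs Ms.
  apply: (@le_trans _ _ (expeR (- (theta%:E * log_transform H (expR s - 1))))); last first.
    have -> : (expR (- (theta * (s * m))))%:E = expeR (- (theta * (s * m)))%:E by [].
    rewrite lee_expeR EFinN leeN2 EFinM.
    by apply: lee_wpmul2l => //; rewrite lee_fin ltW.
  rewrite -Ms unlock -[B]setIT -integral_indic//.
  have mpow : measurable_fun setT (fun t => (1 + (expR s - 1) * M t) `^ (- theta))%R.
    apply: measurable_fun_powR; apply: measurable_funD => //.
    exact: measurable_funM.
  apply: ge0_le_integral => //.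
  - exact/measurable_EFinP.
  - exact/measurable_EFinP.
  - move=> t _; rewrite lee_fin indicE; have [|_] := boolP (t \in B).
      by rewrite inE => /= ->; rewrite mulr0 addr0 powR1.
    exact: powR_ge0.
have PB0 : P B = 0.
  have PBf : P B \is a fin_num by exact: fin_num_measure.
  have PBE := fineK PBf; have r0 : (0 <= fine (P B))%R by exact: fine_ge0.
  rewrite -PBE; congr EFin; apply/eqP; rewrite eq_le r0 andbT leNgt; apply/negP => q0.
  set q := fine (P B) in PBE q0.
  (* This s makes the exponent - 1 / q, and exp (- 1 / q) < q contradicts the bound on q = P (M =
     0). *)
  have := PB (q^-1 / (theta * m))%R.
  rewrite divr_ge0 ?invr_ge0 ?(ltW q0) ?mulr_ge0 ?(ltW theta0) ?(ltW m0)// => /(_ isT).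
  have -> : (theta * (q^-1 / (theta * m) * m) = q^-1)%R by field; rewrite !gt_eqF.
  rewrite -PBE lee_fin leNgt => /negP; apply.
  rewrite expRN invf_plt ?posrE ?expR_gt0//.
  by apply: lt_le_trans (expR_ge1Dx _); rewrite ltrDr.
have PBC : P (~` B) = 1 by rewrite probability_setC// PB0 sube0.
rewrite -[RHS]PBC; apply: (eq_probability_as (measurable_ge0 mM) M0).
- exact: measurable_gt0.
- exact: measurableC.
- move=> t /= Mt; rewrite lt0r Mt andbT /B/=.
  by split => [/eqP|/eqP].
Qed.

Let mM : measurable_fun setT (M : T -> R). Proof. exact: measurable_funPT. Qed.

Context {dA : measure_display} {TA : measurableType dA}.
Variables (PA : probability TA R) (xi : {RV PA >-> R}).
Hypothesis xiM : size_biased_odds PA theta xi P M.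

Let mxi : measurable_fun setT (xi : TA -> R). Proof. exact: measurable_funPT. Qed.

(** For u = m / (m + 1) one has 1 - u = 1 / (1 + m), so the bias becomes the factor (1 + M)^(-
    theta) under the law of M. *)
Lemma size_biased_integral : exists2 c : R, (0 < c)%R &
  forall g : R -> R, measurable_fun setT g -> (forall x, 0 <= g x)%R ->
  \int[PA]_t (g (xi t))%:E =
  c%:E * \int[P]_t (g (M t / (M t + 1)) * (1 + M t) `^ (- theta))%R%:E.
Proof.
have [c c0 xiE] := xiM; exists c => // g mg g0.
have mw : measurable_fun setT (fun u : R => (1 - u) `^ theta)%R.
  by apply: measurable_fun_powR; exact: measurable_funB.
have w0 (u : R) : (0 <= (1 - u) `^ theta)%R by exact: powR_ge0.
rewrite (law_proportional_integral c0 w0 mw xiE mg g0); congr (_ * _).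
have mgw : measurable_fun setT (fun u => (g u * (1 - u) `^ theta)%R%:E).
  by apply/measurable_EFinP; exact: measurable_funM.
have gw0 u : 0 <= (g u * (1 - u) `^ theta)%R%:E by rewrite lee_fin mulr_ge0.
rewrite (ge0_integral_distribution odds_to_prob mgw gw0).
rewrite (ge0_integral_distribution M (f := fun x => (g (odds_to_prob x) * (1 - odds_to_prob x) `^ theta)%R%:E)); last 2 first.
- exact: (measurableT_comp mgw (@measurable_odds_to_prob R)).
- by move=> x; exact: gw0.
apply: (eq_integral_as (measurable_gt0 mM) dirichlet_mean_gt0).
- exact: (measurableT_comp mgw (measurable_ratio_one mM)).
- apply/measurable_EFinP; apply: measurable_funM.
    exact: (measurableT_comp mg (measurable_ratio_one mM)).
  by apply: measurable_fun_powR; exact: measurable_funD.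
- move=> t /= Mt; rewrite /odds_to_prob; congr ((_ * _)%R%:E).
  have M1 : (0 < 1 + M t)%R by rewrite addr_gt0.
  have -> : (1 - M t / (M t + 1) = 1 / (1 + M t))%R.
    by field; rewrite !gt_eqF// addrC.
  by rewrite powR_div// powR1 div1r powRN.
Qed.

(** The laws of the bridges are prescribed only for 0 < p < 1. The indicator of this interval and
    the constant 1 have the same biased integral, because 0 < M / (M + 1) < 1 almost surely. *)
Lemma size_biased_interior : PA [set t | (0 < xi t < 1)%R] = 1.
Proof.
have [c c0 E] := size_biased_integral.
have mi : measurable [set t | (0 < xi t < 1)%R].
  rewrite (_ : [set z | _] = xi @^-1` `]0%R, 1%R[); last first.
    by apply/seteqP; split => z /=; rewrite in_itv.
  by rewrite -[X in measurable X]setTI; exact: mxi.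
have E1 : \int[PA]_t 1%:E = 1 by have := expectation_cst PA 1%R; rewrite unlock.
rewrite -[X in PA X]setIT -integral_indic// -E1.
transitivity (\int[PA]_t (\1_`]0%R, 1%R[%classic (xi t) : R)%:E).
  apply: eq_integral => t _; rewrite !indicE; congr ((nat_of_bool _)%:R%:E).
rewrite (E (\1_`]0%R, 1%R[%classic))//.
rewrite (E (cst 1%R))//; congr (_ * _).
have mpow : measurable_fun setT (fun t => (1 + M t) `^ (- theta))%R.
  by apply: measurable_fun_powR; exact: measurable_funD.
apply: (eq_integral_as (measurable_gt0 mM) dirichlet_mean_gt0).
- apply/measurable_EFinP; apply: measurable_funM => //.
  by apply: (measurableT_comp (f := \1_`]0%R, 1%R[%classic : R -> R)) => //;
    exact: measurable_ratio_one.
- by apply/measurable_EFinP; exact: measurable_funM.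
- move=> t /= Mt; rewrite indicE mem_set//= in_itv/= divr_gt0 ?addr_gt0//=.
  by rewrite ltr_pdivrMr ?addr_gt0// mul1r ltrDl.
Qed.

(** For u = m / (m + 1) one has (1 - u + u l) (1 + m) = 1 + l m, so the transform of xi is that of M
    up to a constant. The formula serves both Dirichlet means: with 1 + l in place of l for xi, and
    with (1 + l)^alpha for the bridge. The increment of the log transform from 1 to l is passed as
    W, with no subtraction of extended reals. *)
Lemma size_biased_stieltjes (l : R) (W : \bar R) : (0 <= l)%R -> 0 <= W ->
  log_transform H l = log_transform H 1 + W ->
  'E_PA[fun t => ((1 - xi t + xi t * l) `^ (- theta))%R] = expeR (- (theta%:E * W)).
Proof.
move=> l0 W0 HW; have [c c0 E] := size_biased_integral.
have [M0 MS] := MH.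
have key u : (0 <= u)%R -> 'E_PA[fun t => ((1 - xi t + xi t * u) `^ (- theta))%R] =
    c%:E * expeR (- (theta%:E * log_transform H u)).
  move=> u0; rewrite unlock.
  have mg : measurable_fun setT (fun x : R => (1 - x + x * u) `^ (- theta))%R.
    apply: measurable_fun_powR; apply: measurable_funD; last exact: measurable_funM.
    exact: measurable_funB.
  have g0 (x : R) : (0 <= (1 - x + x * u) `^ (- theta))%R by exact: powR_ge0.
  rewrite (E _ mg g0) -MS// unlock; congr (_ * _).
  apply: (eq_integral_as (measurable_gt0 mM) dirichlet_mean_gt0).
  - apply/measurable_EFinP; apply: measurable_funM.
      exact: (measurableT_comp mg (measurable_ratio_one mM)).
    by apply: measurable_fun_powR; exact: measurable_funD.
  - apply/measurable_EFinP; apply: measurable_fun_powR.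
    by apply: measurable_funD => //; exact: measurable_funM.
  - move=> t /= Mt; move: (M t) Mt => x x0.
    have x1 : (0 < 1 + x)%R by rewrite addr_gt0.
    rewrite -powRM.
    + congr (_ `^ _)%R%:E.
      by field; rewrite gt_eqF// addrC.
    + rewrite addr_ge0//; last by rewrite mulr_ge0// divr_ge0// ?addr_ge0// ltW.
      by rewrite subr_ge0 ler_pdivrMr ?addr_gt0// mul1r lerDl.
    + exact: ltW.
(* At l = 1 the left side is the expectation of 1, which determines the constant. *)
have c1 : c%:E * expeR (- (theta%:E * log_transform H 1)) = 1.
  have E1 := expectation_cst PA 1%R; rewrite -key// -[RHS]E1 unlock.
  by apply: eq_integral => t _; rewrite mulr1 subrK powR1.
rewrite key// HW expeR_oppMD ?log_transform_ge0//.
by rewrite muleA c1 mul1e.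
Qed.

Let mi01 : measurable [set t | (0 < xi t < 1)%R].
Proof.
rewrite (_ : [set z | _] = xi @^-1` `]0%R, 1%R[); last first.
  by apply/seteqP; split => z /=; rewrite in_itv.
by rewrite -[X in measurable X]setTI; exact: mxi.
Qed.

Lemma size_biased_dirichlet_mean : dirichlet_mean PA theta (odds_law H) xi.
Proof.
have xi01 := size_biased_interior.
split.
- rewrite -[RHS]xi01; apply: (eq_probability_as mi01 xi01) => //.
    exact: measurable_ge0.
  by move=> t /= t01; split => // _; have /andP[/ltW] := t01.
- move=> l l0; rewrite -(size_biased_stieltjes _ _ (log_transform_odds l0)) ?addr_ge0//.
    by congr expectation; apply/funext => t; congr (_ `^ _)%R; ring.
  exact: log_transform_ge0.
Qed.

Variables (alpha : R) (K : {measure set R -> \bar R}) (A : {RV PA >-> R}) (k : R.-pker R ~> R).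
Hypothesis alpha0 : (0 < alpha)%R.
Hypothesis bridge : forall p : R, (0 < p < 1)%R -> bridge_occupation_law alpha theta p (k p).
Hypothesis Axi : conditional_law PA A xi k.
Hypothesis HK : forall l, (0 <= l)%R ->
  log_transform H ((1 + l) `^ alpha) = log_transform H 1 + alpha%:E * log_transform K l.

Let dist01 : distribution PA xi `]0%R, 1%R[%classic = 1.
Proof.
rewrite -size_biased_interior /= /pushforward; congr (PA _).
Qed.

Lemma bridge_ge0 : PA [set t | (0 <= A t)%R] = 1.
Proof.
have mA : measurable_fun setT (A : TA -> R) by exact: measurable_funPT.
have mi : measurable (`[0%R, 1%R]%classic : set R) by [].
have A1 : PA (A @^-1` `[0%R, 1%R]%classic) = 1.
  transitivity (\int[distribution PA xi]_(p in setT) k p `[0%R, 1%R]%classic).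
    by rewrite -(Axi mi measurableT) preimage_setT setTI.
  have E1 := expectation_cst (distribution PA xi) 1%R; rewrite -[RHS]E1 unlock.
  apply: (@eq_integral_as _ _ _ (distribution PA xi) `]0%R, 1%R[%classic) => //.
  - exact: measurable_kernel.
  - by apply/measurable_EFinP; exact: measurable_cst.
  - by move=> p /=; rewrite in_itv/= => p01; have [] := bridge p01.
have mA01 : measurable (A @^-1` `[0%R, 1%R]%classic).
  by rewrite -[X in measurable X]setTI; exact: mA.
rewrite -[RHS]A1; apply: (eq_probability_as mA01 A1) => //.
  exact: measurable_ge0.
by move=> t At; split => // _; move: At; rewrite /= in_itv/= => /andP[].
Qed.

(** Given xi = p, the transform of A is (1 - p + p (1 + l)^alpha)^(- theta), so that the average
    over xi is [size_biased_stieltjes] at (1 + l)^alpha. The factor alpha in [HK] joins theta to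
    give the shape alpha theta. *)
Lemma bridge_dirichlet_mean : dirichlet_mean PA (alpha * theta)%R K A.
Proof.
split; first exact: bridge_ge0.
move=> l l0.
pose g (x : R) : \bar R := ((1 + l * x) `^ (- (alpha * theta)))%R%:E.
have mg : measurable_fun setT g.
  by apply/measurable_EFinP; apply: measurable_fun_powR; apply: measurable_funD => //.
have g0 x : 0 <= g x by rewrite lee_fin powR_ge0.
pose h (p : R) : \bar R := ((1 - p + p * (1 + l) `^ alpha) `^ (- theta))%R%:E.
have mh : measurable_fun setT h.
  apply/measurable_EFinP; apply: measurable_fun_powR; apply: measurable_funD.
    exact: measurable_funB.
  exact: measurable_funM.
have h0 x : 0 <= h x by rewrite lee_fin powR_ge0.
transitivity (\int[distribution PA xi]_p h p).
  rewrite unlock (conditional_law_integral Axi mg g0).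
  apply: (@eq_integral_as _ _ _ (distribution PA xi) `]0%R, 1%R[%classic) => //.
    by apply: measurable_fun_integral_kernel => // U; exact: measurable_kernel.
  by move=> p /=; rewrite in_itv/= => p01; have [_ /(_ l l0)] := bridge p01.
rewrite (ge0_integral_distribution xi mh h0).
have := size_biased_stieltjes (powR_ge0 (1 + l) alpha) _ (HK l0).
rewrite unlock => ->.
- by rewrite muleA -EFinM (mulrC theta).
- by apply: mule_ge0; [rewrite lee_fin ltW|exact: log_transform_ge0].
Qed.

End dirichlet.

Section mixture.
Context {R : realType} {d : measure_display} {T : measurableType d}.
Variables (alpha : R) (H : probability R R) (PX : probability T R) (Xa : {RV PX >-> R}).
Hypotheses (a01 : (0 < alpha < 1)%R) (H_pos : H `]0%R, +oo[%classic = 1).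
Hypothesis Xa_law : stable_ratio alpha PX Xa.

Local Notation P := (mixture_prob H PX).
Local Notation Y := (scaled_ratio alpha H Xa).

Let mY : measurable_fun setT Y. Proof. exact: measurable_scaled_ratio. Qed.
Let Y0 : P [set z | (0 < Y z)%R] = 1. Proof. exact: scaled_ratio_gt0. Qed.

(** The integrated Stieltjes transform, averaged over r and put in additive form: all terms are
    nonnegative extended reals. *)
Lemma log_transform_powR l : (0 <= l)%R ->
  log_transform H ((1 + l) `^ alpha) =
  log_transform H 1 + alpha%:E * log_transform (mixed_skew_law alpha PX Xa H) l.
Proof.
rewrite le_eqVlt => /predU1P[<-|l0].
  rewrite addr0 powR1 [X in alpha%:E * X]integral0_eq ?mule0 ?adde0// => x _.
  by rewrite mul0r addr0 ln1.
have /andP[a0 _] := a01.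
have l1 : (1 <= (1 + l) `^ alpha)%R.
  by rewrite -[leLHS](powRr0 (1 + l)) ler_powR ?(ltW a0)// lerDl ltW.
rewrite !(log_transform_positive H_pos) ?powR_ge0//.
rewrite (log_transformE (measurable_ratio_one mY) (ratio_one_gt0 mY Y0)
  (mixed_skew_lawE alpha Xa H_pos)) ?(ltW l0)//.
rewrite (scaled_ratio_log a01 H_pos Xa_law l0).
have mln (u : R) : measurable_fun (`]0%R, +oo[%classic : set R) (fun x => ln (1 + u * x))%R.
  apply: measurable_funTS; apply: (measurableT_comp (@measurable_ln R)).
  by apply: measurable_funD => //; exact: measurable_funM.
have ge (r : R) : (0 < r)%R -> (0 <= ln (1 + r * (1 + l) `^ alpha) - ln (1 + r))%R.
  move=> r0; rewrite subr_ge0 ler_ln ?posrE ?addr_gt0 ?mulr_gt0 ?(lt_le_trans ltr01 l1)//.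
  by rewrite lerD2l ler_peMr// ltW.
rewrite -ge0_integralZl//; last 3 first.
- apply/measurable_EFinP; apply: measurable_funM => //.
  apply: measurable_funTS; apply: measurable_funB; apply: (measurableT_comp (@measurable_ln R)).
    by apply: measurable_funD => //; exact: measurable_funM.
  exact: measurable_funD.
- move=> r /=; rewrite in_itv/= andbT => r0.
  by rewrite lee_fin mulr_ge0 ?ge// invr_ge0 ltW.
- by rewrite lee_fin ltW.
rewrite -ge0_integralD//.
- apply: eq_integral => r; rewrite inE/= in_itv/= andbT => r0.
  rewrite -EFinM -EFinD; congr EFin; rewrite mul1r mulVKf ?gt_eqF//.
  by rewrite [RHS]addrC subrK mulrC.
- move=> r /=; rewrite in_itv/= andbT => r0.
  by rewrite lee_fin ln_ge0// lerDl mul1r ltW.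
- exact/measurable_EFinP.
- move=> r /=; rewrite in_itv/= andbT => r0.
  by rewrite -EFinM lee_fin mulrA mulfV ?gt_eqF// mul1r ge.
- apply/measurable_EFinP; apply: measurable_funM => //; apply: measurable_funM => //.
  apply: measurable_funTS; apply: measurable_funB; apply: (measurableT_comp (@measurable_ln R)).
    by apply: measurable_funD => //; exact: measurable_funM.
  exact: measurable_funD.
Qed.

End mixture.

Theorem proposition5p4 (R : realType) (alpha theta : R)
  (a01 : (0 < alpha < 1)%R) (theta_gt0 : (0 < theta)%R)
  (H : probability R R) (H_pos : H `]0%R, +oo[%classic = 1)
  (H_base : base_measure H)
  (dX : measure_display) (TX : measurableType dX) (PX : probability TX R)
  (Xa : {RV PX >-> R}) (Xa_law : stable_ratio alpha PX Xa)
  (dL : measure_display) (TL : measurableType dL) (PL : probability TL R)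
  (L : {RV PL >-> R})
  (L_GGC : GGC PL (alpha * theta)%R (rho_measure H a01) L) :
  (exists (d : measure_display) (T : measurableType d) (P : probability T R)
      (Rv X : {RV P >-> R}),
    let Y := fun t => (Rv t `^ alpha^-1 * X t)%R in
    [/\ has_law P Rv H, same_law P X PX Xa & independent P Rv X] /\
    [/\ has_density P Y (rho alpha H),
        base_measure (rho_measure H a01) &
        has_levy_density PL L (thorin_levy_density P (alpha * theta)%R Y)] /\
    [/\ has_law P (fun t => Y t / (Y t + 1))%R (mixed_skew_law alpha PX Xa H),
        base_measure (mixed_skew_law alpha PX Xa H),
        exists xi : {RV P >-> R}, odds_variable P H X xi &
        forall xi : {RV P >-> R}, odds_variable P H X xi ->
          same_law P (occupation_ratio alpha xi X)
                   P (fun t => Y t / (Y t + 1))%R] /\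
    forall (dt : measure_display) (Tt : measurableType dt)
        (Pt : probability Tt R) (Lt : {RV Pt >-> R}), exp_tilt 1%R PL L Pt Lt ->
      GGC Pt (alpha * theta)%R (mixed_skew_law alpha PX Xa H) Lt /\
      forall xi : {RV P >-> R}, odds_variable P H X xi ->
        has_levy_density Pt Lt
          (thorin_levy_density P (alpha * theta)%R
             (occupation_ratio alpha xi X))) /\
  (forall (dM : measure_display) (TM : measurableType dM)
      (PM : probability TM R) (M : {RV PM >-> R}), dirichlet_mean PM theta H M ->
    forall (dA : measure_display) (TA : measurableType dA)
      (PA : probability TA R) (xi A : {RV PA >-> R}) (k : R.-pker R ~> R),
    size_biased_odds PA theta xi PM M ->
    (forall p : R, (0 < p < 1)%R -> bridge_occupation_law alpha theta p (k p)) ->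
    conditional_law PA A xi k ->
    dirichlet_mean PA (alpha * theta)%R (mixed_skew_law alpha PX Xa H) A /\
    base_measure (odds_law H) /\ dirichlet_mean PA theta (odds_law H) xi).

Proof.
have /andP[a0 a1] := a01.
have tau0 : (0 < alpha * theta)%R by rewrite mulr_gt0.
pose P := mixture_prob H PX; pose Y := scaled_ratio alpha H Xa.
have mY : measurable_fun setT Y by exact: measurable_scaled_ratio.
have Y0 : P [set z | (0 < Y z)%R] = 1 by exact: scaled_ratio_gt0.
have Y_rho : has_law P Y (rho_measure H a01).
  exact: (scaled_ratio_density a01 H_pos Xa_law).
have Y_skew := mixed_skew_lawE alpha Xa H_pos.
have log1 := GGC_log_transform_fin tau0 L_GGC.
split.
- exists _, _, P, (mixing_variable H PX), (ratio_variable H Xa).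
  split; [|split; [|split]].
  + split; [exact: mixing_variable_law|exact: ratio_variable_law|].
    exact: mixture_independent.
  + split; first exact: (scaled_ratio_density a01 H_pos Xa_law).
      by split; [exact: (law_total Y_rho)|exact: (law_positive mY Y0 Y_rho)|].
    exact: (GGC_levy_density mY Y0 Y_rho tau0 L_GGC).
  + split; [exact: Y_skew|exact: (ratio_base_measure mY Y0 Y_skew)| |].
      exact: odds_variable_exists.
    by move=> xi; exact: occupation_ratio_law.
  + move=> dt Tt Pt Lt tilt.
    have Lt_GGC := GGC_exp_tilt mY Y0 Y_rho Y_skew tau0 L_GGC tilt.
    split=> // xi xiP.
    have xi_skew : has_law P (occupation_ratio alpha xi (ratio_variable H Xa))
        (mixed_skew_law alpha PX Xa H).
      by move=> A mA; rewrite (occupation_ratio_law alpha H_pos xiP mA); exact: Y_skew mA.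
    apply: (GGC_levy_density _ _ xi_skew tau0 Lt_GGC).
    * exact: measurable_occupation_ratio.
    * exact: (occupation_ratio_gt0 H_pos Xa_law xiP).
    * exact: (log_transform_ratio_fin mY Y0 Y_skew).
- move=> dM TM PM M MH dA TA PA xi A k xiM bridge Axi.
  split; [|split].
  + apply: (bridge_dirichlet_mean H_pos theta_gt0 MH xiM a0 bridge Axi) => l.
    exact: log_transform_powR.
  + exact: odds_law_base_measure.
  + exact: (size_biased_dirichlet_mean H_pos theta_gt0 MH xiM).
Qed.
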